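(* Let $V$ be a vertex operator algebra of CFT type with Zhu algebra $\mathsf{A}$, and let $\mathsf{M}$ be a simple $\mathsf{A}$-module. The following are equivalent: (a) the canonical maps $\psi_{\mathsf{M}}:\Phi^{\mathsf L}(\mathsf{M})\to\Phi^{\mathsf L}({}^\theta\mathsf{M}^\vee)'$ and $\psi^\vee_{\mathsf{M}}:\Phi^{\mathsf L}({}^\theta\mathsf{M}^\vee)\to\Phi^{\mathsf L}(\mathsf{M})'$ are isomorphisms; (b) $\Phi^{\mathsf L}(\mathsf{M})$ and $\Phi^{\mathsf L}({}^\theta\mathsf{M}^\vee)$ are simple ordinary modules and $\mathsf{M}$ is finite-dimensional.
   Context: $V=\bigoplus_{n\in\mathbb{N}}V_n$ is a vertex operator algebra over $\mathbb{C}$ of CFT type ($\mathbb{N}=\mathbb{Z}_{\ge0}$-graded, $\dim V_n<\infty$, $\dim V_0=1$) with conformal vector $\omega$, $Y(\omega,z)=\sum L_nz^{-n-2}$. Universal enveloping algebra: $\mathscr{U}=\bigoplus_{k\in\mathbb{Z}}\mathscr{U}_k$ is the graded unital associative algebra topologically generated by symbols $a_{[n]}$ ($a\in V$, $n\in\mathbb{Z}$, linear in $a$), with $a_{[n]}$ of degree $\deg a-n-1$ for homogeneous $a$. It is obtained from the universal enveloping algebra of the Lie algebra $(V\otimes\mathbb{C}[t,t^{-1}])/\mathrm{im}(L_{-1}\otimes1+1\otimes\tfrac{d}{dt})$, where $a_{[n]}$ is the class of $a\otimes t^n$ and $[a_{[m]},b_{[n]}]=\sum_{j\ge0}\binom mj(a_{(j)}b)_{[m+n-j]}$,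 by completing each graded piece with respect to the subspaces (left ideal generated by degrees $\le -N$), $N\to\infty$, and imposing $\mathbf{1}_{[-1]}=1$ and $(a_{(-1)}b)_{[n]}=\sum_{j<0}a_{[j]}b_{[n-j-1]}+\sum_{j\ge0}b_{[n-j-1]}a_{[j]}$. Write $\mathscr{U}_{\le-1}=\bigoplus_{k\le-1}\mathscr{U}_k$. Modules: an admissible $V$-module is a weak $V$-module $W=\bigoplus_{d\in\mathbb{N}}W_d$ with $a_{(n)}W_d\subseteq W_{d+\deg a-n-1}$; $\mathscr{U}$ acts via $a_{[n]}\mapsto a_{(n)}$. It is simple if nonzero with no nonzero proper graded submodules. A module is ordinary if it is the direct sum of finite-dimensional $L_0$-eigenspaces $W_{(\lambda)}$ with, for each $\lambda$, $W_{(\lambda+n)}=0$ for all integers $n\ll0$. Zhu algebra: $\mathsf{A}=\mathscr{U}_0/(\mathscr{U}\cdot\mathscr{U}_{\le-1})_0$, canonically isomorphic to Zhu's algebra of $V$. $\mathsf{A}$-modules are left modules; $W_0$ is an $\mathsf{A}$-module for $W$ admissible. Induction: $\Phi^{\mathsf L}(\mathsf{M})=(\mathscr{U}/\mathscr{U}\cdot\mathscr{U}_{\le-1})\otimes_{\mathscr{U}_0}\mathsf{M}$, an admissible module with degree-$0$ part $\mathsf{M}$; graded $V$-module maps $\Phi^{\mathsf L}(\mathsf{M})\to W$ correspond to $\mathsf{A}$-module maps $\mathsf{M}\to W_0$ (universal property). Duals: $\theta$ is the anti-automorphism of $\mathscr{U}$ with $\theta(a_{[\deg a-1+n]})=(-1)^{\deg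 a}\sum_{i\ge0}\frac1{i!}(L_1^ia)_{[\deg a-i-1-n]}$; it sends $\mathscr{U}_k$ to $\mathscr{U}_{-k}$ and induces an anti-involution $\theta$ of $\mathsf{A}$. For an $\mathsf{A}$-module $\mathsf{M}$, ${}^\theta\mathsf{M}^\vee$ is the linear dual $\mathsf{M}^\vee$ with $(a\cdot f)(m)=f(\theta(a)m)$. For an admissible $W$, the contragredient $W'=\bigoplus_d(W_d)^\vee$ has action $(u\cdot f)(w)=f(\theta(u)w)$. Since $(\Phi^{\mathsf L}(\mathsf{M})')_0={}^\theta\mathsf{M}^\vee$, the identity map induces $\psi^\vee_{\mathsf{M}}:\Phi^{\mathsf L}({}^\theta\mathsf{M}^\vee)\to\Phi^{\mathsf L}(\mathsf{M})'$; since $(\Phi^{\mathsf L}({}^\theta\mathsf{M}^\vee)')_0={}^{\theta}({}^\theta\mathsf{M}^{\vee})^\vee=\mathsf{M}^{\vee\vee}$, the canonical map $\mathsf{M}\to\mathsf{M}^{\vee\vee}$ induces $\psi_{\mathsf{M}}:\Phi^{\mathsf L}(\mathsf{M})\to\Phi^{\mathsf L}({}^\theta\mathsf{M}^\vee)'$. *)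

(* Defs.v *)
From HB Require Import structures.
From mathcomp Require Import all_boot all_order all_algebra.
From mathcomp Require Import boolp classical_sets functions.
From mathcomp Require Import reals.
From mathcomp Require Import complex.
From mathcomp Require monalg.
From mathcomp Require Import zify ring.

Set Implicit Arguments.
Unset Strict Implicit.
Unset Printing Implicit Defensive.

Import GRing.Theory.
Import monalg.

Local Open Scope classical_set_scope.
Local Open Scope ring_scope.
Local Open Scope quotient_scope.

(** * Linear algebra *)

(* Unital associative K-algebras, given by a central ring morphism scal from K.
   Unlike algType, they may be zero, so that the quotients below need no proof
   of nontriviality. *)
HB.mixin Record isPzAlgebra (K : pzRingType) A of GRing.PzRing A := {
  scal : K -> A;
  scalD : {morph scal : k l / k + l};
  scalM : {morph scal : k l / k * l};
  scal1 : scal 1 = 1;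
  scalC : forall (k : K) (x : A), scal k * x = x * scal k
}.
#[short(type="pzAlgType")]
HB.structure Definition PzAlgebra (K : pzRingType) :=
  {A of isPzAlgebra K A & GRing.PzRing A}.

Section LinearAlgebra.
Variables (K : pzRingType) (W : lmodType K).

Definition subspace (S : set W) : Prop :=
  S 0 /\ forall k x y, S x -> S y -> S (k *: x + y).

(* W is the internal direct sum of the subspaces P i. *)
Definition direct_sum (I : eqType) (P : I -> set W) : Prop :=
  [/\ forall i, subspace (P i),
      forall w, exists (s : seq I) (f : I -> W),
        (forall i, P i (f i)) /\ w = \sum_(i <- s) f i
    & forall (s : seq I) (f : I -> W), uniq s -> (forall i, P i (f i)) ->
        \sum_(i <- s) f i = 0 -> forall i, i \in s -> f i = 0].

Definition findim (S : set W) : Prop :=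
  exists (n : nat) (b : 'I_n -> W), forall w, S w ->
    exists c : 'I_n -> K, w = \sum_(i < n) c i *: b i.

End LinearAlgebra.

(* A module over a K-algebra B, viewed as a K-vector space. *)
Definition restr (K : pzRingType) (B : pzAlgType K) (W : lmodType B) : Type := W.

Section Restriction.
Variables (K : pzRingType) (B : pzAlgType K) (W : lmodType B).

HB.instance Definition _ := GRing.Zmodule.copy (restr W) W.

Let rscale (k : K) (w : restr W) : restr W := (scal k : B) *: (w : W).

Let rscaleA a b v : rscale a (rscale b v) = rscale (a * b) v.
Proof. by rewrite /rscale scalerA -scalM. Qed.
Let rscale1 : left_id 1 rscale.
Proof. by move=> v; rewrite /rscale scal1 scale1r. Qed.
Let rscaleDr : right_distributive rscale +%R.
Proof. by move=> a u v; rewrite /rscale scalerDr. Qed.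
Let rscaleDl v : {morph rscale^~ v : a b / a + b}.
Proof. by move=> a b; rewrite /rscale scalD scalerDl. Qed.

HB.instance Definition _ := GRing.Zmodule_isLmodule.Build K (restr W)
  rscaleA rscale1 rscaleDr rscaleDl.

End Restriction.

(** * Quotient of an algebra by the two-sided ideal generated by a set *)

Section QuotientAlgebra.
Variables (K : pzRingType) (B : pzAlgType K) (S : set B).

Inductive ideal : set B :=
| ideal_gen p x q : S x -> ideal (p * x * q)
| ideal_0 : ideal 0
| ideal_add x y : ideal x -> ideal y -> ideal (x + y).

Lemma ideal_mul p x q : ideal x -> ideal (p * x * q).
Proof.
elim=> {x} [p' x q' Sx||x y _ IHx _ IHy].
- have -> : p * (p' * x * q') * q = (p * p') * x * (q' * q) by rewrite !mulrA.
  exact: ideal_gen.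
- by rewrite mulr0 mul0r; apply: ideal_0.
- by rewrite mulrDr mulrDl; apply: ideal_add.
Qed.

Lemma ideal_mull p x : ideal x -> ideal (p * x).
Proof. by move/(ideal_mul p 1); rewrite mulr1. Qed.

Lemma ideal_mulr x q : ideal x -> ideal (x * q).
Proof. by move/(ideal_mul 1 q); rewrite mul1r. Qed.

Lemma ideal_opp x : ideal x -> ideal (- x).
Proof. by rewrite -mulN1r; apply: ideal_mull. Qed.

Lemma ideal_sub x : S x -> ideal x.
Proof. by move=> Sx; rewrite -[x]mul1r -[_ * x]mulr1; apply: ideal_gen. Qed.

Definition ideal_equiv : rel B := fun x y => `[< ideal (x - y) >].

Lemma ideal_equivP : equiv_class_of ideal_equiv.
Proof.
split=> [x|x y|y x z].
- by apply/asboolP; rewrite subrr; apply: ideal_0.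
- by apply/asboolP/asboolP=> /ideal_opp; rewrite opprB.
- move=> /asboolP xy /asboolP yz; apply/asboolP.
  by rewrite -(subrKA y); apply: ideal_add.
Qed.

Canonical ideal_equiv_equiv := EquivRelPack ideal_equivP.

Definition quot := {eq_quot ideal_equiv}.

HB.instance Definition _ := Choice.on quot.

Definition cls (x : B) : quot := \pi_quot x.

Lemma clsP x y : cls x = cls y <-> ideal (x - y).
Proof. by split=> [/eqquotP/asboolP|H]; last by apply/eqquotP/asboolP. Qed.

Lemma clsK q : cls (repr q) = q. Proof. exact: reprK. Qed.

Lemma repr_cls x : ideal (repr (cls x) - x).
Proof. by apply/clsP; rewrite clsK. Qed.

Lemma cls_ind (P : quot -> Prop) : (forall x, P (cls x)) -> forall q, P q.
Proof. by move=> H q; rewrite -(clsK q). Qed.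

Let qadd (p q : quot) := cls (repr p + repr q).
Let qopp (q : quot) := cls (- repr q).
Let qmul (p q : quot) := cls (repr p * repr q).

Let qaddE x y : qadd (cls x) (cls y) = cls (x + y).
Proof.
apply/clsP; rewrite opprD addrACA.
by apply: ideal_add; apply: repr_cls.
Qed.

Let qoppE x : qopp (cls x) = cls (- x).
Proof. by apply/clsP; rewrite -opprD; apply/ideal_opp/repr_cls. Qed.

Let qmulE x y : qmul (cls x) (cls y) = cls (x * y).
Proof.
apply/clsP; set x' := repr _; set y' := repr _.
have -> : x' * y' - x * y = (x' - x) * y' + x * (y' - y).
  by rewrite mulrBl mulrBr addrA subrK.
by apply: ideal_add; [apply: ideal_mulr|apply: ideal_mull]; apply: repr_cls.
Qed.

Let qaddA : associative qadd.
Proof.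
by elim/cls_ind=> x; elim/cls_ind=> y; elim/cls_ind=> z; rewrite !qaddE addrA.
Qed.
Let qaddC : commutative qadd.
Proof. by elim/cls_ind=> x; elim/cls_ind=> y; rewrite !qaddE addrC. Qed.
Let qadd0 : left_id (cls 0) qadd.
Proof. by elim/cls_ind=> x; rewrite qaddE add0r. Qed.
Let qaddN : left_inverse (cls 0) qopp qadd.
Proof. by elim/cls_ind=> x; rewrite qoppE qaddE addNr. Qed.

HB.instance Definition _ :=
  GRing.isZmodule.Build quot qaddA qaddC qadd0 qaddN.

Let qmulA : associative qmul.
Proof.
by elim/cls_ind=> x; elim/cls_ind=> y; elim/cls_ind=> z; rewrite !qmulE mulrA.
Qed.
Let qmul1 : left_id (cls 1) qmul.
Proof. by elim/cls_ind=> x; rewrite qmulE mul1r. Qed.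
Let qmulr1 : right_id (cls 1) qmul.
Proof. by elim/cls_ind=> x; rewrite qmulE mulr1. Qed.
Let qmulDl : left_distributive qmul +%R.
Proof.
elim/cls_ind=> x; elim/cls_ind=> y; elim/cls_ind=> z.
by rewrite -[LHS]/(qmul (qadd _ _) _) qaddE !qmulE mulrDl -qaddE.
Qed.
Let qmulDr : right_distributive qmul +%R.
Proof.
elim/cls_ind=> x; elim/cls_ind=> y; elim/cls_ind=> z.
by rewrite -[LHS]/(qmul _ (qadd _ _)) qaddE !qmulE mulrDr -qaddE.
Qed.

HB.instance Definition _ := GRing.Zmodule_isPzRing.Build quot
  qmulA qmul1 qmulr1 qmulDl qmulDr.

Lemma clsD x y : cls (x + y) = cls x + cls y. Proof. by rewrite -qaddE. Qed.
Lemma clsN x : cls (- x) = - cls x. Proof. by rewrite -qoppE. Qed.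
Lemma cls0 : cls 0 = 0. Proof. by []. Qed.
Lemma cls1 : cls 1 = 1. Proof. by []. Qed.
Lemma clsM x y : cls (x * y) = cls x * cls y. Proof. by rewrite -qmulE. Qed.

Let qscal (k : K) : quot := cls (scal k).

Let qscalD : {morph qscal : k l / k + l}.
Proof. by move=> k l; rewrite /qscal scalD clsD. Qed.
Let qscalM : {morph qscal : k l / k * l}.
Proof. by move=> k l; rewrite /qscal scalM clsM. Qed.
Let qscal1 : qscal 1 = 1.
Proof. by rewrite /qscal scal1. Qed.
Let qscalC k (q : quot) : qscal k * q = q * qscal k.
Proof. by elim/cls_ind: q => x; rewrite /qscal -!clsM scalC. Qed.

HB.instance Definition _ :=
  isPzAlgebra.Build K quot qscalD qscalM qscal1 qscalC.

Lemma cls_scal k : cls (scal k) = scal k. Proof. by []. Qed.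

End QuotientAlgebra.

(** * Vertex operator algebras of CFT type *)

(* Generalized binomial coefficient m(m-1)...(m-i+1)/i! of an integer m. *)
Definition binz (K : fieldType) (m : int) (i : nat) : K :=
  (\prod_(j < i) (m - j%:Z)%:~R) / i`!%:R.

(* Y a n is the mode a_(n).  The sums in Borcherds' identity are finite by
   truncation: both sides agree once enough terms are taken. *)
Definition truncation (K : fieldType) (V W : lmodType K)
    (Y : V -> int -> W -> W) : Prop :=
  forall a w, exists N : nat, forall n : nat, (N <= n)%N -> Y a n%:Z w = 0.

Definition borcherds (K : fieldType) (V W : lmodType K)
    (YV : V -> int -> V -> V) (YW : V -> int -> W -> W) : Prop :=
  forall (a b : V) (w : W) (l m n : int), exists N0 : nat,
    forall N : nat, (N0 <= N)%N ->
    \sum_(i < N) binz K m i *: YW (YV a (l + i%:Z) b) (m + n - i%:Z) w =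
    \sum_(i < N) ((-1) ^+ i * binz K l i) *:
      (YW a (l + m - i%:Z) (YW b (n + i%:Z) w)
       - (-1) ^ l *: YW b (l + n - i%:Z) (YW a (m + i%:Z) w)).

(* CFT type: graded by nat, with finite-dimensional pieces and V_0 = K vac. *)
Record voa (K : fieldType) := Voa {
  voa_sort :> lmodType K;
  vop : voa_sort -> int -> voa_sort -> voa_sort;
  vac : voa_sort;
  conf : voa_sort;
  vgr : nat -> set voa_sort;
  ccharge : K;
  vop_linearl : forall n b k a a',
    vop (k *: a + a') n b = k *: vop a n b + vop a' n b;
  vop_linearr : forall n a k b b',
    vop a n (k *: b + b') = k *: vop a n b + vop a n b';
  vop_truncation : truncation vop;
  vop_borcherds : borcherds vop vop;
  vop_vac : forall n b, vop vac n b = if n == -1 then b else 0;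
  vop_creation : forall a, vop a (-1) vac = a;
  vop_creation0 : forall a (n : nat), vop a n%:Z vac = 0;
  vop_virasoro : forall (m n : int) v,
    vop conf (m + 1) (vop conf (n + 1) v) - vop conf (n + 1) (vop conf (m + 1) v)
    = (m - n)%:~R *: vop conf (m + n + 1) v
      + (if m + n == 0 then (m ^+ 3 - m)%:~R / 12%:R * ccharge else 0) *: v;
  vop_derivative : forall a n b,
    vop (vop conf 0 a) n b = - n%:~R *: vop a (n - 1) b;
  vgr_direct_sum : direct_sum vgr;
  vgr_findim : forall n, findim (vgr n);
  vgr_L0 : forall n v, vgr n v -> vop conf 1 v = n%:R *: v;
  vac_neq0 : vac != 0;
  vgr0 : forall v, vgr 0 v <-> exists k, v = k *: vac
}.

Definition Lop (K : fieldType) (V : voa K) (n : int) (a : V) : V :=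
  vop (conf V) (n + 1) a.

(** * The universal enveloping algebra *)

Section FreeAlgebra.
Variables (K : fieldType) (V : voa K).

Definition word : Type := seq (V * int).

HB.instance Definition _ := Choice.on word.

Let cat_eq_nil (x y : word) : x ++ y = [::] -> x = [::] /\ y = [::].
Proof. by case: x; case: y. Qed.

HB.instance Definition _ := Choice_isMonomialDef.Build word
  (@catA _) (@cat0s _) (@cats0 _) cat_eq_nil.

(* The free algebra on the symbols a_[n]. *)
Definition freealg : Type := {malg K[word]}.

HB.instance Definition _ := GRing.PzRing.copy freealg {malg K[word]}.

Let fscal (k : K) : freealg := malgC k.

Let fscalD : {morph fscal : k l / k + l}.
Proof. exact: rmorphD. Qed.
Let fscalM : {morph fscal : k l / k * l}.
Proof. exact: rmorphM. Qed.
Let fscal1 : fscal 1 = 1.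
Proof. exact: rmorph1. Qed.
Let fscalC k (x : freealg) : fscal k * x = x * fscal k.
Proof.
apply: etrans (fgmulUg _ _ _) (etrans _ (esym (fgmulgU _ _ _))).
by apply: eq_bigr => w _; rewrite mulrC mul1m mulm1.
Qed.

HB.instance Definition _ :=
  isPzAlgebra.Build K freealg fscalD fscalM fscal1 fscalC.

Definition gen (a : V) (n : int) : freealg := << [:: (a, n)] : word >>.

End FreeAlgebra.

Section EnvelopingAlgebra.
Variables (K : fieldType) (V : voa K).

(* The relations of the Lie algebra (V[t,t^-1])/im(L_{-1} + d/dt), with a_[n]
   the class of a t^n, and of its universal enveloping algebra. *)
Inductive lie_rel : set (freealg V) :=
| lie_rel_linear k (a b : V) n :
    lie_rel (gen (k *: a + b) n - (scal k * gen a n + gen b n))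
| lie_rel_derivative (a : V) n :
    lie_rel (gen (Lop (-1) a) n + scal n%:~R * gen a (n - 1))
| lie_rel_bracket (a b : V) m n (N : nat) :
    (forall j : nat, (N <= j)%N -> vop a j%:Z b = 0) ->
    lie_rel (gen a m * gen b n - gen b n * gen a m
             - \sum_(j < N) scal (binz K m j)
                            * gen (vop a j%:Z b) (m + n - j%:Z)).

Definition lieU : Type := quot lie_rel.
HB.instance Definition _ := PzAlgebra.on lieU.

Definition lmode (a : V) (n : int) : lieU := cls lie_rel (gen a n).

(* The degree k part of lieU. *)
Inductive lgr : int -> set lieU :=
| lgr_0 k : lgr k 0
| lgr_1 : lgr 0 1
| lgr_mode h (a : V) n : vgr h a -> lgr (h%:Z - n - 1) (lmode a n)
| lgr_mul k l x y : lgr k x -> lgr l y -> lgr (k + l) (x * y)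
| lgr_lin k c x y : lgr k x -> lgr k y -> lgr k (scal c * x + y).

(* The left ideal generated by the elements of degree <= -N. *)
Inductive lneg (N : nat) : set lieU :=
| lneg_0 : lneg N 0
| lneg_gen k x y : k <= - N%:Z -> lgr k y -> lneg N (x * y)
| lneg_add x y : lneg N x -> lneg N y -> lneg N (x + y).

(* Completion of each graded piece, by Cauchy sequences; cseq consists of
   the finite sums of homogeneous Cauchy sequences, with termwise operations. *)
Definition cauchy (k : int) (x : nat -> lieU) : Prop :=
  (forall n, lgr k (x n)) /\
  forall N, exists n0, forall m n, (n0 <= m)%N -> (n0 <= n)%N ->
    lneg N (x m - x n).

Inductive csum : set (nat -> lieU) :=
| csum_cauchy k x : cauchy k x -> csum x
| csum_add x y : csum x -> csum y -> csum (x + y).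

Definition csum_pred : {pred (nat -> lieU)} := fun x => `[< csum x >].

Lemma lgr_add k x y : lgr k x -> lgr k y -> lgr k (x + y).
Proof. by move=> kx ky; rewrite -[x]mul1r -(scal1 (K := K)); apply: lgr_lin. Qed.

Lemma lgr_scal k c x : lgr k x -> lgr k (scal c * x).
Proof. by move=> kx; rewrite -[_ * _]addr0; apply: lgr_lin => //; apply: lgr_0. Qed.

Lemma scal0 (A : pzAlgType K) : scal 0 = 0 :> A.
Proof. by apply: (addrI (scal 0)); rewrite -scalD !addr0. Qed.

Lemma scalN1 (A : pzAlgType K) (x : A) : scal (- 1) * x = - x.
Proof.
apply: (addrI x); rewrite subrr -{1}[x]mul1r -(scal1 (K := K)) -mulrDl -scalD.
by rewrite subrr scal0 mul0r.
Qed.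

Lemma lgr_opp k x : lgr k x -> lgr k (- x).
Proof. by rewrite -scalN1; apply: lgr_scal. Qed.

Lemma lneg_mull N x y : lneg N y -> lneg N (x * y).
Proof.
elim=> [|k u v kN kv|u v _ IHu _ IHv].
- by rewrite mulr0; apply: lneg_0.
- by rewrite mulrA; apply: lneg_gen kN kv.
- by rewrite mulrDr; apply: lneg_add.
Qed.

Lemma lneg_opp N x : lneg N x -> lneg N (- x).
Proof. by rewrite -scalN1; apply: lneg_mull. Qed.

Lemma lneg_mulr N l x y : lneg (N + `|l|) x -> lgr l y -> lneg N (x * y).
Proof.
move=> + ly; elim=> [|k u v kN kv|u v _ IHu _ IHv].
- by rewrite mul0r; apply: lneg_0.
- rewrite -mulrA; apply: (@lneg_gen _ (k + l)); last exact: lgr_mul.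
  by move: kN; rewrite PoszD; lia.
- by rewrite mulrDl; apply: lneg_add.
Qed.

Lemma cauchy_mul k l x y : cauchy k x -> cauchy l y -> cauchy (k + l) (x * y).
Proof.
move=> [kx cx] [ly cy]; split=> [n|N]; first exact: lgr_mul.
have [n1 H1] := cx (N + `|l|)%N; have [n2 H2] := cy N.
exists (maxn n1 n2) => m n; rewrite !geq_max => /andP[m1 m2] /andP[n1' n2'].
rewrite -[(x * y) m]/(x m * y m) -[(x * y) n]/(x n * y n).
have -> : x m * y m - x n * y n = (x m - x n) * y m + x n * (y m - y n).
  by rewrite mulrBl mulrBr addrA subrK.
by apply: lneg_add; [apply/lneg_mulr/ly/H1|apply/lneg_mull/H2].
Qed.

Lemma cauchy_cst k x : lgr k x -> cauchy k (fun=> x).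
Proof.
by move=> kx; split=> // N; exists 0%N => *; rewrite subrr; apply: lneg_0.
Qed.

Lemma csum_opp x : csum x -> csum (- x).
Proof.
elim=> {x} [k x kx|x y _ IHx _ IHy]; last by rewrite opprD; apply: csum_add.
apply: (@csum_cauchy k).
rewrite (_ : - x = (fun=> scal (-1)) * x); last first.
  by apply/funext=> n; rewrite -[RHS]/(scal (-1) * x n) scalN1.
rewrite -[k]add0r; apply: cauchy_mul => //; apply: cauchy_cst.
by rewrite -[scal _]mulr1; apply: lgr_scal lgr_1.
Qed.

Lemma csum_mul x y : csum x -> csum y -> csum (x * y).
Proof.
move=> + cy; elim=> {x} [k x kx|x x' _ IHx _ IHx']; last first.
  by rewrite mulrDl; apply: csum_add.
elim: cy => {y} [l y ly|y y' _ IHy _ IHy'].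
- by apply: csum_cauchy; apply: cauchy_mul kx ly.
- by rewrite mulrDr; apply: csum_add.
Qed.

Lemma csum_subring : subring_closed csum_pred.
Proof.
split.
- by apply/asboolP/(@csum_cauchy 0)/cauchy_cst/lgr_1.
- move=> x y /asboolP cx /asboolP cy; apply/asboolP.
  by apply: csum_add => //; apply: csum_opp.
- by move=> x y /asboolP cx /asboolP cy; apply/asboolP/csum_mul.
Qed.

Record cseq : Type := CSeq { cval :> nat -> lieU; cvalP : cval \in csum_pred }.

HB.instance Definition _ := [isSub for cval].
HB.instance Definition _ := [Choice of cseq by <:].
HB.instance Definition _ :=
  GRing.SubChoice_isSubPzRing.Build _ _ cseq csum_subring.

Lemma csum_scal k : (fun=> scal k : lieU) \in csum_pred.
Proof.
apply/asboolP/(@csum_cauchy 0)/cauchy_cst.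
by rewrite -[scal k]mulr1; apply/lgr_scal/lgr_1.
Qed.

Let cscal (k : K) : cseq := CSeq (csum_scal k).

Let cscalD : {morph cscal : k l / k + l}.
Proof. by move=> k l; apply/val_inj/funext=> n /=; rewrite scalD. Qed.
Let cscalM : {morph cscal : k l / k * l}.
Proof. by move=> k l; apply/val_inj/funext=> n /=; rewrite scalM. Qed.
Let cscal1 : cscal 1 = 1.
Proof. by apply/val_inj/funext=> n /=; rewrite scal1. Qed.
Let cscalC k (x : cseq) : cscal k * x = x * cscal k.
Proof. by apply/val_inj/funext=> n /=; apply: scalC. Qed.

HB.instance Definition _ :=
  isPzAlgebra.Build K cseq cscalD cscalM cscal1 cscalC.

(* x lies in the completion of the left ideal lneg N. *)
Definition cneg (N : nat) : set cseq :=
  [set x | exists n0, forall n, (n0 <= n)%N -> lneg N (cval x n)].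

(* The remaining relations 1_[-1] = 1 and
   (a_(-1)b)_[n] = sum_{j<0} a_[j] b_[n-j-1] + sum_{j>=0} b_[n-j-1] a_[j],
   for homogeneous a and b (enough by bilinearity); the infinite sums are
   the Cauchy sequences of their partial sums. *)
Definition voa_rel : set cseq := [set x |
  cval x = (fun=> lmode (vac V) (-1) - 1) \/
  exists p q (a b : V) (n : int), [/\ vgr p a, vgr q b &
    cval x = (fun N : nat => lmode (vop a (-1) b) n
      - (\sum_(j < N) lmode a (- 1 - j%:Z) * lmode b (n + j%:Z)
         + \sum_(j < N) lmode b (n - j%:Z - 1) * lmode a j%:Z))]].

(* The closed two-sided ideal generated by these relations; it contains the
   null sequences, so that the quotient envU is the Hausdorff completion in
   which the relations are imposed.  It is already a two-sided ideal, so that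
   quot adds nothing to it; likewise for zhu_ideal below. *)
Definition voa_ideal : set cseq :=
  [set x | forall N, exists y, ideal voa_rel y /\ cneg N (x - y)].

Definition envU : Type := quot voa_ideal.
HB.instance Definition _ := PzAlgebra.on envU.

(* The degree k part U_k of envU. *)
Definition ugr (k : int) : set envU :=
  [set u | exists x : cseq, cauchy k (cval x) /\ u = cls voa_ideal x].

(* The basic neighbourhoods of 0 in envU. *)
Definition unbhd (N : nat) : set envU :=
  [set u | exists x : cseq, cneg N x /\ u = cls voa_ideal x].

Lemma lgr_mode_sum (a : V) (n : int) : csum (fun=> lmode a n).
Proof.
have lin k (b c : V) : lmode (k *: b + c) n = scal k * lmode b n + lmode c n.
  rewrite /lmode -cls_scal -clsM -clsD; apply/clsP.
  exact/ideal_sub/lie_rel_linear.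
have l0 : lmode (0 : V) n = 0.
  have := lin (-1) 0 0; rewrite scaler0 addr0 scalN1 addNr; exact.
have [_ /(_ a)[s [f [fP ->]]] _] := vgr_direct_sum V.
elim: s => [|i s IHs].
  by rewrite big_nil l0; apply/(@csum_cauchy 0)/cauchy_cst/lgr_0.
rewrite big_cons -[f i]scale1r.
rewrite (_ : (fun=> _) = (fun=> lmode (f i) n) + (fun=> lmode (\sum_(j <- s) f j) n)).
  by apply: csum_add => //; apply/csum_cauchy/cauchy_cst/lgr_mode/fP.
by apply/funext=> ?; rewrite lin scal1 mul1r.
Qed.

Lemma lmode_csum (a : V) (n : int) : (fun=> lmode a n) \in csum_pred.
Proof. exact/asboolP/lgr_mode_sum. Qed.

(* The element a_[n] of envU. *)
Definition umode (a : V) (n : int) : envU := cls voa_ideal (CSeq (lmode_csum a n)).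

End EnvelopingAlgebra.

Section GradedPieces.
Variables (K : fieldType) (V : voa K).
Local Notation U := (envU V).

Lemma ugr_0 k : ugr k (0 : U).
Proof. by exists 0; split=> //; apply/cauchy_cst/lgr_0. Qed.

Lemma ugr_1 : ugr 0 (1 : U).
Proof. by exists 1; split=> //; apply/cauchy_cst/lgr_1. Qed.

Lemma ugr_mul k l (u v : U) : ugr k u -> ugr l v -> ugr (k + l) (u * v).
Proof.
move=> [x [kx ->]] [y [ly ->]]; exists (x * y); split; last by rewrite clsM.
exact: cauchy_mul.
Qed.

Lemma ugr_scal k : ugr 0 (scal k : U).
Proof.
exists (scal k); split=> //; apply/cauchy_cst.
by rewrite -[scal k]mulr1; apply/lgr_scal/lgr_1.
Qed.

Lemma cauchy_add k (x y : nat -> lieU V) :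
  cauchy k x -> cauchy k y -> cauchy k (x + y).
Proof.
move=> [kx cx] [ky cy]; split=> [n|N]; first exact: lgr_add.
have [n1 H1] := cx N; have [n2 H2] := cy N.
exists (maxn n1 n2) => m n; rewrite !geq_max => /andP[m1 m2] /andP[n1' n2'].
rewrite -[(x + y) m]/(x m + y m) -[(x + y) n]/(x n + y n) opprD addrACA.
by apply: lneg_add; [apply: H1|apply: H2].
Qed.

Lemma ugr_add k (u v : U) : ugr k u -> ugr k v -> ugr k (u + v).
Proof.
move=> [x [kx ->]] [y [ky ->]]; exists (x + y); split; last by rewrite clsD.
exact: cauchy_add.
Qed.

Lemma ugr_opp k (u : U) : ugr k u -> ugr k (- u).
Proof.
by move=> ku; rewrite -(scalN1 (K := K)) -[k]add0r; apply: ugr_mul ku; apply: ugr_scal.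
Qed.

(* U is the sum of its graded pieces. *)
Lemma ugr_ind (P : U -> Prop) :
  (forall k u, ugr k u -> P u) -> (forall u v, P u -> P v -> P (u + v)) ->
  forall u, P u.
Proof.
move=> Pgr Padd; elim/cls_ind=> -[x xP].
have cx : csum x by apply/asboolP.
elim: cx xP => {x} [k x kx|x y cx IHx cy IHy] xP.
  by apply: (Pgr k); exists (CSeq xP).
have xP' : (x : nat -> lieU V) \in @csum_pred K V by apply/asboolP.
have yP' : (y : nat -> lieU V) \in @csum_pred K V by apply/asboolP.
rewrite (_ : CSeq xP = CSeq xP' + CSeq yP'); last exact/val_inj.
by rewrite clsD; apply: Padd.
Qed.

(** ** The Zhu algebra *)

(* (U . U_{<=-1})_k: finite sums of products u v with v of degree -j <= -1,
   and their limits.  In the topological algebra U the product U . U_{<=-1}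
   is the closed left ideal: only then are tails of normally ordered series
   sum_j b_[n-j-1] a_[j] of arbitrary modes zero on the lowest degree, and is
   the quotient Zhu's algebra. *)
Inductive negprod (k : int) : set U :=
| negprod_0 : negprod k 0
| negprod_gen (j : nat) u v :
    (0 < j)%N -> ugr (k + j%:Z) u -> ugr (- j%:Z) v -> negprod k (u * v)
| negprod_add u v : negprod k u -> negprod k v -> negprod k (u + v).

Definition negid (k : int) : set U := [set u | ugr k u /\
  forall N, exists v, negprod k v /\ unbhd N (u - v)].

Lemma unbhd_mull N (u v : U) : unbhd N v -> unbhd N (u * v).
Proof.
elim/cls_ind: u => x -[y [[n0 yN] ->]]; exists (x * y).
by split; [exists n0 => n /yN; apply: lneg_mull | rewrite clsM].
Qed.

Lemma negid_mull k l (u v : U) : ugr k u -> negid l v -> negid (k + l) (u * v).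
Proof.
move=> ku [lv Hv]; split=> [|N]; first exact: ugr_mul.
have [w [lw Nw]] := Hv N; exists (u * w); split; last first.
  by rewrite -mulrBr; apply: unbhd_mull.
elim: lw => {w Nw} [|j x y j0 xP yP|x y _ IHx _ IHy].
- by rewrite mulr0; apply: negprod_0.
- by rewrite mulrA; apply: (negprod_gen j0 _ yP); rewrite -addrA; apply: ugr_mul.
- by rewrite mulrDr; apply: negprod_add.
Qed.

Lemma unbhd_0 N : unbhd N (0 : U).
Proof. by exists 0; split=> //; exists 0%N => *; apply: lneg_0. Qed.

Lemma negprod_negid k (u : U) : ugr k u -> negprod k u -> negid k u.
Proof.
by move=> ku nu; split=> // N; exists u; split=> //; rewrite subrr; apply: unbhd_0.
Qed.

Lemma negid_neg k (u : U) : k < 0 -> ugr k u -> negid k u.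
Proof.
move=> k0 ku; apply: negprod_negid => //; rewrite -[u]mul1r.
apply: (@negprod_gen _ `|k|%N); first lia.
- by rewrite (_ : k + _ = 0); [apply: ugr_1|lia].
- by rewrite (_ : - _ = k) //; lia.
Qed.

Lemma negid_0 k : negid k (0 : U).
Proof. by apply: negprod_negid; [apply: ugr_0|apply: negprod_0]. Qed.

Definition U0_pred : {pred U} := fun u => `[< ugr 0 u >].

Lemma U0_subring : subring_closed U0_pred.
Proof.
split.
- exact/asboolP/ugr_1.
- by move=> u v /asboolP u0 /asboolP v0; apply/asboolP/ugr_add/ugr_opp.
- by move=> u v /asboolP u0 /asboolP v0; apply/asboolP/(ugr_mul u0 v0).
Qed.

Record U0 : Type := MkU0 { u0val :> U; u0valP : u0val \in U0_pred }.

HB.instance Definition _ := [isSub for u0val].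
HB.instance Definition _ := [Choice of U0 by <:].
HB.instance Definition _ :=
  GRing.SubChoice_isSubPzRing.Build _ _ U0 U0_subring.

Lemma U0_scal k : (scal k : U) \in U0_pred.
Proof. exact/asboolP/ugr_scal. Qed.

Let zscal (k : K) : U0 := MkU0 (U0_scal k).

Let zscalD : {morph zscal : k l / k + l}.
Proof. by move=> k l; apply/val_inj => /=; rewrite scalD. Qed.
Let zscalM : {morph zscal : k l / k * l}.
Proof. by move=> k l; apply/val_inj => /=; rewrite scalM. Qed.
Let zscal1 : zscal 1 = 1.
Proof. by apply/val_inj => /=; rewrite scal1. Qed.
Let zscalC k (x : U0) : zscal k * x = x * zscal k.
Proof. by apply/val_inj => /=; apply: scalC. Qed.

HB.instance Definition _ :=
  isPzAlgebra.Build K U0 zscalD zscalM zscal1 zscalC.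

Definition zhu_ideal : set U0 := [set x | negid 0 (u0val x)].

(* A = U_0 / (U . U_{<=-1})_0. *)
Definition zhu : Type := quot zhu_ideal.
HB.instance Definition _ := PzAlgebra.on zhu.

Definition zcls (x : U0) : zhu := cls zhu_ideal x.

(** ** The anti-automorphism theta *)

(* Since the a_[n] topologically generate U, the last field determines a
   continuous anti-automorphism: there is at most one theta_antiaut. *)
Record theta_antiaut := ThetaAntiaut {
  theta :> U -> U;
  thetaD : forall u v, theta (u + v) = theta u + theta v;
  theta_scal : forall k, theta (scal k) = scal k;
  thetaM : forall u v, theta (u * v) = theta v * theta u;
  theta_bij : bijective theta;
  theta_ugr : forall k u, ugr k u -> ugr (- k) (theta u);
  theta_continuous : forall k N, exists M, forall u,
    ugr k u -> unbhd M u -> unbhd N (theta u);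
  theta_mode : forall h (a : V) (n : int), vgr h a ->
    theta (umode a (h%:Z - 1 + n)) =
    scal ((-1) ^+ h) * \sum_(i < h.+1)
      scal (i`!%:R^-1) * umode (iter i (Lop 1) a) (h%:Z - i%:Z - 1 - n)
}.

Section ThetaZhu.
Variable th : theta_antiaut.

Lemma theta0 : th 0 = 0.
Proof. by apply: (addrI (th 0)); rewrite -thetaD !addr0. Qed.
Lemma theta1 : th 1 = 1.
Proof. by rewrite -(scal1 (K := K)) theta_scal. Qed.
Lemma thetaN u : th (- u) = - th u.
Proof. by apply: (addrI (th u)); rewrite -thetaD !subrr theta0. Qed.

Lemma theta_U0 (x : U0) : th (u0val x) \in U0_pred.
Proof.
by apply/asboolP; rewrite -oppr0; apply: theta_ugr; apply/asboolP/u0valP.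
Qed.

Definition theta_0 (x : U0) : U0 := MkU0 (theta_U0 x).

Lemma theta_negid u : negid 0 u -> negid 0 (th u).
Proof.
move=> [u0 Hu]; split=> [|N]; first by rewrite -oppr0; apply: theta_ugr.
have [M HM] := theta_continuous th 0 N; have [v [v0 uv]] := Hu M.
have gv : ugr 0 v.
  elim: v0 => {v uv} [|j x y j0 xP yP|x y _ IHx _ IHy]; first exact: ugr_0.
  - by rewrite (_ : 0 = 0 + j%:Z - j%:Z); [apply: ugr_mul|lia].
  - exact: ugr_add.
exists (th v); split; last first.
  by rewrite -thetaN -thetaD; apply: HM => //; apply/ugr_add/ugr_opp.
elim: v0 => {v gv uv} [|j x y j0 xP yP|x y _ IHx _ IHy].
- by rewrite theta0; apply: negprod_0.
- rewrite thetaM; apply: (@negprod_gen _ j) => //.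
  + by rewrite add0r -[j%:Z]opprK; apply: theta_ugr.
  + by rewrite -[j%:Z]add0r; apply: theta_ugr.
- by rewrite thetaD; apply: negprod_add.
Qed.

Definition theta_zhu (a : zhu) : zhu := zcls (theta_0 (repr a)).

Lemma theta_zhuE x : theta_zhu (zcls x) = zcls (theta_0 x).
Proof.
apply/clsP; have := repr_cls zhu_ideal x; set x' := repr _ => xx'.
have -> : theta_0 x' - theta_0 x = theta_0 (x' - x).
  by apply/val_inj; rewrite /= thetaD thetaN.
elim: xx' => [p y q Sy||y z _ IHy _ IHz].
- have -> : theta_0 (p * y * q) = theta_0 q * theta_0 y * theta_0 p.
    by apply/val_inj; rewrite /= !thetaM mulrA.
  exact/ideal_gen/theta_negid.
- by rewrite (_ : theta_0 0 = 0); [apply: ideal_0|apply/val_inj/theta0].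
- rewrite (_ : theta_0 _ = theta_0 y + theta_0 z); first exact: ideal_add.
  by apply/val_inj; rewrite /= thetaD.
Qed.

Lemma theta_zhuD a b : theta_zhu (a + b) = theta_zhu a + theta_zhu b.
Proof.
elim/cls_ind: a => x; elim/cls_ind: b => y; rewrite -clsD !theta_zhuE -clsD.
by congr zcls; apply/val_inj; rewrite /= thetaD.
Qed.
Lemma theta_zhuM a b : theta_zhu (a * b) = theta_zhu b * theta_zhu a.
Proof.
elim/cls_ind: a => x; elim/cls_ind: b => y; rewrite -clsM !theta_zhuE -clsM.
by congr zcls; apply/val_inj; rewrite /= thetaM.
Qed.
Lemma theta_zhu_scal k : theta_zhu (scal k) = scal k.
Proof.
rewrite -cls_scal theta_zhuE; congr zcls; apply/val_inj.
exact: theta_scal.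
Qed.
Lemma theta_zhu1 : theta_zhu 1 = 1.
Proof. by rewrite -(scal1 (K := K)) theta_zhu_scal. Qed.

End ThetaZhu.
End GradedPieces.

(** ** The dual of a module over the Zhu algebra *)

Section DualModule.
Variables (K : fieldType) (V : voa K) (th : theta_antiaut V).
Variable M : lmodType (zhu V).

Definition functional_pred : {pred (M -> K)} := fun f =>
  `[< forall k (x y : restr M), f (k *: x + y) = k * f x + f y >].

Lemma functional_zmod : zmod_closed functional_pred.
Proof.
split=> [|f g /asboolP fP /asboolP gP].
  by apply/asboolP=> k x y; rewrite -![(0 : M -> K) _]/0 mulr0 addr0.
apply/asboolP=> k x y.
rewrite -![(f - g) _]/(f _ - g _) fP gP; ring.
Qed.

(* The parameter t only selects the action of the Zhu algebra. *)
Record dualmod (t : theta_antiaut V) : Type := DualMod {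
  dual_fun :> M -> K; dual_funP : dual_fun \in functional_pred }.

HB.instance Definition _ t := [isSub for @dual_fun t].
HB.instance Definition _ t := [Choice of dualmod t by <:].
HB.instance Definition _ t :=
  GRing.SubChoice_isSubZmodule.Build _ _ (dualmod t) functional_zmod.

Lemma dual_scale_subproof (a : zhu V) (f : dualmod th) :
  (fun m => f (theta_zhu th a *: m)) \in functional_pred.
Proof.
apply/asboolP=> k x y; have /asboolP fP := dual_funP f.
rewrite -[k *: x]/((scal k : zhu V) *: (x : M)) scalerDr scalerA -scalC -scalerA.
exact: fP.
Qed.

Definition dual_scale (a : zhu V) (f : dualmod th) : dualmod th :=
  DualMod th (dual_scale_subproof a f).

Let dual_scaleA a b f : dual_scale a (dual_scale b f) = dual_scale (a * b) f.
Proof. by apply/val_inj/funext=> m /=; rewrite theta_zhuM scalerA. Qed.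
Let dual_scale1 : left_id 1 dual_scale.
Proof. by move=> f; apply/val_inj/funext=> m /=; rewrite theta_zhu1 scale1r. Qed.
Let dual_scaleDr : right_distributive dual_scale +%R.
Proof. by move=> a f g; apply/val_inj/funext. Qed.
Let dual_scaleDl f : {morph dual_scale^~ f : a b / a + b}.
Proof.
move=> a b; apply/val_inj/funext=> m /=; rewrite theta_zhuD scalerDl.
have /asboolP fP := dual_funP f; have := fP 1 (theta_zhu th a *: m) (theta_zhu th b *: m).
by rewrite scale1r mul1r.
Qed.

HB.instance Definition _ := GRing.Zmodule_isLmodule.Build (zhu V) (dualmod th)
  dual_scaleA dual_scale1 dual_scaleDr dual_scaleDl.

End DualModule.
Arguments dualmod {K V} M t.

(** * Graded modules *)

Section GradedModules.
Variables (K : fieldType) (V : voa K).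
Local Notation U := (envU V).

(* Graded U-modules W = sum_d W_d with U_k W_d contained in W_(d+k). *)
Record gmod := GMod {
  gmod_sort :> lmodType U;
  gpc : nat -> set gmod_sort;
  gpc_subspace : forall d, subspace (gpc d : set (restr gmod_sort));
  gpc_act : forall k u d w, ugr k u -> gpc d w ->
    match (d%:Z + k)%R with
    | Posz e => gpc e (u *: w)
    | Negz _ => u *: w = 0
    end
}.

(* The V-module structure a_(n) = a_[n] on a U-module. *)
Definition wmode (W : lmodType U) (a : V) (n : int) (w : restr W) : restr W :=
  umode a n *: (w : W).
Arguments wmode W a n w : clear implicits.

Definition weak_module (W : lmodType U) : Prop :=
  [/\ truncation (wmode W),
      forall n w, wmode W (vac V) n w = if n == -1 then w else 0
    & borcherds (@vop K V) (wmode W)].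

(* Since W is a gmod, a_(n) W_d is contained in W_(d + deg a - n - 1). *)
Definition admissible_module (W : gmod) : Prop :=
  weak_module W /\ direct_sum (gpc (g := W) : nat -> set (restr W)).

Definition graded_submodule (W : gmod) (S : set W) : Prop :=
  [/\ subspace (S : set (restr W)),
      forall a n w, S w -> S (wmode W a n w)
    & forall w, S w -> exists (s : seq nat) (f : nat -> W),
        (forall d, gpc d (f d) /\ S (f d)) /\ w = \sum_(d <- s) f d].

Definition simple_module (W : gmod) : Prop :=
  [/\ admissible_module W,
      exists w : W, w != 0
    & forall S : set W, graded_submodule S ->
        (forall w, S w -> w = 0) \/ (forall w, S w)].

Definition L0_eigenspace (W : lmodType U) (lambda : K) : set (restr W) :=
  [set w | wmode W (conf V) 1 w = lambda *: w].
Arguments L0_eigenspace W lambda : clear implicits.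

Definition ordinary_module (W : lmodType U) : Prop :=
  [/\ weak_module W,
      direct_sum (L0_eigenspace W),
      forall lambda, findim (L0_eigenspace W lambda)
    & forall lambda, exists N : int, forall n : int, n < N ->
        forall w, L0_eigenspace W (lambda + n%:~R) w -> w = 0].

(** ** Contragredient modules *)

Section Contragredient.
Variables (th : theta_antiaut V) (W : gmod).

(* The direct sum of the duals of the W_d, as the space of linear functionals
   on W which vanish on W_d for all but finitely many d. *)
Definition contra_pred : {pred (W -> K)} := fun f => `[<
  (forall k (x y : restr W), f (k *: x + y) = k * f x + f y) /\
  exists D, forall d w, (D <= d)%N -> gpc d w -> f w = 0 >].

Lemma contra_zmod : zmod_closed contra_pred.
Proof.
split=> [|f g /asboolP[fP [D fD]] /asboolP[gP [E gE]]]; apply/asboolP.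
  by split=> [k x y|]; [rewrite -![(0 : W -> K) _]/0 mulr0 addr0|exists 0%N].
split=> [k x y|].
  rewrite -![(f - g) _]/(f _ - g _) fP gP; ring.
exists (maxn D E) => d w; rewrite geq_max => /andP[Dd Ed] dw.
by rewrite -[(f - g) w]/(f w - g w) (fD d) ?(gE d) ?subrr.
Qed.

(* The parameter t only selects the action of U. *)
Record contragredient (t : theta_antiaut V) : Type := MkContragredient {
  contra_fun :> W -> K; contra_funP : contra_fun \in contra_pred }.

HB.instance Definition _ t := [isSub for @contra_fun t].
HB.instance Definition _ t := [Choice of contragredient t by <:].
HB.instance Definition _ t :=
  GRing.SubChoice_isSubZmodule.Build _ _ (contragredient t) contra_zmod.

Lemma contra_scale_subproof (u : U) (f : contragredient th) :
  (fun w => f (th u *: w)) \in contra_pred.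
Proof.
have /asboolP[fP [D fD]] := contra_funP f; apply/asboolP; split=> [k x y|].
  rewrite -[k *: x]/((scal k : U) *: (x : W)) scalerDr scalerA -scalC -scalerA.
  exact: fP.
elim/ugr_ind: u => [k u /(theta_ugr th) ku|u v [E HE] [F HF]].
  exists (D + `|k|)%N => d w Dd dw; have := gpc_act ku dw.
  case E: (_ + _) => [e|e] => [ew|->]; first by apply: fD ew; lia.
  by have := fP (-1) 0 0; rewrite scaler0 addr0 mulN1r addNr.
exists (maxn E F) => d w; rewrite geq_max => /andP[Ed Fd] dw.
rewrite thetaD scalerDl.
have := fP 1 (th u *: w) (th v *: w); rewrite scale1r mul1r => ->.
by rewrite (HE d) ?(HF d) ?addr0.
Qed.

Definition contra_scale (u : U) (f : contragredient th) : contragredient th :=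
  MkContragredient th (contra_scale_subproof u f).

Let contra_scaleA a b f :
  contra_scale a (contra_scale b f) = contra_scale (a * b) f.
Proof. by apply/val_inj/funext=> w /=; rewrite thetaM scalerA. Qed.
Let contra_scale1 : left_id 1 contra_scale.
Proof. by move=> f; apply/val_inj/funext=> w /=; rewrite theta1 scale1r. Qed.
Let contra_scaleDr : right_distributive contra_scale +%R.
Proof. by move=> a f g; apply/val_inj/funext. Qed.
Let contra_scaleDl f : {morph contra_scale^~ f : a b / a + b}.
Proof.
move=> a b; apply/val_inj/funext=> w /=; rewrite thetaD scalerDl.
have /asboolP[fP _] := contra_funP f.
by have := fP 1 (th a *: w) (th b *: w); rewrite scale1r mul1r.
Qed.

HB.instance Definition _ := GRing.Zmodule_isLmodule.Build U (contragredient th)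
  contra_scaleA contra_scale1 contra_scaleDr contra_scaleDl.

(* The summand dual to W_d. *)
Definition contra_pc (d : nat) : set (contragredient th) :=
  [set f | forall e w, e != d -> gpc e w -> f w = 0].

End Contragredient.

(** ** Induction from the Zhu algebra *)

Section Induction.
Variable M : lmodType (zhu V).

(* The tensor product of U / U . U_{<=-1} and M over U_0: an element is a
   finite sum of symbols u (x) m, represented by the list of the (u, m). *)
Inductive tens_eq : seq (U * M) -> seq (U * M) -> Prop :=
| tens_refl s : tens_eq s s
| tens_sym s t : tens_eq s t -> tens_eq t s
| tens_trans s t r : tens_eq s t -> tens_eq t r -> tens_eq s r
| tens_cat s s' t t' : tens_eq s s' -> tens_eq t t' ->
    tens_eq (s ++ t) (s' ++ t')
| tens_comm s t : tens_eq (s ++ t) (t ++ s)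
| tens_addl u v m : tens_eq [:: (u + v, m)] [:: (u, m); (v, m)]
| tens_addr u m n : tens_eq [:: (u, m + n)] [:: (u, m); (u, n)]
| tens_bal u (x : U0 V) m :
    tens_eq [:: (u * u0val x, m)] [:: (u, zcls x *: m)]
| tens_neg k u m : negid k u -> tens_eq [:: (u, m)] [::].

Definition tens_equiv : rel (seq (U * M)) := fun s t => `[< tens_eq s t >].

Lemma tens_equivP : equiv_class_of tens_equiv.
Proof.
split=> [s|s t|t s r]; first exact/asboolP/tens_refl.
  by apply/asboolP/asboolP; apply: tens_sym.
by move=> /asboolP st /asboolP tr; apply/asboolP/(tens_trans st).
Qed.

Canonical tens_equiv_equiv := EquivRelPack tens_equivP.

Definition Phi_sort := {eq_quot tens_equiv}.

HB.instance Definition _ := Choice.on Phi_sort.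

Definition tcls (s : seq (U * M)) : Phi_sort := \pi_Phi_sort s.

Lemma tclsP s t : tcls s = tcls t <-> tens_eq s t.
Proof. by split=> [/eqquotP/asboolP|H]; last by apply/eqquotP/asboolP. Qed.

Lemma repr_tcls s : tens_eq (repr (tcls s)) s.
Proof. by apply/tclsP; apply: reprK. Qed.

Lemma tcls_ind (P : Phi_sort -> Prop) : (forall s, P (tcls s)) -> forall x, P x.
Proof. by move=> H x; rewrite -[x]reprK. Qed.

Definition tmul (u : U) (s : seq (U * M)) : seq (U * M) :=
  [seq (u * p.1, p.2) | p <- s].

Lemma tens_eq0 m : tens_eq [:: (0, m)] [::].
Proof. exact: (tens_neg _ (negid_0 V 0)). Qed.

Lemma tens_neg_mul k u v m : negid k v -> tens_eq [:: (u * v, m)] [::].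
Proof.
move=> kv; elim/ugr_ind: u => [l u lu|u w IHu IHw].
  exact: tens_neg (negid_mull lu kv).
rewrite mulrDl; apply: tens_trans (tens_addl _ _ _) _.
exact: (tens_cat IHu IHw).
Qed.

Lemma tens_eq_mul u s t : tens_eq s t -> tens_eq (tmul u s) (tmul u t).
Proof.
elim=> {s t}.
- by move=> s; apply: tens_refl.
- by move=> s t _; apply: tens_sym.
- by move=> s t r _ st _; apply: tens_trans.
- by move=> s s' t t' _ IHs _ IHt; rewrite /tmul !map_cat; apply: tens_cat.
- by move=> s t; rewrite /tmul !map_cat; apply: tens_comm.
- by move=> v w m; rewrite /tmul /= mulrDr; apply: tens_addl.
- by move=> v m n; apply: tens_addr.
- by move=> v x m; rewrite /tmul /= mulrA; apply: tens_bal.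
- by move=> k v m kv; apply: tens_neg_mul kv.
Qed.

Lemma tens_eq_mulD u v s : tens_eq (tmul (u + v) s) (tmul u s ++ tmul v s).
Proof.
elim: s => [|[w m] s IHs] /=; first exact: tens_refl.
rewrite mulrDl; apply: (@tens_trans _
  ([:: (u * w, m); (v * w, m)] ++ (tmul u s ++ tmul v s))).
  exact: (tens_cat (tens_addl _ _ _) IHs).
have H := tens_cat (tens_comm [:: (v * w, m)] (tmul u s)) (tens_refl (tmul v s)).
by have := tens_cat (tens_refl [:: (u * w, m)]) H; rewrite -!catA.
Qed.

Let tadd (x y : Phi_sort) := tcls (repr x ++ repr y).
Let topp (x : Phi_sort) := tcls (tmul (- 1) (repr x)).
Let tscale (u : U) (x : Phi_sort) := tcls (tmul u (repr x)).

Let taddE s t : tadd (tcls s) (tcls t) = tcls (s ++ t).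
Proof. by apply/tclsP/tens_cat; apply: repr_tcls. Qed.
Let tscaleE u s : tscale u (tcls s) = tcls (tmul u s).
Proof. by apply/tclsP/tens_eq_mul/repr_tcls. Qed.

Let taddA : associative tadd.
Proof.
by elim/tcls_ind=> x; elim/tcls_ind=> y; elim/tcls_ind=> z; rewrite !taddE catA.
Qed.
Let taddC : commutative tadd.
Proof.
elim/tcls_ind=> x; elim/tcls_ind=> y; rewrite !taddE.
exact/tclsP/tens_comm.
Qed.
Let tadd0 : left_id (tcls [::]) tadd.
Proof. by elim/tcls_ind=> x; rewrite taddE. Qed.
Let tmul1 s : tmul 1 s = s.
Proof. by rewrite /tmul -[RHS]map_id; apply: eq_map => -[u m] /=; rewrite mul1r. Qed.
Let taddN : left_inverse (tcls [::]) topp tadd.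
Proof.
elim/tcls_ind=> x; rewrite [topp _]tscaleE taddE; apply/tclsP.
rewrite -{2}[x]tmul1; apply: tens_trans (tens_sym (tens_eq_mulD _ _ _)) _.
rewrite addNr; elim: x => [|[u m] x IHx] /=; first exact: tens_refl.
by rewrite mul0r; apply: (tens_cat (tens_eq0 m) IHx).
Qed.

HB.instance Definition _ :=
  GRing.isZmodule.Build Phi_sort taddA taddC tadd0 taddN.

Let tscaleA a b v : tscale a (tscale b v) = tscale (a * b) v.
Proof.
elim/tcls_ind: v => x; rewrite !tscaleE /tmul -map_comp.
by congr tcls; apply: eq_map => -[u m] /=; rewrite mulrA.
Qed.
Let tscale1 : left_id 1 tscale.
Proof. by elim/tcls_ind=> x; rewrite tscaleE tmul1. Qed.
Let tscaleDr : right_distributive tscale +%R.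
Proof.
move=> a; elim/tcls_ind=> x; elim/tcls_ind=> y.
rewrite -[LHS]/(tscale _ (tadd _ _)) -[RHS]/(tadd _ _).
by rewrite taddE !tscaleE taddE /tmul map_cat.
Qed.
Let tscaleDl v : {morph tscale^~ v : a b / a + b}.
Proof.
elim/tcls_ind: v => x a b; rewrite -[RHS]/(tadd _ _) !tscaleE taddE.
exact/tclsP/tens_eq_mulD.
Qed.

HB.instance Definition _ := GRing.Zmodule_isLmodule.Build U Phi_sort
  tscaleA tscale1 tscaleDr tscaleDl.

Definition tens (u : U) (m : M) : Phi_sort := tcls [:: (u, m)].

(* The image of U_d (x) M. *)
Definition Phi_pc (d : nat) : set Phi_sort :=
  [set x | exists s : seq (U * M),
     (forall p, p \in s -> ugr d%:Z p.1) /\ x = tcls s].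

Lemma tclsD s t : tcls (s ++ t) = tcls s + tcls t.
Proof. by rewrite -taddE. Qed.
Lemma tclsZ u s : tcls (tmul u s) = u *: tcls s.
Proof. by rewrite -tscaleE. Qed.

Let Phi_subspace d : subspace (Phi_pc d : set (restr Phi_sort)).
Proof.
split=> [|k x y [s [sd ->]] [t [td ->]]]; first by exists [::].
exists (tmul (scal k) s ++ t); rewrite tclsD tclsZ; split=> // p.
rewrite mem_cat => /orP[/mapP[q /sd qd ->]|/td //] /=.
by rewrite -[d%:Z]add0r; apply: ugr_mul qd; apply: ugr_scal.
Qed.

Let Phi_act k u d w : ugr k u -> Phi_pc d w ->
  match (d%:Z + k)%R with
  | Posz e => Phi_pc e (u *: w)
  | Negz _ => u *: w = 0
  end.
Proof.
move=> ku [s [sd ->]]; rewrite -tclsZ.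
have sdk p : p \in tmul u s -> ugr (d%:Z + k) p.1.
  by move=> /mapP[q /sd qd ->] /=; rewrite addrC; apply: ugr_mul.
case E: (_ + _) sdk => [e|e] sdk; first by exists (tmul u s).
elim: (tmul u s) sdk => // -[v m] t IHt tdk.
rewrite -cat1s tclsD IHt ?addr0; last by move=> p pt; apply: tdk; rewrite inE pt orbT.
apply/tclsP; apply: (@tens_neg (Negz e)); apply: negid_neg => //.
by apply: (tdk (v, m)); rewrite inE eqxx.
Qed.

Definition Phi : gmod := GMod Phi_subspace Phi_act.

End Induction.

(** ** The canonical maps *)

(* psi : Phi M -> (Phi N)' is the U-module map extending the map
   M -> (Phi N)'_0 = N^* given by a pairing of M and N.  It is unique, as
   the elements tens 1 m generate Phi M, and it preserves degrees. *)
Definition canonical_map (th : theta_antiaut V) (M N : lmodType (zhu V))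
    (pairing : M -> N -> K)
    (psi : {linear Phi M -> contragredient (Phi N) th}) : Prop :=
  forall m, contra_pc (th := th) 0 (psi (tens 1 m)) /\
    forall n, psi (tens 1 m) (tens 1 n) = pairing m n.

Definition is_psi (th : theta_antiaut V) (M : lmodType (zhu V))
    (psi : {linear Phi M -> contragredient (Phi (dualmod M th)) th}) : Prop :=
  canonical_map (fun (m : M) (f : dualmod M th) => f m) psi.

Definition is_psi_dual (th : theta_antiaut V) (M : lmodType (zhu V))
    (psi : {linear Phi (dualmod M th) -> contragredient (Phi M) th}) : Prop :=
  canonical_map (fun (f : dualmod M th) (m : M) => f m) psi.

Definition simple_zhu_module (M : lmodType (zhu V)) : Prop :=
  (exists m : M, m != 0) /\
  forall S : set M,
    S 0 -> (forall (a : zhu V) m n, S m -> S n -> S (a *: m + n)) ->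
    (forall m, S m -> m = 0) \/ (forall m, S m).

End GradedModules.

(* Main.v *)
(** Let N be the theta-twisted dual of M.  Both psi_M and psi_M^dual are adjoints
    of one contravariant pairing of Phi(M) with Phi(N),
    B(u (x) m, v (x) n) = <m, (theta(u) v)_0 n>, where x_0 is the degree 0 part;
    that the two adjoints agree rests on theta^2 = 1.  A graded submodule of
    Phi(M) which misses the degree 0 part M is B-orthogonal to everything, because
    Phi(N) is generated in degree 0; hence, M being simple, Phi(M) is simple iff
    psi_M is injective.  If psi_M and psi_M^dual are bijective, then every
    Phi(M)_d maps onto its double dual, and so is finite-dimensional; conversely,
    a pairing of finite-dimensional spaces which is nondegenerate on both sides is
    perfect.  Finally L_0 acts on M by a scalar l (Schur), hence on Phi(M)_d by
    l + d, so that Phi(M) is ordinary iff all Phi(M)_d are finite-dimensional. *)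

From HB Require Import structures.
Require Import Defs.
From mathcomp Require Import all_boot all_order all_algebra.
From mathcomp Require Import boolp classical_sets functions.
From mathcomp Require Import reals.
From mathcomp Require Import complex.
From mathcomp Require monalg.
From mathcomp Require Import zify ring.

Set Implicit Arguments.
Unset Strict Implicit.
Unset Printing Implicit Defensive.

Import Order.TTheory GRing.Theory Num.Theory.

Local Open Scope classical_set_scope.
Local Open Scope ring_scope.

(** * Linear algebra *)

(** Most of the work lies in making the pairing argument available for objects given by generators
    and relations. Nothing in the definition of the graded pieces of [lieU], [envU] and [Phi M] says
    that their sums are direct; in characteristic 0 this holds because the degree is an eigenvalue,
    of ad L_0 on the algebras and of u (x) m -> [L_0, u] (x) m on [Phi M]. Being simple or ordinary
    includes being a weak module, so Borcherds' identity has to be derived for [Phi M]. Its input,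
    the normally ordered product, holds in [envU] only as a limit; it becomes a finite identity on
    each vector because homogeneous elements close enough to 0 kill that vector. Involutivity is not
    a field of [theta_antiaut]: it is computed on modes and extended by density. Finally, nothing
    bounds dim M a priori, and in infinite dimension a subspace of the dual that separates points
    can be proper. So, from (a) to (b), finite dimension is first extracted from the two
    surjectivities, and only then is the dual of M known to be simple. *)

Lemma sum_widen (X : nmodType) (I : eqType) (v t : seq I) (h : I -> X) :
  uniq v -> uniq t -> {subset v <= t} -> (forall i, i \notin v -> h i = 0) ->
  \sum_(i <- v) h i = \sum_(i <- t) h i.
Proof.
move=> uv ut vt hv; rewrite [RHS](bigID (mem v)) /= [X in _ = _ + X]big1 ?addr0 //.
rewrite -[RHS]big_filter; apply: perm_big; apply: uniq_perm => //.
  exact/filter_uniq.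
by move=> i; rewrite mem_filter; case: (boolP (i \in v)) => // /vt ->.
Qed.

(** * Direct sums and eigenspaces *)

Section DirectSum.
Variables (K : fieldType) (X : lmodType K).

Lemma subspaceD (S : set X) x y : subspace S -> S x -> S y -> S (x + y).
Proof. by move=> [_ SS] Sx Sy; rewrite -[x]scale1r; apply: SS. Qed.

Lemma subspaceZ (S : set X) k x : subspace S -> S x -> S (k *: x).
Proof. by move=> [S0 SS] Sx; rewrite -[_ *: _]addr0; apply: SS. Qed.

Lemma subspaceB (S : set X) x y : subspace S -> S x -> S y -> S (x - y).
Proof.
by move=> SS Sx Sy; apply: subspaceD => //; rewrite -scaleN1r; apply: subspaceZ.
Qed.

Lemma subspace_sum (J : eqType) (S : set X) (s : seq J) (f : J -> X) :
  subspace S -> (forall j, j \in s -> S (f j)) -> S (\sum_(j <- s) f j).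
Proof.
move=> SS; elim: s => [|j s IHs] Sf; first by rewrite big_nil; case: SS.
rewrite big_cons; apply: subspaceD => //; first by apply: Sf; rewrite inE eqxx.
by apply: IHs => i si; apply: Sf; rewrite inE si orbT.
Qed.

(** Applying T - ev j to the relation kills the term at j and multiplies the others by nonzero
    scalars, so that the induction hypothesis applies to the rescaled terms. *)
Lemma eigen_indep (I : eqType) (ev : I -> K) (T : {linear X -> X}) (s : seq I)
    (f : I -> X) :
  injective ev -> uniq s -> (forall i, T (f i) = ev i *: f i) ->
  \sum_(i <- s) f i = 0 -> forall i, i \in s -> f i = 0.
Proof.
move=> ev_inj; elim: s f => // j s IHs f /= /andP[js us] Tf.
rewrite big_cons => sum0.
have fs i : i \in s -> f i = 0.
  move=> si; have ij : ev i - ev j != 0.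
    rewrite subr_eq0; apply: contraNneq js => /ev_inj ij.
    by rewrite -ij.
  suff : (ev i - ev j) *: f i = 0 by move/eqP; rewrite scaler_eq0 (negPf ij) => /eqP.
  apply: (IHs (fun i => (ev i - ev j) *: f i)) => // [k|].
    by rewrite linearZ /= Tf !scalerA mulrC.
  have : T (f j + \sum_(i <- s) f i) - ev j *: (f j + \sum_(i <- s) f i) = 0.
    by rewrite sum0 linear0 scaler0 subrr.
  rewrite linearD /= Tf scalerDr opprD addrACA subrr add0r => E; rewrite -[RHS]E.
  rewrite linear_sum /= scaler_sumr -sumrB. apply: eq_bigr => k _.
  by rewrite Tf scalerBl.
move=> i; rewrite inE => /orP[/eqP->|/fs//].
by rewrite -[RHS]sum0 big_seq big1 ?addr0.
Qed.

(** Distinct eigenvalues give uniqueness, so that only spanning is left to check. Every direct sum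
    proved below is obtained in this way. *)
Lemma direct_sum_eigen (I : eqType) (P : I -> set X) (ev : I -> K)
    (T : {linear X -> X}) :
  injective ev -> (forall i, subspace (P i)) ->
  (forall w, exists (s : seq I) (f : I -> X),
        (forall i, P i (f i)) /\ w = \sum_(i <- s) f i) ->
  (forall i x, P i x -> T x = ev i *: x) -> direct_sum P.
Proof.
move=> ev_inj Psub Pspan PT; split=> // s f us Pf.
by apply: (eigen_indep ev_inj us) => i; apply: PT.
Qed.

Section Decomposition.
Variables (I : eqType) (P : I -> set X).
Hypothesis Psub : forall i, subspace (P i).

(** In [direct_sum] the list s may repeat an index and f is arbitrary outside s. Here f vanishes off
    a duplicate-free list, so that it is unique as a function when the sum is direct. *)
Definition decomposes (f : I -> X) (w : X) :=
  (forall i, P i (f i)) /\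
  exists2 s, uniq s & (forall i, i \notin s -> f i = 0) /\ w = \sum_(i <- s) f i.

(** An index occurring several times in s contributes that many copies of f i, whence the
    multiplicity. *)
Lemma decomposes_count s f : (forall i, P i (f i)) ->
  decomposes (fun i => f i *+ count_mem i s) (\sum_(i <- s) f i).
Proof.
move=> Pf; split.
  by move=> i; rewrite -scaler_nat; apply: subspaceZ.
exists (undup s); first exact: undup_uniq.
split=> [i|]; first by rewrite mem_undup => /count_memPn->.
by rewrite big_undup_iterop_count /=.
Qed.

Lemma decomposes_wide f w (s : seq I) : decomposes f w -> exists2 t, uniq t &
  {subset s <= t} /\ w = \sum_(i <- t) f i.
Proof.
move=> [Pf [r ur [rf ->]]]; exists (undup (r ++ s)); first exact: undup_uniq.
split=> [i si|]; first by rewrite mem_undup mem_cat si orbT.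
apply: sum_widen => //; first exact: undup_uniq.
by move=> i ir; rewrite mem_undup mem_cat ir.
Qed.

Lemma decomposes_lin f g x y k : decomposes f x -> decomposes g y ->
  decomposes (fun i => k *: f i + g i) (k *: x + y).
Proof.
move=> [Pf [s us [sf ->]]] yP; have [Pg [r ur [rg _]]] := yP.
have xP : decomposes f (\sum_(i <- s) f i) by split => //; exists s.
split=> [i|]; first by apply: subspaceD => //; apply: subspaceZ.
have [t ut [st ->]] := decomposes_wide (s ++ r) xP.
have [Pg' [r' ur' [rg' ->]]] := yP.
exists (undup (t ++ r')); first exact: undup_uniq.
split=> [i|].
  rewrite mem_undup mem_cat negb_or => /andP[it ir'].
  rewrite sf ?rg' ?scaler0 ?addr0 //.
  by apply: contra it => si; apply: st; rewrite mem_cat si.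
rewrite (@sum_widen _ _ t (undup (t ++ r')) f) ?undup_uniq //; last first.
- by move=> i it; apply: sf; apply: contra it => si; apply: st; rewrite mem_cat si.
- by move=> i it; rewrite mem_undup mem_cat it.
rewrite (@sum_widen _ _ r' (undup (t ++ r')) g) ?undup_uniq //; last first.
  by move=> i it; rewrite mem_undup mem_cat it orbT.
by rewrite scaler_sumr -big_split.
Qed.

Lemma decomposes_homog j w : P j w -> decomposes (fun i => if i == j then w else 0) w.
Proof.
move=> jw; split=> [i|]; first by case: eqP => [->//|_]; case: (Psub i).
exists [:: j] => //; split=> [i|]; first by rewrite inE => /negPf->.
by rewrite big_seq1 eqxx.
Qed.

(** The decomposable vectors form a subspace containing all pieces. The hypothesis has the shape of
    an induction principle, which spares its users the handling of lists. *)
Lemma direct_sum_span (w : X) :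
  (forall S : set X, subspace S -> (forall i x, P i x -> S x) -> S w) ->
  exists (s : seq I) (f : I -> X), (forall i, P i (f i)) /\ w = \sum_(i <- s) f i.
Proof.
move=> H.
suff [f [Pf [s _ [_ ->]]]] : exists f, decomposes f w by exists s, f.
apply: (H [set w | exists f, decomposes f w]) => [|i x ix]; last first.
  by eexists; apply: decomposes_homog ix.
split=> [|k x y [f fx] [g gy]]; last by eexists; apply: decomposes_lin fx gy.
exists (fun=> 0); split=> [i|]; first by case: (Psub i).
by exists [::] => //; rewrite big_nil.
Qed.

End Decomposition.

Section Projection.
Variables (I : eqType) (P : I -> set X).
Hypothesis dP : direct_sum P.

Let Psub i : subspace (P i). Proof. by case: dP. Qed.

Let decomposes_uniq f g w : decomposes P f w -> decomposes P g w -> f =1 g.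
Proof.
move=> fw gw i; have := decomposes_lin Psub (-1) fw gw.
rewrite scaleN1r addNr => /(decomposes_wide [:: i])[t ut [it]].
have [_ _ indep] := dP; move/esym/(indep t _ ut) => H.
apply/esym/eqP; rewrite -subr_eq0 addrC -scaleN1r; apply/eqP.
apply: (H _ i); last by apply: it; rewrite inE.
by move=> j; apply: subspaceD => //; [apply: subspaceZ => //; case: fw|case: gw].
Qed.

Definition dproj (i : I) (w : X) : X :=
  xget 0 [set x | exists2 f, decomposes P f w & x = f i].

Lemma dprojE f w : decomposes P f w -> forall i, dproj i w = f i.
Proof.
move=> fw i; rewrite /dproj; case: xgetP => [x _ [g gw ->]|/(_ (f i))[]].
  exact: decomposes_uniq gw fw i.
by exists f.
Qed.

Lemma dproj_decomposes w : decomposes P (dproj^~ w) w.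
Proof.
have [_ /(_ w)[s [f [Pf wE]]] _] := dP.
have := decomposes_count Psub s Pf; rewrite -wE; set g := (fun _ => _) => fw.
by rewrite (_ : dproj^~ w = g) //; apply/funext/dprojE.
Qed.

Lemma dproj_in i w : P i (dproj i w).
Proof. by have [] := dproj_decomposes w. Qed.

Lemma dproj_sum w : exists2 s, uniq s &
  (forall i, i \notin s -> dproj i w = 0) /\ w = \sum_(i <- s) dproj i w.
Proof. by have [] := dproj_decomposes w. Qed.

Lemma dproj_lin i k x y : dproj i (k *: x + y) = k *: dproj i x + dproj i y.
Proof.
exact: (dprojE (decomposes_lin Psub k (dproj_decomposes x) (dproj_decomposes y))).
Qed.

HB.instance Definition _ i := GRing.isLinear.Build K X X _ (dproj i) (dproj_lin i).

Lemma dprojD i x y : dproj i (x + y) = dproj i x + dproj i y.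
Proof. exact: linearD. Qed.

Lemma dproj0 i : dproj i 0 = 0.
Proof. exact: linear0. Qed.

Lemma dproj_homog j w : P j w -> forall i, dproj i w = if i == j then w else 0.
Proof.
move=> jw i; move: i; exact/dprojE/decomposes_homog.
Qed.

Lemma dproj_eq0 w : (forall i, dproj i w = 0) -> w = 0.
Proof.
by move=> H; have [s _ [_ ->]] := dproj_sum w; rewrite big1.
Qed.

Lemma dproj_eqP x y : (forall i, dproj i x = dproj i y) -> x = y.
Proof.
move=> H; apply/eqP; rewrite -subr_eq0; apply/eqP/dproj_eq0 => i.
by rewrite -scaleN1r addrC dproj_lin H scaleN1r addNr.
Qed.

Section Eigen.
Variables (ev : I -> K) (T : {linear X -> X}).
Hypothesis PT : forall i x, P i x -> T x = ev i *: x.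

Lemma dproj_eigen i x : dproj i (T x) = ev i *: dproj i x.
Proof.
have [s _ [_ ->]] := dproj_sum x; rewrite !linear_sum /=.
apply: eq_bigr => j _; have jx := dproj_in j x.
rewrite (PT jx) linearZ /= (dproj_homog jx).
by case: eqP => [->//|_]; rewrite !scaler0.
Qed.

(** T multiplies the component of x at j both by ev j and by ev i, so this component vanishes for j
    different from i. Eigenvalue computations thus yield membership in a graded piece. *)
Lemma eigen_homog i x : injective ev -> T x = ev i *: x -> P i x.
Proof.
move=> ev_inj Tx; suff -> : x = dproj i x by apply: dproj_in.
apply: dproj_eqP => j; rewrite (dproj_homog (dproj_in i x)).
case: eqP => [->//|/eqP ji].
have /eqP := dproj_eigen j x; rewrite Tx linearZ /= -subr_eq0 -scalerBl.
rewrite scaler_eq0 subr_eq0 => /orP[/eqP/ev_inj ij|/eqP//].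
by rewrite ij eqxx in ji.
Qed.

Lemma eigen_eq0 c x : (forall i, c != ev i) -> T x = c *: x -> x = 0.
Proof.
move=> cev Tx; apply: dproj_eq0 => j.
have /eqP := dproj_eigen j x; rewrite Tx linearZ /= -subr_eq0 -scalerBl.
by rewrite scaler_eq0 subr_eq0 (negPf (cev j)) => /eqP.
Qed.

End Eigen.
End Projection.
End DirectSum.

(** * Extension of partially defined linear maps *)

Section LinearExtension.
Variables (K : fieldType) (X Z : lmodType K).

(** A partially defined linear map, encoded by its graph. *)
Definition linear_graph (G : set (X * Z)) : Prop :=
  subspace G /\ forall z, G (0, z) -> z = 0.

(** Zorn's lemma on graphs: a maximal one is defined everywhere, since a missing vector can be given
    the value 0. *)
Lemma linear_extension (G0 : set (X * Z)) : linear_graph G0 ->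
  exists F : {linear X -> Z}, forall x z, G0 (x, z) -> F x = z.
Proof.
(* The union with [G0] keeps the initial graph in play and makes the property hold for the empty
   chain, whose union is empty. *)
move=> gG0; pose P (A : set (X * Z)) := linear_graph (A `|` G0).
have [|A [PA maxA]] := @Zorn_bigcup _ P.
  move=> F FP totF; rewrite /P; set B := (X in linear_graph X).
  have chain p q : B p -> B q -> exists A, [/\ linear_graph A, A `<=` B, A p & A q].
    have sub A : F A -> A `|` G0 `<=` B.
      by move=> FA x [Ax|]; [left; exists A|right].
    move=> [[A FA Ap]|Gp] [[A' FA' Aq]|Gq].
    - have [AA'|AA'] := totF _ _ FA FA'.
        by exists (A' `|` G0); split; [exact: FP|exact: sub|left; apply: AA'|left].
      by exists (A `|` G0); split; [exact: FP|exact: sub|left|left; apply: AA'].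
    - by exists (A `|` G0); split; [exact: FP|exact: sub|left|right].
    - by exists (A' `|` G0); split; [exact: FP|exact: sub|right|left].
    - by exists G0; split=> // x; right.
  split; first split=> [|k x y Bx By].
  - by right; case: gG0 => -[].
  - have [C [[[_ SC] _] CB Cx Cy]] := chain _ _ Bx By.
    by apply/CB/SC.
  - by move=> z Bz; have [C [[_ fC] _ /fC]] := chain _ _ Bz Bz.
set G := A `|` G0 in PA *; have [sG fG] : linear_graph G := PA.
have total x0 : exists z, G (x0, z).
  (* [B] is the graph extended by x0 -> 0, that is G + K (x0, 0). *)
  apply: contrapT => Nx0; pose B : set (X * Z) := [set p | exists k, G (p.1 - k *: x0, p.2)].
  have GB : G `<=` B by move=> -[x z] Gx; exists 0; rewrite scale0r subr0.
  apply: (maxA B).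
    split=> [x Ax|BA]; first by apply: GB; left.
    apply: Nx0; exists 0; left; apply: BA; exists 1.
    by rewrite /= scale1r subrr; case: sG.
  rewrite /P (_ : B `|` G0 = B); last by apply/setUidl => x Gx; apply: GB; right.
  split; first split=> [|k [x z] [x' z'] [l /= Gx] [l' /= Gx']].
  - by exists 0; rewrite /= scale0r subr0; case: sG.
  - exists (k * l + l') => /=.
    have : G (k *: (x - l *: x0) + (x' - l' *: x0), k *: z + z') := proj2 sG k _ _ Gx Gx'.
    by rewrite scalerBr scalerA scalerDl opprD addrACA.
  (* For nonzero k, scaling the element (- k x0, z) of G by - k^-1 puts x0 into the domain of G,
     contrary to [Nx0]. *)
  move=> z [k /= Gk]; have [k0|k0] := eqVneq k 0.
    by apply: fG; rewrite k0 scale0r subr0 in Gk.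
  case: Nx0; exists (- k^-1 *: z).
  have : G (- k^-1 *: (0 - k *: x0), - k^-1 *: z) := subspaceZ (- k^-1) sG Gk.
  by rewrite sub0r scalerN scaleNr opprK scalerA mulVf // scale1r.
have [F HF] := choice total.
have Funiq x z : G (x, z) -> F x = z.
  move=> Gz; apply/eqP; rewrite -subr_eq0; apply/eqP/fG.
  have : G (x - x, F x - z) := subspaceB sG (HF x) Gz.
  by rewrite subrr.
have Flin : linear F.
  by move=> k x y; apply: Funiq; apply: ((proj2 sG) k (x, _) (y, _)); apply: HF.
pose FL := GRing.isLinear.Build _ _ _ _ F Flin.
pose FF : {linear X -> Z} := HB.pack F FL.
exists FF => x z Gz /=.
by apply: Funiq; right.
Qed.

End LinearExtension.

(** * Independent sequences and finite families of functionals *)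

Section Functionals.
Variables (K : fieldType) (X : lmodType K).

Lemma scalar_zero (f : X -> K) : scalar f -> f 0 = 0.
Proof. by move=> flin; have := flin (-1) 0 0; rewrite scaler0 addr0 mulN1r addNr. Qed.

Lemma scalar_scale (f : X -> K) : scalar f -> forall k x, f (k *: x) = k * f x.
Proof.
by move=> flin k x; rewrite -[k *: x]addr0 flin scalar_zero ?addr0.
Qed.

Definition lin_indep (e : nat -> X) : Prop :=
  forall n (c : nat -> K), \sum_(i < n) c i *: e i = 0 ->
    forall i, (i < n)%N -> c i = 0.

Lemma lin_indep_extension (Z : lmodType K) (e : nat -> X) (z : nat -> Z) :
  lin_indep e -> exists F : {linear X -> Z}, forall i, F (e i) = z i.
Proof.
move=> indep.
pose G : set (X * Z) := [set p | exists n (c : nat -> K), (forall i, (n <= i)%N -> c i = 0) /\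
  p = (\sum_(i < n) c i *: e i, \sum_(i < n) c i *: z i)].
have widen (Y : lmodType K) (y : nat -> Y) n m c :
    (forall i, (n <= i)%N -> c i = 0 :> K) -> (n <= m)%N ->
    \sum_(i < n) c i *: y i = \sum_(i < m) c i *: y i.
  move=> cn nm; rewrite (big_ord_widen _ (fun i => c i *: y i) nm) big_mkcond /=.
  by apply: eq_bigr => i _; case: ltnP => // /cn->; rewrite scale0r.
have [|F HF] := @linear_extension _ _ _ G.
  split; first split.
  - by exists 0%N, (fun=> 0); rewrite !big_ord0.
  - move=> k _ _ [n [c [cn ->]]] [m [d [dm ->]]]; exists (maxn n m), (fun i => k * c i + d i).
    split=> [i|]; first by rewrite geq_max => /andP[/cn-> /dm->]; rewrite mulr0 addr0.
    rewrite !(widen _ _ _ _ _ cn (leq_maxl n m)) !(widen _ _ _ _ _ dm (leq_maxr n m)).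
    rewrite -[LHS]/(_ *: _ + _, _ *: _ + _) !scaler_sumr -!big_split /=.
    by congr pair; apply: eq_bigr => i _; rewrite scalerDl scalerA.
  - move=> z0 [n [c [cn [/esym/indep c0 ->]]]].
    by rewrite big1 // => i _; rewrite c0 ?scale0r.
exists F => i; apply: HF; exists i.+1, (fun j => (j == i)%:R); split.
  by move=> j ij; case: eqP => // E; rewrite E ltnn in ij.
have sum (Y : lmodType K) (y : nat -> Y) : y i = \sum_(j < i.+1) (j == i :> nat)%:R *: y j.
  rewrite (bigD1 ord_max) //= eqxx scale1r big1 ?addr0 // => j ji.
  by have /negPf-> : j != i :> nat by []; rewrite scale0r.
by rewrite -!sum.
Qed.

(** The vectors are chosen greedily, each outside the span of its predecessors: if none were left in
    P, these finitely many predecessors would span P. *)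
Lemma lin_indep_ex (P : set X) : subspace P -> ~ findim P ->
  exists2 e : nat -> X, (forall i, P (e i)) & lin_indep e.
Proof.
move=> SP infP.
have next (s : seq X) : exists x, P x /\
    forall c : nat -> K, x <> \sum_(i < size s) c i *: s`_i.
  apply: contrapT => H; apply: infP; exists (size s), (fun i => s`_i) => w Pw.
  apply: contrapT => Hw; apply: H; exists w; split=> // c E.
  by apply: Hw; exists c.
have [f Hf] := choice next.
pose es n := iter n (fun s => rcons s (f s)) [::].
have size_es n : size (es n) = n by elim: n => //= n IHn; rewrite size_rcons IHn.
pose e n := f (es n).
have esE n i : (i < n)%N -> (es n)`_i = e i.
  elim: n => // n IHn; rewrite ltnS leq_eqVlt /= nth_rcons size_es => /orP[/eqP->|ni].
    by rewrite ltnn eqxx.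
  by rewrite ni IHn.
exists e => [i|n c]; first by case: (Hf (es i)).
elim: n => // n IHn; rewrite big_ord_recr /= => sum0.
have cn0 : c n = 0.
  apply/eqP; apply: contrapT => /negP cn; have [_ /(_ (fun i => - (c i / c n)))] := Hf (es n).
  apply; rewrite size_es -/(e n); apply: (scalerI cn).
  move/eqP: sum0; rewrite addrC addr_eq0 => /eqP->; rewrite scaler_sumr -sumrN.
  apply: eq_bigr => i _; rewrite esE // scalerA mulrN scaleNr mulrCA mulfV //.
  by rewrite mulr1.
move=> i; rewrite ltnS leq_eqVlt => /orP[/eqP->//|]; apply: IHn.
by move: sum0; rewrite cn0 scale0r addr0.
Qed.

Lemma functional_separates (x : X) : x != 0 ->
  exists2 F : X -> K, scalar F & F x != 0.
Proof.
move=> x0; pose G : set (X * K^o) := [set p | exists k : K, p = (k *: x, k)].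
have [|F HF] := @linear_extension _ _ _ G.
  split; first split.
  - by exists 0; rewrite scale0r.
  - move=> k _ _ [l ->] [l' ->]; exists (k * l + l').
    by rewrite scalerDl -scalerA.
  - move=> z [k [/esym/eqP]]; rewrite scaler_eq0 (negPf x0) orbF => /eqP-> ->//.
exists F; first by move=> k y z; rewrite linearP.
rewrite (HF x 1) ?oner_eq0 //; exists 1.
by rewrite scale1r.
Qed.

(** Induction on the number of spanning vectors: a functional f with f y nonzero for some y in P
    cuts P down to its kernel, which is spanned by one vector fewer. *)
Lemma separating_seq (F : (X -> K) -> Prop) (P : set X) : subspace P -> findim P ->
  (forall f, F f -> scalar f) ->
  (forall x, P x -> x != 0 -> exists2 f, F f & f x != 0) ->
  exists r (fs : 'I_r -> (X -> K)), (forall i, F (fs i)) /\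
    forall x, P x -> (forall i, fs i x = 0) -> x = 0.
Proof.
move=> SP [n [b Pb]] Flin; elim: n b P SP Pb => [|n IHn] b P SP Pb Fsep.
  exists 0%N, (fun=> fun=> 0); split=> [[]//|x /Pb[c ->] _].
  by rewrite big_ord0.
have [P0|/existsNP[y /not_implyP[Py /eqP y0]]] := pselect (forall x, P x -> x = 0).
  by exists 0%N, (fun=> fun=> 0); split=> [[]//|x /P0].
have [f Ff fy] := Fsep y Py y0; have flin := Flin f Ff.
have fZ := scalar_scale flin.
have fB u v : f (u - v) = f u - f v.
  by rewrite addrC -scaleN1r flin mulN1r addrC.
have [c yE] := Pb y Py.
have /existsP[k ck] : [exists k, c k != 0].
  apply: contraT => /existsPn c0; move: y0; rewrite yE big1 ?eqxx // => i _.
  by have /negPn/eqP-> := c0 i; rewrite scale0r.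
(* [q] projects onto the kernel of f along y. As q y = 0 and y has a nonzero coefficient at b k, the
   vector q (b k) is a combination of the other q (b i); this saves one spanning vector. *)
pose q x := x - (f x / f y) *: y.
have qlin : linear q.
  move=> l u v; rewrite /q flin mulrDl scalerDl scalerBr opprD addrACA.
  by rewrite -mulrA scalerA.
have q0 : q 0 = 0 by have := qlin (-1) 0 0; rewrite scaler0 addr0 scaleN1r addNr.
have qZ l x : q (l *: x) = l *: q x by rewrite -[l *: x]addr0 qlin q0 addr0.
have qsum m (d : 'I_m -> K) (u : 'I_m -> X) :
    q (\sum_i d i *: u i) = \sum_i d i *: q (u i).
  by elim/big_rec2: _ => [//|i x z _ <-]; rewrite qlin.
have qy : q y = 0 by rewrite /q divff // scale1r subrr.
pose P' : set X := [set x | P x /\ f x = 0].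
have [||x [Px _]|r [fs [Ffs sep]]] := IHn (fun i => q (b (lift k i))) P'.
- split=> [|l u v [Pu fu] [Pv fv]].
    split; first by case: SP.
    by have := fZ 0 0; rewrite scale0r mul0r.
  by split; [apply: (proj2 SP)|rewrite flin fu fv mulr0 addr0].
- move=> x [Px fx]; have [d xE] := Pb x Px.
  have {1}-> : x = \sum_i d i *: q (b i) - (d k / c k) *: \sum_i c i *: q (b i).
    rewrite -!qsum -xE -yE qy scaler0 subr0 /q fx mul0r scale0r.
    by rewrite subr0.
  exists (fun i => d (lift k i) - d k / c k * c (lift k i)).
  rewrite (bigD1_ord k) //= [X in _ - _ *: X](bigD1_ord k) //=.
  rewrite (scalerDr (d k / c k) (c k *: _)) scalerA divfK // opprD addrACA subrr add0r.
  rewrite scaler_sumr -sumrB; apply: eq_bigr => i _.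
  by rewrite scalerBl scalerA.
- by apply: Fsep.
- exists r.+1, (fun i => if unlift ord0 i is Some j then fs j else f); split=> [i|x Px H].
    by case: unliftP => [j _|_].
  apply: sep => [|i].
    by split=> //; have := H ord0; rewrite unlift_none.
  by have := H (lift ord0 i); rewrite liftK.
Qed.

(** On the kernel of the first functional f, induction makes g a combination of the others. The
    difference h vanishes there, so on P it is a multiple of f, with factor h y / f y at any y in P
    where f is nonzero. *)
Lemma functional_combination r (fs : 'I_r -> (X -> K)) (P : set X) (g : X -> K) :
  subspace P -> (forall i, scalar (fs i)) -> scalar g ->
  (forall x, P x -> (forall i, fs i x = 0) -> g x = 0) ->
  exists c : 'I_r -> K, forall x, P x -> g x = \sum_i c i * fs i x.
Proof.
move=> SP; elim: r fs P SP g => [|r IHr] fs P SP g fsl gl ker.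
  by exists (fun=> 0) => x Px; rewrite big_ord0 ker // => -[].
set f := fs ord0; have flin : scalar f := fsl _.
pose P' : set X := [set x | P x /\ f x = 0].
have f0 := scalar_zero flin.
have [|||x [Px fx] H|c cE] := IHr (fun i => fs (lift ord0 i)) P' _ g => //.
- split=> [|l u v [Pu fu] [Pv fv]]; first by split=> //; case: SP.
  by split; [apply: (proj2 SP)|rewrite flin fu fv mulr0 addr0].
- by apply: ker => // i; case: (unliftP ord0 i) => [j ->|->].
pose h x := g x - \sum_i c i * fs (lift ord0 i) x.
have hlin : scalar h.
  move=> k x y; rewrite /h gl [X in _ - X = _](_ : _ = k * \sum_i c i * fs (lift ord0 i) x
    + \sum_i c i * fs (lift ord0 i) y); last first.
    rewrite mulr_sumr -big_split; apply: eq_bigr => i _ /=.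
    by rewrite fsl mulrDr mulrCA.
  by rewrite mulrBr opprD addrACA.
have h0 x : P x -> f x = 0 -> h x = 0 by move=> Px fx; rewrite /h cE ?subrr.
have [[y [Py fy]]|N] := pselect (exists y, P y /\ f y != 0); last first.
  exists (fun i => if unlift ord0 i is Some j then c j else 0) => x Px.
  rewrite big_ord_recl unlift_none mul0r add0r.
  under eq_bigr do rewrite liftK.
  apply: cE; split=> //; apply/eqP; apply: contrapT => fx; apply: N.
  by exists x; split=> //; apply/negP.
exists (fun i => if unlift ord0 i is Some j then c j else h y / f y) => x Px.
rewrite big_ord_recl unlift_none; under eq_bigr do rewrite liftK.
apply/eqP; rewrite -subr_eq; apply/eqP; rewrite -/(h x) -/f.
have : h (- (f x / f y) *: y + x) = 0.
  apply: h0; first by apply: (proj2 SP).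
  by rewrite flin mulNr divfK // addNr.
rewrite hlin mulNr => /eqP; rewrite addrC subr_eq0 => /eqP->.
by rewrite mulrAC [RHS]mulrAC (mulrC (f x)).
Qed.

End Functionals.

(** Some nonzero p has p(T) x = 0. Writing p = q (X - a), either q(T) x = 0 with q of smaller
    degree, or q(T) x is an eigenvector for a. *)
Lemma eigenvector_ex (K : closedFieldType) (X : lmodType K) (T : {linear X -> X}) (x : X) :
  findim [set: X] -> x != 0 -> exists l y, y != 0 /\ T y = l *: y.
Proof.
move=> [n [b Hb]] x0.
(* [ev p] is p(T) x. *)
pose ev (p : {poly K}) := \sum_(i < size p) p`_i *: iter i T x.
have evE m (p : {poly K}) : (size p <= m)%N -> ev p = \sum_(i < m) p`_i *: iter i T x.
  move=> pm; rewrite /ev (big_ord_widen _ (fun i => p`_i *: iter i T x) pm) big_mkcond /=.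
  by apply: eq_bigr => i _; case: ltnP => // pi; rewrite nth_default ?scale0r.
have evX (q : {poly K}) a : ev (q * ('X - a%:P)) = T (ev q) - a *: ev q.
  rewrite (evE (size q).+1); last first.
    have [->|q0] := eqVneq q 0; first by rewrite mul0r size_poly0.
    by rewrite size_Mmonic ?monicXsubC // size_XsubC addn2.
  rewrite {2}(evE (size q).+1) // linear_sum scaler_sumr /= big_ord_recl.
  rewrite [in RHS]big_ord_recl opprD addrCA.
  rewrite -sumrB mulrBr coefB coefMX coefMC /= sub0r; congr (_ + _).
    by rewrite scaleNr mulrC scalerA.
  apply: eq_bigr => i _; rewrite /bump leq0n add1n ?add0n coefB coefMX coefMC scalerBl [i.+1.-1]/=.
  by rewrite scalerA (mulrC a) [in RHS](linearZZ T).
(* The n + 1 vectors T^i x with i <= n have coordinates in K^n, so a nonzero row vector kills their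
   matrix [C]; its entries are the coefficients of p. *)
have [p p0 evp] : exists2 p, p != 0 & ev p = 0.
  have coordE i : exists c : 'rV[K]_n, iter i T x = \sum_j c 0 j *: b j.
    have [c ->] := Hb (iter i T x) I; exists (\row_j c j).
    by apply: eq_bigr => j _; rewrite mxE.
  have [c cE] := choice coordE.
  pose C : 'M[K]_(n.+1, n) := \matrix_(i, j) c i 0 j.
  have kerC : kermx C != 0.
    rewrite kermx_eq0 /row_free; apply: contraTneq (rank_leq_col C) => ->.
    by rewrite -ltnNge.
  have /rowV0Pn[u /sub_kermxP uC u0] := kerC.
  exists (\poly_(i < n.+1) u 0 (inord i)).
    apply: contraNneq u0 => /polyP pE; apply/eqP/rowP => i.
    by have := pE i; rewrite coef_poly ltn_ord inord_val coef0 mxE.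
  rewrite (evE n.+1) ?size_poly //.
  under eq_bigr => i _ do rewrite coef_poly ltn_ord inord_val cE scaler_sumr.
  rewrite exchange_big big1 // => j _ /=.
  have /rowP/(_ j) := uC; rewrite !mxE => uCj.
  rewrite -[RHS](scale0r (b j)) -uCj scaler_suml; apply: eq_bigr => i _.
  by rewrite scalerA mxE.
have [m] := ubnP (size p); elim: m p p0 evp => // m IHm p p0 evp sp.
have [sp1|/closed_rootP[a /factor_theorem[q pE]]] := eqVneq (size p) 1%N.
  have /size_poly1P[k k0 pE] := introT eqP sp1.
  move: evp; rewrite pE /ev size_polyC k0 big_ord1 coefC /= => /eqP.
  by rewrite scaler_eq0 (negPf k0) (negPf x0).
have q0 : q != 0 by apply: contraNneq p0 => q0; rewrite pE q0 mul0r.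
have [evq|evq] := eqVneq (ev q) 0.
  apply: (IHm q) => //; move: sp; rewrite pE size_Mmonic ?monicXsubC //.
  by rewrite size_XsubC addn2.
exists a, (ev q); split=> //; apply/eqP.
by rewrite -subr_eq0 -evX -pE evp.
Qed.

(** * The enveloping algebra and its completion *)

Local Notation vect A := (restr (A^o : lmodType A)).

Section Enveloping.
Variables (K : numClosedFieldType) (V : voa K).
Local Notation U := (envU V).
Local Notation L := (lieU V).

Lemma vop0r n (a : V) : vop a n 0 = 0.
Proof. by have := vop_linearr n a (-1) 0 0; rewrite scaler0 addr0 scaleN1r addNr. Qed.

Lemma vopZr n (a b : V) k : vop a n (k *: b) = k *: vop a n b.
Proof. by rewrite -[k *: b]addr0 vop_linearr vop0r addr0. Qed.

Definition vop_fun (a : V) (n : int) (b : V) : V := vop a n b.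

Let vop_fun_linear a n : linear (vop_fun a n).
Proof. by move=> k x y; apply: vop_linearr. Qed.

HB.instance Definition _ a n :=
  GRing.isLinear.Build K V V _ (vop_fun a n) (vop_fun_linear a n).

Let nat_inj : injective (fun i : nat => i%:R : K).
Proof. by move=> i j /eqP; rewrite eqr_nat => /eqP. Qed.

Let int_inj : injective (fun i : int => i%:~R : K).
Proof. exact: intr_inj. Qed.

(** The Virasoro relation for L_0 and L_1 has no central term and gives [L_0, L_1] = - L_1, so that
    L_1 lowers the L_0-eigenvalue by 1. *)
Lemma vgr_Lop1 h (a : V) : vgr h.+1 a -> vgr h (Lop 1 a).
Proof.
move=> ha.
have PT i (x : V) : vgr i x -> vop_fun (conf V) 1 x = i%:R *: x by apply: vgr_L0.
apply: (eigen_homog (vgr_direct_sum V) PT nat_inj).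
have := vop_virasoro 0 1 a; rewrite !add0r /= scale0r addr0 => /eqP.
rewrite subr_eq /vop_fun /Lop => /eqP->; rewrite (vgr_L0 ha).
rewrite vopZr -scalerDl; congr (_ *: _).
by rewrite -natr1 mulrNz; ring.
Qed.

Lemma vgr_ind (P : V -> Prop) : P 0 -> (forall h a, vgr h a -> P a) ->
  (forall a b, P a -> P b -> P (a + b)) -> forall a, P a.
Proof.
move=> P0 Pgr PD a; have [_ /(_ a)[s [f [fP ->]]] _] := vgr_direct_sum V.
by elim/big_rec: _ => // i x _; apply: PD; apply: Pgr (fP i).
Qed.

Lemma lmode_lin k (a b : V) n : lmode (k *: a + b) n = scal k * lmode a n + lmode b n.
Proof.
rewrite /lmode -cls_scal -clsM -clsD; apply/clsP.
exact/ideal_sub/lie_rel_linear.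
Qed.

Lemma lmode_derivative (a : V) n : lmode (Lop (-1) a) n = - (scal n%:~R * lmode a (n - 1)).
Proof.
rewrite /lmode -cls_scal -clsM -clsN; apply/clsP; rewrite opprK.
exact/ideal_sub/lie_rel_derivative.
Qed.

Lemma cls_sum (B : pzAlgType K) (S : set B) (I : Type) (r : seq I) (f : I -> B) :
  cls S (\sum_(i <- r) f i) = \sum_(i <- r) cls S (f i).
Proof. by elim/big_rec2: _ => [//|i y x _ <-]; rewrite clsD. Qed.

Lemma cls_comm (B : pzAlgType K) (S : set B) x y z : ideal S (x * y - y * x - z) ->
  cls S x * cls S y - cls S y * cls S x = cls S z.
Proof. by move/clsP <-; rewrite clsD clsN !clsM. Qed.

Lemma lmode_bracket (a b : V) m n N :
  (forall j : nat, (N <= j)%N -> vop a j%:Z b = 0) ->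
  lmode a m * lmode b n - lmode b n * lmode a m =
  \sum_(j < N) scal (binz K m j) * lmode (vop a j%:Z b) (m + n - j%:Z).
Proof.
move=> Nab; apply: etrans (cls_comm (ideal_sub (lie_rel_bracket m n Nab))) _.
rewrite cls_sum; apply: eq_bigr => j _.
exact: clsM.
Qed.

Lemma freealg_ind (P : freealg V -> Prop) :
  (forall k, P (scal k)) -> (forall a n, P (gen a n)) ->
  (forall x y, P x -> P y -> P (x + y)) -> (forall x y, P x -> P y -> P (x * y)) ->
  forall x, P x.
Proof.
move=> Ps Pg PD PM x; rewrite (monalg.monalgE x).
elim/big_rec: _ => [|w y _ Py]; first by rewrite -(scal0 (freealg V)).
apply: PD => //; elim: (w : seq _) (monalg.mcoeff w x) => [|[a n] w' IHw] c.
  exact: (Ps c).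
suff -> : monalg.mkmalgU ((a, n) :: w' : word V) c = gen a n * monalg.mkmalgU (w' : word V) c.
  exact: PM.
apply: etrans (esym (monalg.fgmulUU _ _ _ _)).
by rewrite mul1r.
Qed.

(** The algebra is generated by scalars and modes, and these are sums of homogeneous elements.
    Besides giving a map from [lieU] to [envU], this shows that homogeneous elements span [lieU]. *)
Lemma csum_cst (x : L) : csum (fun=> x).
Proof.
elim/cls_ind: x; apply: freealg_ind => [k|a n|x y cx cy|x y cx cy].
- by apply/asboolP; apply: (csum_scal V k).
- exact: lgr_mode_sum.
- have E : (fun=> cls (@lie_rel K V) (x + y)) =
      (fun=> cls (@lie_rel K V) x) + (fun=> cls (@lie_rel K V) y) :> (nat -> L).
    by apply/funext => ?; apply: clsD.
  refine (eq_ind_r (@csum K V) (csum_add cx cy) E).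
- have E : (fun=> cls (@lie_rel K V) (x * y)) =
      (fun=> cls (@lie_rel K V) x) * (fun=> cls (@lie_rel K V) y) :> (nat -> L).
    by apply/funext => ?; apply: clsM.
  refine (eq_ind_r (@csum K V) (csum_mul cx cy) E).
Qed.

Lemma lgr_subspace k : subspace (@lgr K V k : set (vect L)).
Proof. by split=> [|c x y]; [apply: lgr_0|apply: lgr_lin]. Qed.

Lemma csum_subspace_ind (x : nat -> L) n (S : set (vect L)) : subspace S ->
  (forall k y, lgr k y -> S y) -> csum x -> S (x n).
Proof.
move=> SS lS; elim=> [k y [ky _]|y z _ Sy _ Sz]; first exact: lS (ky n).
exact: (subspaceD SS Sy Sz).
Qed.

Lemma sum_binz1 (A : pzAlgType K) (f : nat -> A) N :
  \sum_(j < N.+2) scal (binz K 1 j) * f j = f 0 + f 1.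
Proof.
rewrite !big_ord_recl big1 ?addr0 => [|i _]; last first.
  rewrite (_ : binz _ _ _ = 0) ?scal0 ?mul0r //.
  by rewrite /binz (bigD1 (Ordinal (isT : 1 < (lift ord0 (lift ord0 i)))%N)) //= subrr !mul0r.
by rewrite /binz !big_ord0 big_ord1 /= subr0 !divr1 scal1 !mul1r.
Qed.

Lemma lmode0 n : lmode (0 : V) n = 0.
Proof. by have := lmode_lin (-1) 0 0 n; rewrite scaler0 addr0 scalN1 addNr. Qed.

(** The bracket reduces to (L_{-1} a)_[n+1] + (L_0 a)_[n], that is - (n + 1) a_[n] + h a_[n]. *)
Lemma lgr_mode_comm_conf h (a : V) n : vgr h a ->
  lmode (conf V) 1 * lmode a n - lmode a n * lmode (conf V) 1 =
  scal (h%:Z - n - 1)%:~R * lmode a n.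
Proof.
move=> ha; have [N HN] := vop_truncation (conf V) a.
(* The cutoff is raised by 2 so that the terms j = 0 and j = 1, the only ones with a nonzero
   binomial, are present. *)
rewrite (@lmode_bracket _ _ _ _ N.+2); last by move=> j Nj; apply: HN; lia.
rewrite (sum_binz1 (fun j : nat => lmode (vop (conf V) j%:Z a) (1 + n - j%:Z))).
have -> : vop (conf V) 0 a = Lop (-1) a by [].
rewrite (vgr_L0 ha) subr0 (_ : 1 + n - 1 = n); last by ring.
rewrite lmode_derivative -[_ *: a]addr0 lmode_lin.
rewrite lmode0 addr0 (_ : 1 + n - 1 = n); last by ring.
rewrite -scalN1 mulrA -scalM -mulrDl -scalD; congr (scal _ * _).
by rewrite !rmorphD !rmorphN /=; ring.
Qed.

Section AdEigen.
Variables (A : pzAlgType K) (c : A).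
Implicit Types x y : A.

Lemma ad_eigen0 k : c * 0 - 0 * c = scal k%:~R * 0.
Proof. by rewrite !mulr0 mul0r subrr. Qed.

Lemma ad_eigen1 : c * 1 - 1 * c = scal (0 : int)%:~R * 1.
Proof. by rewrite mulr1 mul1r subrr scal0 mul0r. Qed.

Lemma ad_eigenM k l x y : c * x - x * c = scal k%:~R * x ->
  c * y - y * c = scal l%:~R * y ->
  c * (x * y) - x * y * c = scal (k + l)%:~R * (x * y).
Proof.
move=> Hx Hy; rewrite rmorphD scalD mulrDl.
have -> : scal l%:~R * (x * y) = x * (scal l%:~R * y) by rewrite !mulrA scalC.
by rewrite (mulrA (scal k%:~R)) -Hx -Hy mulrBl mulrBr !mulrA addrA subrK.
Qed.

Lemma ad_eigen_lin k b x y : c * x - x * c = scal k%:~R * x ->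
  c * y - y * c = scal k%:~R * y ->
  c * (scal b * x + y) - (scal b * x + y) * c = scal k%:~R * (scal b * x + y).
Proof.
move=> Hx Hy; rewrite mulrDr mulrDl opprD addrACA Hy mulrDr; congr (_ + _).
have -> : c * (scal b * x) - scal b * x * c = scal b * (c * x - x * c).
  by rewrite mulrBr !mulrA -(scalC b c).
by rewrite Hx !mulrA -!scalM mulrC.
Qed.

End AdEigen.

(* The degree is the eigenvalue of ad L_0; in characteristic 0 this is why the
   gradings of lieU, of envU and of the induced modules are direct sums. *)
Lemma lgr_ad k (x : L) : lgr k x ->
  lmode (conf V) 1 * x - x * lmode (conf V) 1 = scal k%:~R * x.
Proof.
elim=> {k x} [k||h a n|k l x y _ IHx _ IHy|k c x y _ IHx _ IHy].
- exact (ad_eigen0 (lmode (conf V) 1) k).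
- exact (ad_eigen1 (lmode (conf V) 1)).
- exact: lgr_mode_comm_conf.
- exact (ad_eigenM IHx IHy).
- exact (ad_eigen_lin c IHx IHy).
Qed.

Definition ad (A : pzAlgType K) (c : A) (x : vect A) : vect A := c * (x : A) - (x : A) * c.

Let ad_linear (A : pzAlgType K) (c : A) : linear (ad c).
Proof.
move=> k x y; rewrite /ad mulrDr mulrDl opprD addrACA; congr (_ + _).
rewrite -[(k *: x : A)]/(scal k * (x : A)) -[RHS]/(scal k * (_ - _)).
by rewrite mulrBr !mulrA -scalC.
Qed.

HB.instance Definition _ (A : pzAlgType K) (c : A) :=
  GRing.isLinear.Build K (vect A) (vect A) _ (ad c) (ad_linear c).

Lemma lgr_direct_sum : direct_sum (@lgr K V : int -> set (vect L)).
Proof.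
have span (w : vect L) : exists (s : seq int) (f : int -> vect L),
    (forall i, lgr i (f i : L)) /\ w = \sum_(i <- s) f i.
  apply: (direct_sum_span lgr_subspace) => S SS lS.
  exact: (csum_subspace_ind 0 SS lS (csum_cst w)).
exact (direct_sum_eigen (T := ad (lmode (conf V) 1)) int_inj lgr_subspace span lgr_ad).
Qed.

End Enveloping.

Section AbstractAlgebra.
Variables (K : fieldType) (A : pzAlgType K).
Implicit Types x y z : A.

Lemma ad_mul_commuting c u x : c * x - x * c = 0 ->
  c * (u * x) - u * x * c = (c * u - u * c) * x.
Proof.
by move=> /eqP; rewrite subr_eq0 mulrBl -!mulrA => /eqP->.
Qed.

Lemma addrBBK x y z : x - y - z + y = x - z.
Proof. by rewrite addrAC subrK. Qed.

Lemma opp_scal_mul k x : - (scal k * x) = scal (- k) * x.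
Proof. by rewrite -(scalN1 (scal k * x)) mulrA -scalM mulN1r. Qed.

Lemma scal_mul_eq0 k x : k != 0 -> scal k * x = 0 -> x = 0.
Proof.
move=> k0 /(congr1 ( *%R (scal k^-1))).
by rewrite mulr0 mulrA -scalM mulVf // scal1 mul1r.
Qed.

Variable S : set A.

Lemma clsB x y : cls S (x - y) = cls S x - cls S y.
Proof. by rewrite clsD clsN. Qed.

Lemma cls_comm_eq x y z : x * y - y * x = z ->
  cls S x * cls S y - cls S y * cls S x = cls S z.
Proof. by move<-; rewrite clsB !clsM. Qed.

Lemma cls_eq0 x : S x -> cls S x = 0.
Proof. by move=> Sx; rewrite -cls0; apply/clsP; rewrite subr0; apply: ideal_sub. Qed.

End AbstractAlgebra.

(** * Topology of the completion *)

Section Completion.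
Variables (K : numClosedFieldType) (V : voa K).
Local Notation U := (envU V).
Local Notation L := (lieU V).

Lemma lneg_le M N (x : L) : (M <= N)%N -> lneg N x -> lneg M x.
Proof.
move=> MN; elim=> [|k u v kN kv|u v _ IHu _ IHv]; first exact: lneg_0.
- by apply: lneg_gen kv; lia.
- exact: lneg_add.
Qed.

Lemma cneg_add N (x y : cseq V) : cneg N x -> cneg N y -> cneg N (x + y).
Proof.
move=> [m Hm] [n Hn]; exists (maxn m n) => p; rewrite geq_max => /andP[mp np].
exact (lneg_add (Hm p mp) (Hn p np)).
Qed.

Lemma cneg_mull N (x y : cseq V) : cneg N y -> cneg N (x * y).
Proof. move=> [m Hm]; exists m => p mp; exact (lneg_mull (x p) (Hm p mp)). Qed.

Lemma cneg_opp N (x : cseq V) : cneg N x -> cneg N (- x).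
Proof. move=> [m Hm]; exists m => p mp; exact (lneg_opp (Hm p mp)). Qed.

(** A right factor of degree l shifts the left ideals [lneg N] by at most |l|. A member of [csum]
    involves finitely many degrees, so that one M serves all its terms. *)
Lemma csum_mulr (y : nat -> L) : csum y ->
  forall N, exists M, forall n (x : L), lneg M x -> lneg N (x * y n).
Proof.
elim=> [l z [lz _] N|z t _ IHz _ IHt N].
  by exists (N + `|l|)%N => n x Mx; apply: lneg_mulr Mx (lz n).
have [M HM] := IHz N; have [M' HM'] := IHt N.
exists (maxn M M') => n x Mx; rewrite -[(z + t) n]/(z n + t n) mulrDr.
by apply: lneg_add; [apply/HM/lneg_le/Mx/leq_maxl|apply/HM'/lneg_le/Mx/leq_maxr].
Qed.

(** Multiplication by fixed elements on both sides is continuous for the filtration [cneg], so the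
    closure of an ideal is an ideal. *)
Lemma voa_idealP (x : cseq V) : ideal (@voa_ideal K V) x -> voa_ideal x.
Proof.
elim=> {x} [p x q Hx||x y _ IHx _ IHy] N.
- have [M HM] := csum_mulr (asboolP _ (cvalP q)) N.
  have [y [Iy xy]] := Hx M; exists (p * y * q); split; first exact: ideal_mul.
  have -> : p * x * q - p * y * q = p * (x - y) * q by rewrite mulrBr mulrBl.
  have [n0 Hn0] := cneg_mull p xy.
  by exists n0 => n /Hn0; apply: HM.
- exists 0; split; first exact: ideal_0.
  by rewrite subrr; exists 0%N => *; apply: lneg_0.
- have [z [Iz xz]] := IHx N; have [t [It yt]] := IHy N.
  exists (z + t); split; first exact: ideal_add.
  by rewrite opprD addrACA; apply: cneg_add.
Qed.

(** [envU] is Hausdorff because the ideal imposed is closed: an element approximated by it to every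
    order N belongs to it. *)
Lemma unbhd_eq0 (u : U) : (forall N, unbhd N u) -> u = 0.
Proof.
elim/cls_ind: u => x Hx; apply: cls_eq0 => N.
have [y [yN /clsP/voa_idealP/(_ N)[z [Iz xyz]]]] := Hx N.
exists z; split; first exact Iz.
have E : x - y - z + y = x - z by exact (addrBBK x y z).
rewrite -E; exact (cneg_add xyz yN).
Qed.

Lemma unbhd_mulr N l (u v : U) : unbhd (N + `|l|) u -> ugr l v -> unbhd N (u * v).
Proof.
move=> [x [[n0 Hx] ->]] [y [[ly _] ->]]; exists (x * y); split.
  by exists n0 => n /Hx xn; apply: lneg_mulr xn (ly n).
by rewrite clsM.
Qed.

Lemma unbhd_le M N (u : U) : (M <= N)%N -> unbhd N u -> unbhd M u.
Proof.
move=> MN [x [[n0 Hx] ->]]; exists x; split=> //.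
by exists n0 => n /Hx; apply: lneg_le.
Qed.

Lemma unbhd_add N (u v : U) : unbhd N u -> unbhd N v -> unbhd N (u + v).
Proof.
move=> [x [xN ->]] [y [yN ->]]; exists (x + y); split; first exact: cneg_add.
by rewrite clsD.
Qed.

Lemma unbhd_opp N (u : U) : unbhd N u -> unbhd N (- u).
Proof.
move=> [x [xN ->]]; exists (- x); split; first exact: cneg_opp.
by rewrite clsN.
Qed.

Definition cst (x : L) : cseq V := CSeq (asboolT (csum_cst x)).

(** The canonical map from [lieU]. Its image is dense by [cls_approx], so that properties of [envU]
    can be checked on it and extended by continuity. *)
Definition lie_env (x : L) : U := cls (@voa_ideal K V) (cst x).

Lemma lie_envD x y : lie_env (x + y) = lie_env x + lie_env y.
Proof.
apply: etrans (clsD _ _ _); apply: (congr1 (cls _)).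
exact/val_inj.
Qed.

Lemma lie_envM x y : lie_env (x * y) = lie_env x * lie_env y.
Proof.
apply: etrans (clsM _ _ _); apply: (congr1 (cls _)).
exact/val_inj.
Qed.

Lemma lie_env_scal k : lie_env (scal k) = scal k.
Proof. by apply: (congr1 (cls _)); apply/val_inj. Qed.

Lemma lie_envZ k x : lie_env (scal k * x) = scal k * lie_env x.
Proof.
exact (etrans (lie_envM (scal k) x) (congr1 ( *%R^~ (lie_env x)) (lie_env_scal k))).
Qed.

Lemma lie_env_lin k x y : lie_env (scal k * x + y) = scal k * lie_env x + lie_env y.
Proof.
exact (etrans (lie_envD (scal k * x) y) (congr1 (+%R^~ (lie_env y)) (lie_envZ k x))).
Qed.

Lemma lie_env_mode a n : lie_env (lmode a n) = umode a n.
Proof. by apply: (congr1 (cls _)); apply/val_inj. Qed.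

Lemma ugr_lie_env k x : lgr k x -> ugr k (lie_env x).
Proof. by move=> kx; exists (cst x); split=> //; apply: cauchy_cst. Qed.

Lemma unbhd_lie_env N x : lneg N x -> unbhd N (lie_env x).
Proof. by move=> Nx; exists (cst x); split=> //; exists 0%N. Qed.

Lemma cls_approx k (x : cseq V) N : cauchy k (cval x) ->
  exists n0, forall n, (n0 <= n)%N -> unbhd N (cls (@voa_ideal K V) x - lie_env (x n)).
Proof.
move=> [_ /(_ N)[n0 Hx]]; exists n0 => n n0n; exists (x - cst (x n)); split.
  by exists n0 => m n0m; apply: Hx.
by rewrite clsB.
Qed.

Lemma ugr_subspace k : subspace (@ugr K V k : set (vect U)).
Proof.
split=> [|c x y kx ky]; first exact: ugr_0.
apply: ugr_add => //; rewrite -[k]add0r.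
exact: ugr_mul (ugr_scal _ _) kx.
Qed.

Lemma ugr_ad k (u : U) : ugr k u ->
  umode (conf V) 1 * u - u * umode (conf V) 1 = scal k%:~R * u.
Proof.
move=> [x [[kx _] ->]]; apply: etrans (cls_comm_eq _ (z := scal k%:~R * x) _) _.
  by apply/val_inj/funext => n; exact (lgr_ad (kx n)).
exact: clsM.
Qed.

Lemma ugr_direct_sum : direct_sum (@ugr K V : int -> set (vect U)).
Proof.
have span (w : vect U) : exists (s : seq int) (f : int -> vect U),
    (forall i, ugr i (f i : U)) /\ w = \sum_(i <- s) f i.
  apply: (direct_sum_span ugr_subspace) => S SS uS.
  elim/ugr_ind: w => [k u|u v Su Sv]; first exact: uS.
  exact: (subspaceD SS Su Sv).
exact (direct_sum_eigen (T := ad (umode (conf V) 1)) (@intr_inj K) ugr_subspace span ugr_ad).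
Qed.

Definition uproj (k : int) (u : U) : U := dproj (@ugr K V : int -> set (vect U)) k u.
Definition lproj (k : int) (x : L) : L := dproj (@lgr K V : int -> set (vect L)) k x.

Lemma lproj_in k x : lgr k (lproj k x).
Proof. exact (dproj_in (lgr_direct_sum V) k (x : vect L)). Qed.

Lemma lprojD k x y : lproj k (x + y) = lproj k x + lproj k y.
Proof. exact (dprojD (lgr_direct_sum V) k (x : vect L) y). Qed.

Lemma lproj0 k : lproj k 0 = 0.
Proof. exact (dproj0 (lgr_direct_sum V) k). Qed.

Lemma lproj_homog l x k : lgr l x -> lproj k x = if k == l then x else 0.
Proof.
move=> lx.
exact (dproj_homog (lgr_direct_sum V) (lx : (@lgr K V l : set (vect L)) x) k).
Qed.

Lemma uproj_in k u : ugr k (uproj k u).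
Proof. exact (dproj_in ugr_direct_sum k (u : vect U)). Qed.

Lemma uprojD k u v : uproj k (u + v) = uproj k u + uproj k v.
Proof. exact (dprojD ugr_direct_sum k (u : vect U) v). Qed.

Lemma uproj_homog l u k : ugr l u -> uproj k u = if k == l then u else 0.
Proof. by move=> lu; exact (dproj_homog ugr_direct_sum (lu : (@ugr K V l : set (vect U)) u) k). Qed.

Lemma lgr_ind (P : L -> Prop) : (forall k x, lgr k x -> P x) ->
  (forall x y, P x -> P y -> P (x + y)) -> forall x, P x.
Proof.
move=> Pgr PD x.
have [s _ [_ ->]] := dproj_sum (lgr_direct_sum V) (x : vect L).
elim/big_rec: _ => [|k y _ Py]; first exact (Pgr 0 0 (lgr_0 V 0)).
exact (PD _ _ (Pgr k _ (lproj_in k x)) Py).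
Qed.

Lemma lproj_mulr k l x y : lgr l y -> lproj k (x * y) = lproj (k - l) x * y.
Proof.
move=> ly; elim/lgr_ind: x => [j x jx|x z IHx IHz].
  rewrite (lproj_homog k (lgr_mul jx ly)) (lproj_homog (k - l) jx) subr_eq.
  by case: ifP => // _; rewrite mul0r.
apply: etrans (congr1 (lproj k) (mulrDl x z y)) _.
apply: etrans (lprojD k (x * y) (z * y)) _; apply: etrans (congr2 +%R IHx IHz) _.
apply: etrans (esym (mulrDl (lproj (k - l) x) _ y)) _.
exact (congr1 ( *%R^~ y) (esym (lprojD (k - l) x z))).
Qed.

(** The generators of the left ideal are homogeneous: projecting x y with y homogeneous changes only
    the factor x. *)
Lemma lneg_lproj N k x : lneg N x -> lneg N (lproj k x).
Proof.
elim=> {x} [|l x y lN ly|x y _ IHx _ IHy].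
- rewrite lproj0; exact: lneg_0.
- rewrite (lproj_mulr k x ly); exact (lneg_gen (lproj (k - l) x) lN ly).
- rewrite lprojD; exact: lneg_add.
Qed.

Lemma negprod_lie_env N k x : (0 < N)%N -> lneg N x -> negprod k (lie_env (lproj k x)).
Proof.
move=> N0; elim=> {x} [|l x y lN ly|x y _ IHx _ IHy].
- rewrite lproj0 (_ : lie_env 0 = 0); first exact: negprod_0.
  by apply: (congr1 (cls _)); apply/val_inj.
- rewrite (lproj_mulr k x ly) lie_envM; apply: (@negprod_gen _ _ _ `|l|%N); first lia.
    by rewrite (_ : k + _ = k - l); [apply/ugr_lie_env/lproj_in|lia].
  by rewrite (_ : - _ = l); [apply: ugr_lie_env|lia].
- rewrite lprojD lie_envD; exact: negprod_add.
Qed.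

Lemma cauchy_lproj k x : csum x -> cauchy k (fun n => lproj k (x n)).
Proof.
elim=> {x} [l x [lx cx]|x y _ IHx _ IHy].
  split=> [n|N]; first exact: lproj_in.
  have [n0 H] := cx N; exists n0 => m n n0m n0n.
  rewrite (lproj_homog k (lx m)) (lproj_homog k (lx n)).
  by case: ifP => _; [exact (H m n n0m n0n)|rewrite subrr; apply: lneg_0].
rewrite (_ : (fun n => _) = (fun n => lproj k (x n)) + (fun n => lproj k (y n))).
  exact (cauchy_add IHx IHy).
by apply/funext => n; apply: lprojD.
Qed.

Lemma uproj_cls k (x : cseq V) (y : cseq V) :
  (forall n, cval y n = lproj k (cval x n)) ->
  uproj k (cls (@voa_ideal K V) x) = cls (@voa_ideal K V) y.
Proof.
case: x => x xP /=; have cx : csum x by apply/asboolP.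
elim: cx xP y => {x} [l x lx|x1 x2 c1 IH1 c2 IH2] xP y yE.
  have lu : ugr l (cls (@voa_ideal K V) (CSeq xP)) by exists (CSeq xP).
  rewrite (uproj_homog k lu); case: eqP => kl.
    apply: (congr1 (cls _)); apply/val_inj/funext => n /=.
    by rewrite yE (lproj_homog k (lx.1 n)) kl eqxx.
  rewrite -cls0; apply: (congr1 (cls _)); apply/val_inj/funext => n /=.
  by rewrite yE (lproj_homog k (lx.1 n)); case: eqP.
have p1 : (x1 : nat -> L) \in @csum_pred K V by apply/asboolP.
have p2 : (x2 : nat -> L) \in @csum_pred K V by apply/asboolP.
have q1 : (fun n => lproj k (x1 n)) \in @csum_pred K V.
  by apply/asboolP/csum_cauchy/cauchy_lproj.
have q2 : (fun n => lproj k (x2 n)) \in @csum_pred K V.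
  by apply/asboolP/csum_cauchy/cauchy_lproj.
have -> : CSeq xP = CSeq p1 + CSeq p2 by apply/val_inj.
have -> : y = CSeq q1 + CSeq q2.
  by apply/val_inj/funext => n /=; rewrite yE; apply: lprojD.
rewrite clsD uprojD (IH1 p1 (CSeq q1)) // (IH2 p2 (CSeq q2)) //.
exact/esym/clsD.
Qed.

(** The two hypotheses provide one homogeneous representative and another small one; projecting the
    terms of the small one to degree k makes it both. *)
Lemma ugr_unbhd k N (u : U) : ugr k u -> unbhd N u ->
  exists x : cseq V, [/\ cauchy k (cval x), cneg N x & u = cls (@voa_ideal K V) x].
Proof.
move=> ku [x [[n0 xN] uE]].
have cx : cauchy k (fun n => lproj k (cval x n)) by apply/cauchy_lproj/asboolP/cvalP.
have xP : (fun n => lproj k (cval x n)) \in @csum_pred K V by apply/asboolP/csum_cauchy/cx.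
exists (CSeq xP); split; first exact cx.
  by exists n0 => n n0n; exact (lneg_lproj k (xN n n0n)).
rewrite -(@uproj_cls k x (CSeq xP)) // -uE (uproj_homog k ku).
by rewrite eqxx.
Qed.

(* A Cauchy sequence representing u may be chosen homogeneous with tail in the
   left ideal generated by degrees <= -N; its terms then lie in U . U_{<=-1}. *)
Lemma unbhd_negid k N (u : U) : (0 < N)%N -> ugr k u -> unbhd N u -> negid k u.
Proof.
move=> N0 ku uN; split=> // M.
have [x [cx [n0 xN] ->]] := ugr_unbhd ku uN.
have [n1 H] := cls_approx M cx; exists (lie_env (x (maxn n0 n1))); split.
  have E : lproj k (x (maxn n0 n1)) = x (maxn n0 n1).
    by rewrite (lproj_homog k (cx.1 _)) eqxx.
  rewrite -E; exact (negprod_lie_env k N0 (xN _ (leq_maxl n0 n1))).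
by apply: H; apply: leq_maxr.
Qed.

End Completion.

(** * The anti-automorphism theta is an involution *)

Section ThetaSums.
Variable K : numFieldType.

(** Multiplied by k!, the sum is the binomial expansion of (1 - 1)^k. *)
Lemma sum_alternating_fact k :
  \sum_(i < k.+1) (-1) ^+ i / (i`!%:R * (k - i)`!%:R) = (k == 0)%:R :> K.
Proof.
have fact_neq0 n : n`!%:R != 0 :> K by rewrite pnatr_eq0 -lt0n fact_gt0.
have [->|k0] := eqVneq k 0; first by rewrite big_ord1 /= expr0 !mulr1 invr1 mulr1.
apply: (mulfI (fact_neq0 k)); rewrite mulr0 mulr_sumr.
have := exprBn (1 : K) 1 k; rewrite subrr expr0n (negPf k0) => /esym E.
rewrite -[RHS]E; apply: eq_bigr => -[i /= ik] _.
rewrite !expr1n !mulr1 -(bin_fact (m := i) (n := k)) // !natrM -[RHS]mulr_natr.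
by field; rewrite !fact_neq0.
Qed.

(** Collecting the terms with i + j = k gives x k the coefficient of [sum_alternating_fact], which
    vanishes unless k = 0. *)
Lemma sum_alternating_triangle (X : lmodType K) (x : nat -> X) h :
  \sum_(i < h.+1) \sum_(j < (h - i).+1)
    ((-1) ^+ i / (i`!%:R * j`!%:R)) *: x (i + j)%N = x 0.
Proof.
pose F i k := ((-1) ^+ i / (i`!%:R * (k - i)`!%:R)) *: x k.
transitivity (\sum_(i < h.+1) \sum_(k < h.+1 | (i <= k)%N) F i k).
  apply: eq_bigr => i _; have ih : (i <= h)%N by rewrite -ltnS.
  transitivity (\sum_(i <= k < h.+1) F i k); last by rewrite big_geq_mkord.
  rewrite -[X in \sum_(X <= _ < _) _]add0n big_addn subSn // big_mkord; apply: eq_bigr => j _.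
  by rewrite /F addnK addnC.
rewrite (exchange_big_dep xpredT) //=.
transitivity (\sum_(k < h.+1) ((k == 0 :> nat)%:R : K) *: x k).
  apply: eq_bigr => k _; rewrite -sum_alternating_fact scaler_suml.
  by rewrite (big_ord_widen h.+1 (fun i => F i k) (ltn_ord k)).
rewrite big_ord_recl /= scale1r big1 ?addr0 // => i _.
by rewrite scale0r.
Qed.

(** The formal core of theta^2 = 1 on a mode of a: [x i] and [y i] stand for modes of L_1^i a with
    opposite shifts. As L_1^i a has degree h - i, the signs combine to (-1)^h (-1)^(h-i) =
    (-1)^i. *)
Lemma sum_alternating_involution (A : pzAlgType K) (th : A -> A) (x y : nat -> A) h :
  (forall u v, th (u + v) = th u + th v) ->
  (forall c u, th (scal c * u) = scal c * th u) ->
  (forall i, (i <= h)%N -> th (y i) = scal ((-1) ^+ (h - i)) *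
    \sum_(j < (h - i).+1) scal (j`!%:R^-1) * x (i + j)%N) ->
  th (scal ((-1) ^+ h) * \sum_(i < h.+1) scal (i`!%:R^-1) * y i) = x 0.
Proof.
move=> thD thZ thy.
have th0 : th 0 = 0 by apply: (addrI (th 0)); rewrite -thD !addr0.
rewrite thZ (big_morph th thD th0) mulr_sumr.
rewrite -[RHS](@sum_alternating_triangle (vect A) x h).
apply: eq_bigr => i _; have ih : (i <= h)%N by rewrite -ltnS.
rewrite thZ (thy i ih) !mulr_sumr; apply: eq_bigr => j _.
rewrite -[RHS]/(scal _ * _) !mulrA -!scalM; congr (scal _ * _).
have -> : (-1) ^+ i = (-1) ^+ h * (-1) ^+ (h - i) :> K.
  rewrite -signr_odd -[in RHS]signr_odd -[X in _ * X]signr_odd -signr_addb -oddD.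
  by congr ((-1) ^+ _); lia.
have fact_neq0 n : n`!%:R != 0 :> K by rewrite pnatr_eq0 -lt0n fact_gt0.
by field; rewrite !fact_neq0.
Qed.

End ThetaSums.

Section ThetaInvolution.
Variables (K : numClosedFieldType) (V : voa K) (th : theta_antiaut V).
Local Notation U := (envU V).
Local Notation L := (lieU V).

Lemma thetaZ c (u : U) : th (scal c * u) = scal c * th u.
Proof. by rewrite thetaM theta_scal -scalC. Qed.

Lemma iter_Lop1 i h (a : V) : (i <= h)%N -> vgr h a -> vgr (h - i)%N (iter i (Lop 1) a).
Proof.
move=> + ha; elim: i => [|i IHi] ih /=; first by rewrite subn0.
by apply: vgr_Lop1; rewrite -subSn // subSS; apply: IHi; apply: ltnW.
Qed.

Lemma theta_mode_involutive h (a : V) n : vgr h a -> th (th (umode a n)) = umode a n.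
Proof.
(* The shift m is the one for which [theta_mode] applies to a_[n]; theta exchanges m and - m. *)
move=> ha; pose m := n - h%:Z + 1.
have nE : n = h%:Z - 1 + m by rewrite /m; ring.
rewrite nE (theta_mode th m ha).
pose x k := umode (iter k (Lop 1) a) (h%:Z - k%:Z - 1 + m).
pose y k := umode (iter k (Lop 1) a) (h%:Z - k%:Z - 1 - m).
have thy i : (i <= h)%N -> th (y i) = scal ((-1) ^+ (h - i)) *
    \sum_(j < (h - i).+1) scal (j`!%:R^-1) * x (i + j)%N.
  move=> ih; rewrite /y (_ : _ - m = (h - i)%N%:Z - 1 + - m); last by lia.
  rewrite (theta_mode th (- m) (iter_Lop1 ih ha)).
  apply: congr1; apply: eq_bigr => j _; apply: congr1.
  rewrite /x addnC iterD (_ : _ - - m = h%:Z - (j + i)%N%:Z - 1 + m) //.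
  by have := ltn_ord j; lia.
apply: etrans (sum_alternating_involution (thetaD th) thetaZ thy) _.
by rewrite /x (_ : _ + m = h%:Z - 1 + m) //; ring.
Qed.

Lemma theta_lie_env_involutive k (x : L) : lgr k x -> th (th (lie_env x)) = lie_env x.
Proof.
elim=> {k x} [k||h a n ha|k l x y _ IHx _ IHy|k c x y _ IHx _ IHy].
- by rewrite -(scal0 L) lie_env_scal !theta_scal.
- by rewrite -(scal1 (K := K) (s := L)) lie_env_scal !theta_scal.
- by rewrite lie_env_mode; exact (theta_mode_involutive n ha).
- by rewrite lie_envM !thetaM IHx IHy.
- by rewrite lie_envD lie_envM lie_env_scal !thetaD !thetaZ IHx IHy.
Qed.

(* True on the modes, hence on the dense image of lieU, hence on the Hausdorff
   completion by continuity. *)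
Lemma theta_involutive : involutive th.
Proof.
elim/ugr_ind => [k u ku|u v IHu IHv]; last by rewrite !thetaD IHu IHv.
apply/eqP; rewrite -subr_eq0; apply/eqP/unbhd_eq0 => N.
have [M HM] := theta_continuous th (- k) N.
have [M' HM'] := theta_continuous th k M.
have [x [cx uE]] := ku; have [n0 H] := cls_approx (maxn M' N) cx.
pose v := lie_env (x n0); have uv : unbhd (maxn M' N) (u - v) by rewrite uE; apply: H.
have kv : ugr k v by apply: ugr_lie_env (cx.1 n0).
have kuv : ugr k (u - v) by apply: ugr_add ku (ugr_opp kv).
have E : th (th u) - u = th (th (u - v)) - (u - v).
  rewrite thetaD thetaN thetaD thetaN (theta_lie_env_involutive (cx.1 n0)) -/v.
  by rewrite opprB addrA subrK.
rewrite E; apply: unbhd_add; last first.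
  exact (unbhd_opp (unbhd_le (leq_maxr M' N) uv)).
apply: HM; first exact: theta_ugr kuv.
exact (HM' _ kuv (unbhd_le (leq_maxl M' N) uv)).
Qed.

End ThetaInvolution.

(** * Induced modules *)

Section Induced.
Variables (K : numClosedFieldType) (V : voa K) (M : lmodType (zhu V)).
Local Notation U := (envU V).
Local Notation L := (lieU V).
Implicit Types (u v : U) (m : M).

Lemma tensDl u v m : tens (u + v) m = tens u m + tens v m.
Proof. by rewrite -[RHS]tclsD; apply/tclsP/tens_addl. Qed.

Lemma tensDr u m n : tens u (m + n) = tens u m + tens u n.
Proof. by rewrite -[RHS]tclsD; apply/tclsP/tens_addr. Qed.

Lemma tens_balanced u (x : U0 V) m : tens (u * u0val x) m = tens u (zcls x *: m).
Proof. exact/tclsP/tens_bal. Qed.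

Lemma tens_negid k u m : negid k u -> tens u m = 0.
Proof. by move=> ku; apply/tclsP/(tens_neg _ ku). Qed.

Lemma tens_scale u v m : u *: (tens v m : Phi M) = tens (u * v) m.
Proof. exact/esym/(tclsZ u [:: (v, m)]). Qed.

Lemma tcls_cons p (s : seq (U * M)) : tcls (p :: s) = tens p.1 p.2 + tcls s.
Proof. by rewrite -cat1s tclsD; case: p. Qed.

Lemma Phi_pc_tens d u m : ugr d%:Z u -> gpc (g := Phi M) d (tens u m).
Proof. by move=> du; exists [:: (u, m)]; split=> // p; rewrite inE => /eqP->. Qed.

Lemma Phi_pc_ind d (P : Phi M -> Prop) : P 0 ->
  (forall u m, ugr d%:Z u -> P (tens u m)) ->
  (forall x y, P x -> P y -> P (x + y)) -> forall x, gpc d x -> P x.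
Proof.
move=> P0 Ptens PD _ [s [sd ->]]; elim: s sd => [//|p s IHs] sd.
rewrite tcls_cons; apply: PD; first by apply/Ptens/sd/mem_head.
by apply: IHs => q qs; apply: sd; rewrite inE qs orbT.
Qed.

Lemma Phi_ind (P : Phi M -> Prop) : P 0 ->
  (forall d u m, ugr d%:Z u -> P (tens u m)) ->
  (forall x y, P x -> P y -> P (x + y)) -> forall x, P x.
Proof.
move=> P0 Ptens PD; elim/tcls_ind; elim=> [//|[u m] s IHs].
rewrite tcls_cons; apply: (PD) => {s IHs}//=.
elim/ugr_ind: u => [k u ku|u v Pu Pv]; last by rewrite tensDl; apply: PD.
case: k ku => [d|d] ku; first exact: Ptens ku.
by rewrite (@tens_negid (Negz d)) //; apply: negid_neg.
Qed.

Section Rec.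
Variables (Z : zmodType) (g : U -> M -> Z).
Hypotheses (gDl : forall u v m, g (u + v) m = g u m + g v m)
  (gDr : forall u m n, g u (m + n) = g u m + g u n)
  (gbal : forall u (x : U0 V) m, g (u * u0val x) m = g u (zcls x *: m))
  (gneg : forall k u m, negid k u -> g u m = 0).

(** The universal property of the tensor product: the hypotheses of the section are the generating
    relations of [tens_eq], which makes the value independent of the chosen representative. *)
Definition Phi_rec (x : Phi M) : Z :=
  \sum_(p <- repr (x : Phi_sort M)) g p.1 p.2.

Lemma Phi_rec_tcls s : Phi_rec (tcls s) = \sum_(p <- s) g p.1 p.2.
Proof.
have := repr_tcls s; rewrite /Phi_rec; move: (repr _) => t.
elim=> {s t}//.
- by move=> s t r _ -> _ ->.
- by move=> s s' t t' _ IHs _ IHt; rewrite !big_cat /= IHs IHt.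
- by move=> s t; rewrite !big_cat /= addrC.
- by move=> u v m; rewrite !big_cons !big_nil !addr0 gDl.
- by move=> u m n; rewrite !big_cons !big_nil !addr0 gDr.
- by move=> u x m; rewrite !big_seq1 gbal.
- by move=> k u m ku; rewrite big_nil big_seq1 (gneg _ ku).
Qed.

Lemma Phi_rec_tens u m : Phi_rec (tens u m) = g u m.
Proof. by rewrite Phi_rec_tcls big_seq1. Qed.

Lemma Phi_recD x y : Phi_rec (x + y) = Phi_rec x + Phi_rec y.
Proof.
elim/tcls_ind: x => s; elim/tcls_ind: y => t.
by rewrite -[X in Phi_rec X]tclsD !Phi_rec_tcls big_cat.
Qed.

Lemma Phi_rec0 : Phi_rec 0 = 0.
Proof. by apply: (addrI (Phi_rec 0)); rewrite -Phi_recD !addr0. Qed.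

End Rec.

Lemma ugr_umode h (a : V) n : vgr h a -> ugr (h%:Z - n - 1) (umode a n).
Proof. by move=> ha; rewrite -lie_env_mode; apply/ugr_lie_env/lgr_mode. Qed.

(** L_0 omega = L_0 L_{-2} vac = [L_0, L_{-2}] vac = 2 omega, without central term since 0 + (-2) is
    nonzero. *)
Lemma vgr_conf : vgr 2 (conf V).
Proof.
have PT i (x : V) : vgr i x -> vop_fun (conf V) 1 x = i%:R *: x by apply: vgr_L0.
apply: (eigen_homog (vgr_direct_sum V) PT).
  by move=> i j /eqP; rewrite eqr_nat => /eqP.
have := vop_virasoro 0 (-2) (vac V).
rewrite /= scale0r addr0 add0r (vop_creation0 (conf V) 1) vop0r subr0.
by rewrite vop_creation.
Qed.

Local Notation c := (umode (conf V) 1).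

Lemma ugr_conf : ugr 0 c.
Proof. exact (ugr_umode 1 vgr_conf). Qed.

(** The degree operator u (x) m -> [L_0, u] (x) m, well defined because L_0 commutes with U_0. The
    action of L_0 itself need not separate degrees, as nothing is known here about L_0 on M. *)
Definition Phi_degree : Phi M -> Phi M :=
  Phi_rec (fun u m => tens (c * u - u * c) m : Phi M).

Let degDl u v m : tens (c * (u + v) - (u + v) * c) m =
  tens (c * u - u * c) m + tens (c * v - v * c) m :> Phi M.
Proof.
by rewrite -tensDl; apply: (congr1 (fun w => tens w m : Phi M)); exact (linearD (ad c) u v).
Qed.

Let degZ k u m : tens (c * (scal k * u) - scal k * u * c) m =
  (scal k : U) *: (tens (c * u - u * c) m : Phi M).
Proof.
rewrite tens_scale; apply: (congr1 (fun w => tens w m : Phi M)).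
exact (linearZZ (ad c) k (u : vect U)).
Qed.

Let degDr u m n : tens (c * u - u * c) (m + n) =
  tens (c * u - u * c) m + tens (c * u - u * c) n :> Phi M.
Proof. exact: tensDr. Qed.

Let degbal u (x : U0 V) m : tens (c * (u * u0val x) - u * u0val x * c) m =
  tens (c * u - u * c) (zcls x *: m) :> Phi M.
Proof.
rewrite -tens_balanced; apply: (congr1 (fun w => tens w m : Phi M)).
have := ugr_ad (asboolP _ (u0valP x)); rewrite scal0 mul0r.
exact: ad_mul_commuting.
Qed.

Let degneg k u m : negid k u -> tens (c * u - u * c) m = 0 :> Phi M.
Proof.
move=> ku; rewrite (ugr_ad ku.1); apply: (@tens_negid (0 + k)).
exact: negid_mull (ugr_scal _ _) ku.
Qed.

Lemma Phi_degree_tens u m : Phi_degree (tens u m) = tens (c * u - u * c) m.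
Proof. exact (Phi_rec_tens degDl degDr degbal degneg u m). Qed.

Lemma Phi_degreeD x y : Phi_degree (x + y) = Phi_degree x + Phi_degree y.
Proof. exact (Phi_recD degDl degDr degbal degneg x y). Qed.

Lemma Phi_degree0 : Phi_degree 0 = 0.
Proof. exact (Phi_rec0 degDl degDr degbal degneg). Qed.

Lemma Phi_degree_linear : linear (Phi_degree : restr (Phi M) -> restr (Phi M)).
Proof.
move=> k x y; rewrite Phi_degreeD; congr (_ + _).
rewrite -[k *: x]/((scal k : U) *: (x : Phi M)).
rewrite -[RHS]/((scal k : U) *: (Phi_degree x : Phi M)).
elim/Phi_ind: x => [|d u m _|x z IHx IHz].
- by rewrite scaler0 Phi_degree0 scaler0.
- by rewrite tens_scale !Phi_degree_tens; apply: degZ.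
- by rewrite scalerDr !Phi_degreeD scalerDr IHx IHz.
Qed.

Lemma Phi_degree_pc d x : gpc d x -> Phi_degree x = d%:R *: (x : restr (Phi M)).
Proof.
elim/Phi_pc_ind: x / => [|u m du|x y IHx IHy].
- by rewrite Phi_degree0 scaler0.
- rewrite Phi_degree_tens (ugr_ad du); exact/esym/tens_scale.
- by rewrite Phi_degreeD IHx IHy scalerDr.
Qed.

Lemma Phi_direct_sum : direct_sum (gpc (g := Phi M) : nat -> set (restr (Phi M))).
Proof.
have natI : injective (fun i : nat => i%:R : K) by move=> i j /eqP; rewrite eqr_nat => /eqP.
have span (w : restr (Phi M)) : exists (s : seq nat) (f : nat -> restr (Phi M)),
    (forall i, gpc (g := Phi M) i (f i)) /\ w = \sum_(i <- s) f i.
  apply: (direct_sum_span (@gpc_subspace _ _ (Phi M))) => S SS pcS.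
  elim/Phi_ind: w => [|d u m du|x y Sx Sy]; first by case: SS.
    exact: (pcS d _ (Phi_pc_tens _ du)).
  exact: (subspaceD SS Sx Sy).
pose TL := GRing.isLinear.Build K (restr (Phi M)) (restr (Phi M)) _ _ Phi_degree_linear.
pose T : {linear restr (Phi M) -> restr (Phi M)} :=
  HB.pack (Phi_degree : restr (Phi M) -> restr (Phi M)) TL.
exact (direct_sum_eigen (T := T) natI (@gpc_subspace _ _ (Phi M)) span Phi_degree_pc).
Qed.

(** * The lowest piece of an induced module *)

Lemma U0_uproj u : uproj 0 u \in @U0_pred K V.
Proof. exact/asboolP/uproj_in. Qed.

Definition deg0 u : U0 V := MkU0 (U0_uproj u).

Lemma deg0D u v : deg0 (u + v) = deg0 u + deg0 v.
Proof. by apply/val_inj; exact (uprojD 0 u v). Qed.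

Lemma deg0_id u (x : U0 V) : u = u0val x -> deg0 u = x.
Proof.
move->; apply/val_inj => /=.
by rewrite (uproj_homog 0 (asboolP _ (u0valP x))) eqxx.
Qed.

Lemma deg0_neq k u : ugr k u -> k != 0 -> deg0 u = 0.
Proof.
move=> ku k0; apply/val_inj; apply: etrans (uproj_homog 0 ku) _.
by rewrite eq_sym (negPf k0).
Qed.

Lemma deg0_mulr u (x : U0 V) : deg0 (u * u0val x) = deg0 u * x.
Proof.
have x0 := asboolP _ (u0valP x).
elim/ugr_ind: u => [k u ku|u v IHu IHv]; last by rewrite mulrDl !deg0D mulrDl IHu IHv.
have [k0|k0] := eqVneq k 0; last first.
  rewrite (deg0_neq ku k0) mul0r; apply: (@deg0_neq (k + 0)); last by rewrite addr0.
  exact: ugr_mul ku x0.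
rewrite k0 in ku.
have uP : u \in @U0_pred K V by apply/asboolP.
by rewrite (@deg0_id u (MkU0 uP)) // (@deg0_id _ (MkU0 uP * x)).
Qed.

Lemma zcls_deg0_negid k u : negid k u -> zcls (deg0 u) = 0.
Proof.
move=> ku; have [k0|k0] := eqVneq k 0; last first.
  by rewrite (deg0_neq ku.1 k0); apply: cls0.
apply: cls_eq0; rewrite k0 in ku; rewrite /zhu_ideal /= (uproj_homog 0 ku.1) eqxx.
exact: ku.
Qed.

(** The projection to degree 0 followed by the identification of that piece with M: by
    [Phi_lowest_tens1] and [tens1_lowest] it is inverse there to m -> 1 (x) m. *)
Definition Phi_lowest : Phi M -> M := Phi_rec (fun u m => zcls (deg0 u) *: m).

Let lowDl u v m : zcls (deg0 (u + v)) *: m = zcls (deg0 u) *: m + zcls (deg0 v) *: m.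
Proof. by rewrite deg0D -scalerDl; apply: (congr1 (fun a : zhu V => a *: m)); apply: clsD. Qed.

Let lowDr u m n : zcls (deg0 u) *: (m + n) = zcls (deg0 u) *: m + zcls (deg0 u) *: n.
Proof. exact: scalerDr. Qed.

Let lowbal u (x : U0 V) m : zcls (deg0 (u * u0val x)) *: m = zcls (deg0 u) *: (zcls x *: m).
Proof.
rewrite scalerA; apply: (congr1 (fun a : zhu V => a *: m)).
by rewrite deg0_mulr; apply: clsM.
Qed.

Let lowneg k u m : negid k u -> zcls (deg0 u) *: m = 0.
Proof. by move=> /zcls_deg0_negid->; rewrite scale0r. Qed.

Lemma Phi_lowest_tens u m : Phi_lowest (tens u m) = zcls (deg0 u) *: m.
Proof. exact (Phi_rec_tens lowDl lowDr lowbal lowneg u m). Qed.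

Lemma Phi_lowestD x y : Phi_lowest (x + y) = Phi_lowest x + Phi_lowest y.
Proof. exact (Phi_recD lowDl lowDr lowbal lowneg x y). Qed.

Lemma Phi_lowest0 : Phi_lowest 0 = 0.
Proof. exact (Phi_rec0 lowDl lowDr lowbal lowneg). Qed.

Lemma Phi_lowest_tens1 m : Phi_lowest (tens 1 m) = m.
Proof.
rewrite Phi_lowest_tens (_ : deg0 1 = 1); last by apply: deg0_id.
exact: scale1r.
Qed.

Lemma Phi_lowest_neq d x : gpc d x -> d != 0%N -> Phi_lowest x = 0.
Proof.
move=> + d0; elim/Phi_pc_ind: x / => [|u m du|x y IHx IHy].
- exact: Phi_lowest0.
- by rewrite Phi_lowest_tens (deg0_neq du) // (_ : zcls 0 = 0) ?scale0r.
- by rewrite Phi_lowestD IHx IHy addr0.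
Qed.

Lemma tens1_lowest x : gpc 0 x -> tens 1 (Phi_lowest x) = x.
Proof.
elim/Phi_pc_ind: x / => [|u m u0|x y IHx IHy].
- by rewrite Phi_lowest0; apply: (addrI (tens 1 0)); rewrite -tensDr !addr0.
- have uP : u \in @U0_pred K V by apply/asboolP.
  by rewrite Phi_lowest_tens (@deg0_id u (MkU0 uP)) // -tens_balanced mul1r.
- by rewrite Phi_lowestD tensDr IHx IHy.
Qed.

Lemma Phi_pc0_tens1 m : gpc (g := Phi M) 0 (tens 1 m).
Proof. by apply: Phi_pc_tens; apply: ugr_1. Qed.

Lemma tens1_scale (x : U0 V) m : u0val x *: (tens 1 m : Phi M) = tens 1 (zcls x *: m).
Proof. by rewrite tens_scale -tens_balanced mulr1 mul1r. Qed.

Lemma Phi_lowest_scale (x : U0 V) (y : Phi M) :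
  Phi_lowest (u0val x *: y) = zcls x *: Phi_lowest y.
Proof.
elim/Phi_ind: y => [|d u m du|y z IHy IHz].
- by rewrite scaler0 Phi_lowest0 scaler0.
- rewrite tens_scale !Phi_lowest_tens scalerA.
  apply: (congr1 (fun a : zhu V => a *: m)).
  have x0 := asboolP _ (u0valP x).
  have [d0|d0] := eqVneq d 0%N; last first.
    rewrite (deg0_neq du) // (deg0_neq (ugr_mul x0 du)) ?add0r //.
    exact/esym/(mulr0 (zcls x)).
  rewrite d0 in du; have uP : u \in @U0_pred K V by apply/asboolP.
  rewrite (@deg0_id u (MkU0 uP)) // (@deg0_id _ (x * MkU0 uP)) //.
  exact: clsM.
- by rewrite scalerDr !Phi_lowestD scalerDr IHy IHz.
Qed.

(* The action on an induced module is continuous, since the quotient defining it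
   is by the closed left ideal. *)
Lemma Phi_smooth (w : Phi M) :
  exists N, forall k u, ugr k u -> unbhd N u -> u *: w = 0.
Proof.
elim/Phi_ind: w => [|d v m dv|x y [N HN] [N' HN']].
- by exists 0%N => k u _ _; rewrite scaler0.
- exists (1 + `|d%:Z|)%N => k u ku uN; rewrite tens_scale.
  apply: (@tens_negid (k + d)); apply: (@unbhd_negid _ _ _ 1) => //.
    exact: ugr_mul.
  exact: unbhd_mulr uN dv.
- exists (maxn N N') => k u ku uN.
  rewrite scalerDr (HN k) // ?(HN' k) ?addr0 //; apply: unbhd_le uN.
    exact: leq_maxr.
  exact: leq_maxl.
Qed.

(** Elements close to 0 kill w, so an element of the completion acts on w like every late enough
    term of a Cauchy sequence representing it. Limits in [envU] thus become finite identities on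
    vectors. *)
Lemma Phi_approx k (x : cseq V) (w : Phi M) : cauchy k (cval x) ->
  exists n0, forall n, (n0 <= n)%N -> cls (@voa_ideal K V) x *: w = lie_env (x n) *: w.
Proof.
move=> kx; have [N HN] := Phi_smooth w; have [n0 H] := cls_approx N kx.
exists n0 => n n0n; apply/eqP; rewrite -subr_eq0 -scalerBl; apply/eqP.
apply: (HN k); last exact: H.
apply: ugr_add; first by exists x.
exact/ugr_opp/ugr_lie_env/(kx.1 n).
Qed.

(** Stability is required under modes only. It extends to the completed algebra because each
    homogeneous element acts on w like some element of [lieU]. *)
Lemma graded_submodule_scale (S : set (Phi M)) u (w : Phi M) :
  graded_submodule S -> S w -> S (u *: w).
Proof.
move=> [SS Smode _] Sw.
have lieS k x : lgr k x -> forall w, S w -> S (lie_env x *: w).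
  elim=> {k x w Sw} [k||h a n _|k l x y _ IHx _ IHy|k c x y _ IHx _ IHy] w Sw.
  - by rewrite -(scal0 L) lie_env_scal scal0 scale0r; case: SS.
  - by rewrite -(scal1 (K := K) (s := L)) lie_env_scal scal1 scale1r.
  - by rewrite lie_env_mode; apply: Smode.
  - by rewrite lie_envM -scalerA; apply/IHx/IHy.
  - rewrite lie_envD lie_envM lie_env_scal scalerDl -scalerA.
    exact: (subspaceD SS (subspaceZ c SS (IHx w Sw)) (IHy w Sw)).
elim/ugr_ind: u => [k u [x [kx ->]]|u v Su Sv]; last first.
  by rewrite scalerDl; exact: (subspaceD SS Su Sv).
have [n0 H] := Phi_approx w kx; rewrite (H n0) //.
exact: lieS (kx.1 n0) _ Sw.
Qed.

Lemma umode_lin k (a b : V) n : umode (k *: a + b) n = scal k * umode a n + umode b n :> U.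
Proof. rewrite -!lie_env_mode lmode_lin; exact (lie_env_lin k _ _). Qed.

Lemma umode0 n : umode (0 : V) n = 0 :> U.
Proof. by rewrite -lie_env_mode lmode0 -(scal0 L) lie_env_scal scal0. Qed.

Lemma umodeD (a b : V) n : umode (a + b) n = umode a n + umode b n :> U.
Proof. by rewrite -[a in LHS]scale1r umode_lin scal1 mul1r. Qed.

Lemma unbhd_umode N h (a : V) n : vgr h a -> h%:Z - n - 1 <= - N%:Z -> unbhd N (umode a n).
Proof.
move=> ha hn; rewrite -lie_env_mode -[lmode a n]mul1r; apply: unbhd_lie_env.
exact: lneg_gen hn (lgr_mode n ha).
Qed.

Lemma Phi_truncation : truncation (@wmode K V (Phi M)).
Proof.
move=> a w; have [N HN] := Phi_smooth w.
elim/vgr_ind: a => [|h a ha|a b [n0 H] [n1 H']].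
- by exists 0%N => n _; rewrite /wmode umode0 scale0r.
- exists (h + N)%N => n hn; apply: HN (ugr_umode _ ha) _.
  by apply: unbhd_umode ha _; lia.
- exists (maxn n0 n1) => n; rewrite geq_max => /andP[n0n n1n].
  have := H n n0n; have := H' n n1n; rewrite /wmode umodeD scalerDl => -> ->.
  exact: addr0.
Qed.

Lemma umode_derivative (a : V) n : umode (Lop (-1) a) n = scal (- n%:~R) * umode a (n - 1) :> U.
Proof.
rewrite -!lie_env_mode lmode_derivative opp_scal_mul.
exact: lie_envZ.
Qed.

Lemma umode_vac n : umode (vac V) n = if n == -1 then 1 else 0 :> U.
Proof.
case: eqP => [->|n1].
  pose x : cseq V := CSeq (lmode_csum (vac V) (-1)).
  have : cls (@voa_ideal K V) x = cls (@voa_ideal K V) 1; last exact.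
  apply/clsP; apply: ideal_sub => N; exists (x - 1); split.
    by apply: ideal_sub; left.
  by rewrite subrr; exists 0%N => *; apply: lneg_0.
(* As L_{-1} vac = 0, the derivative relation at n + 1 reads 0 = - (n + 1) vac_[n], and n + 1 is
   nonzero. *)
have := umode_derivative (vac V) (n + 1).
rewrite (_ : Lop (-1) (vac V) = 0); last exact: (vop_creation0 (conf V) 0).
rewrite umode0 addrK => /esym; apply: scal_mul_eq0.
by rewrite oppr_eq0 intr_eq0 addr_eq0; apply/eqP.
Qed.

Lemma Phi_vac n (w : restr (Phi M)) :
  wmode (W := Phi M) (vac V) n w = if n == -1 then w else 0.
Proof. by rewrite /wmode umode_vac; case: eqP; rewrite ?scale1r ?scale0r. Qed.

End Induced.

(** * Borcherds' identity *)

Section Binomials.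
Variable K : numFieldType.
Implicit Types (m : int) (i : nat).

Lemma binz_0r m : binz K m 0 = 1.
Proof. by rewrite /binz big_ord0 fact0 divr1. Qed.

Lemma binzSr m i : i.+1%:R * binz K m i.+1 = (m - i%:Z)%:~R * binz K m i.
Proof.
have i1 : i.+1%:R != 0 :> K by rewrite pnatr_eq0.
have f0 : i`!%:R != 0 :> K by rewrite pnatr_eq0 -lt0n fact_gt0.
rewrite /binz big_ord_recr /= factS natrM.
move: (i.+1%:R) (i`!%:R) i1 f0 => c d c0 d0.
by field; rewrite d0 c0.
Qed.

Lemma binzSS m i : i.+1%:R * binz K m i.+1 = m%:~R * binz K (m - 1) i.
Proof.
rewrite binzSr /binz !mulrA; congr (_ / _).
transitivity (\prod_(j < i.+1) (m - j%:Z)%:~R : K); first by rewrite big_ord_recr mulrC.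
rewrite big_ord_recl subr0; congr (_ * _); apply: eq_bigr => j _; congr _%:~R.
by rewrite lift0; lia.
Qed.

Lemma binzB m i : (m - i%:Z)%:~R * binz K m i = m%:~R * binz K (m - 1) i.
Proof. by rewrite -binzSr binzSS. Qed.

Lemma binz_pascal m i : binz K (m + 1) i.+1 = binz K m i.+1 + binz K m i.
Proof.
have i1 : i.+1%:R != 0 :> K by rewrite pnatr_eq0.
apply: (mulfI i1); rewrite mulrDr !binzSr -mulrDl binzB addrK.
congr (_ * _); rewrite -[i.+1%:R]/(i.+1%:Z%:~R) -intrD; congr _%:~R.
by lia.
Qed.

Lemma binz0S i : binz K 0 i.+1 = 0.
Proof. by rewrite /binz big_ord_recl subr0 !mul0r. Qed.

Lemma binzN1 i : binz K (-1) i = (-1) ^+ i.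
Proof.
elim: i => [|i IHi]; first by rewrite binz_0r.
have i1 : i.+1%:R != 0 :> K by rewrite pnatr_eq0.
apply: (mulfI i1); rewrite binzSr IHi exprS mulrA; congr (_ * _).
rewrite mulrN1 -[i.+1%:R]/(i.+1%:Z%:~R) -mulrNz; congr _%:~R.
by lia.
Qed.

End Binomials.

Section FiniteSums.
Variables (K : numFieldType) (X : lmodType K).
Implicit Types f g : nat -> X.

Definition ev0 f := exists N, forall i, (N <= i)%N -> f i = 0.

(** The sum of an eventually zero sequence without reference to a cutoff; the three sums of
    Borcherds' identity have different cutoffs. *)
Definition fsum f : X :=
  xget 0 [set x | exists2 N, forall i, (N <= i)%N -> f i = 0 & x = \sum_(i < N) f i].

Let widen f M N : (M <= N)%N -> (forall i, (M <= i)%N -> f i = 0) ->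
  \sum_(i < N) f i = \sum_(i < M) f i.
Proof.
move=> MN fM; rewrite [RHS](big_ord_widen N f MN) [RHS]big_mkcond /=.
by apply: eq_bigr => i _; case: ltnP => // /fM.
Qed.

Lemma fsumE f N : (forall i, (N <= i)%N -> f i = 0) -> fsum f = \sum_(i < N) f i.
Proof.
move=> fN; rewrite /fsum; case: xgetP => [x _ [M fM ->]|/(_ (\sum_(i < N) f i))[]];
  last by exists N.
by rewrite -(widen (leq_maxl M N) fM) -(widen (leq_maxr M N) fN).
Qed.

Lemma ev0Z (c : nat -> K) f : ev0 f -> ev0 (fun i => c i *: f i).
Proof. by move=> [N fN]; exists N => i /fN->; rewrite scaler0. Qed.

Lemma ev0S f : ev0 f -> ev0 (fun i => f i.+1).
Proof. by move=> [N fN]; exists N => i Ni; apply/fN/leqW. Qed.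

Lemma fsum_lin k f g : ev0 f -> ev0 g ->
  fsum (fun i => k *: f i + g i) = k *: fsum f + fsum g.
Proof.
move=> [M fM] [N gN].
have fMN i : (maxn M N <= i)%N -> f i = 0 by rewrite geq_max => /andP[/fM].
have gMN i : (maxn M N <= i)%N -> g i = 0 by rewrite geq_max => /andP[_ /gN].
rewrite (fsumE fMN) (fsumE gMN) (@fsumE _ (maxn M N)) => [|i Hi].
  by rewrite scaler_sumr -big_split.
by rewrite fMN // gMN // scaler0 addr0.
Qed.

Lemma fsumD f g : ev0 f -> ev0 g -> fsum (fun i => f i + g i) = fsum f + fsum g.
Proof.
move=> f0 g0; rewrite -[fsum f]scale1r -fsum_lin //; congr fsum.
by apply/funext => i; rewrite scale1r.
Qed.

Lemma fsum0 : fsum (fun=> 0) = 0.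
Proof. by rewrite (@fsumE _ 0) ?big_ord0. Qed.

Lemma fsumZ k f : ev0 f -> fsum (fun i => k *: f i) = k *: fsum f.
Proof.
move=> f0; have z0 : ev0 (fun=> 0) by exists 0%N.
have := fsum_lin k f0 z0; rewrite fsum0 addr0 => <-; congr fsum.
by apply/funext => i; rewrite addr0.
Qed.

Lemma fsum_recl f : ev0 f -> fsum f = f 0 + fsum (fun i => f i.+1).
Proof.
move=> [N fN]; rewrite (@fsumE f N.+1); last by move=> i Ni; apply/fN/ltnW.
by rewrite (@fsumE _ N) ?big_ord_recl // => i Ni; apply/fN/leqW.
Qed.

Lemma fsum_single f : (forall i, f i.+1 = 0) -> fsum f = f 0%N.
Proof. by move=> f0; rewrite (@fsumE f 1) ?big_ord1 // => -[]. Qed.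

Lemma eq_fsum f g : f =1 g -> fsum f = fsum g.
Proof. by move/funext->. Qed.

Lemma fsum_pascal m f : ev0 f -> fsum (fun i => binz K (m + 1) i *: f i) =
  fsum (fun i => binz K m i *: f i) + fsum (fun i => binz K m i *: f i.+1).
Proof.
move=> f0; have fS := ev0S f0.
rewrite fsum_recl; last exact: (ev0Z (binz K (m + 1))).
rewrite [in RHS]fsum_recl; last exact: (ev0Z (binz K m)).
rewrite !binz_0r -addrA; congr (_ + _).
rewrite -fsumD; last 2 first.
- exact: (ev0Z (fun i => binz K m i.+1)).
- exact: (ev0Z (binz K m)).
by apply: eq_fsum => i; rewrite binz_pascal scalerDl.
Qed.

Lemma fsum_absorb m f : ev0 f -> fsum (fun i => (i%:R * binz K m i) *: f i) =
  m%:~R *: fsum (fun i => binz K (m - 1) i *: f i.+1).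
Proof.
move=> f0; have fS := ev0S f0.
rewrite fsum_recl; last exact: (ev0Z (fun i => i%:R * binz K m i)).
rewrite mul0r scale0r add0r -fsumZ; last exact: (ev0Z (binz K (m - 1))).
by apply: eq_fsum => i; rewrite binzSS scalerA.
Qed.

End FiniteSums.

Section Borcherds.
Variables (K : numClosedFieldType) (V : voa K) (X : lmodType K).
Variable Y : V -> int -> X -> X.
Hypotheses
  (Yl : forall k a b n w, Y (k *: a + b) n w = k *: Y a n w + Y b n w)
  (Yr : forall a n k w x, Y a n (k *: w + x) = k *: Y a n w + Y a n x)
  (Ytrunc : truncation Y)
  (Yder : forall a n w, Y (Lop (-1) a) n w = - n%:~R *: Y a (n - 1) w)
  (Ycomm : forall a b m n w N, (forall j : nat, (N <= j)%N -> vop a j%:Z b = 0) ->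
     Y a m (Y b n w) - Y b n (Y a m w) =
     \sum_(j < N) binz K m j *: Y (vop a j%:Z b) (m + n - j%:Z) w)
  (Ynop : forall p q a b n w, vgr p a -> vgr q b -> exists N0, forall N, (N0 <= N)%N ->
     Y (vop a (-1) b) n w = \sum_(j < N) (Y a (- 1 - j%:Z) (Y b (n + j%:Z) w) +
                                          Y b (n - j%:Z - 1) (Y a j%:Z w))).
Implicit Types (a b : V) (l m n : int) (w : X).

Let Y0l n w : Y 0 n w = 0.
Proof. by have := Yl (-1) 0 0 n w; rewrite scaler0 addr0 scaleN1r addNr. Qed.

Let Y0r a n : Y a n 0 = 0.
Proof. by have := Yr a n (-1) 0 0; rewrite scaler0 addr0 scaleN1r addNr. Qed.

Let YZl k a n w : Y (k *: a) n w = k *: Y a n w.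
Proof. by rewrite -[k *: a]addr0 Yl Y0l addr0. Qed.

Let YZr k a n w : Y a n (k *: w) = k *: Y a n w.
Proof. by rewrite -[k *: w]addr0 Yr Y0r addr0. Qed.

Let YDl a b n w : Y (a + b) n w = Y a n w + Y b n w.
Proof. by rewrite -[a in LHS]scale1r Yl scale1r. Qed.

Let YDr a n w x : Y a n (w + x) = Y a n w + Y a n x.
Proof. by rewrite -[w in LHS]scale1r Yr scale1r. Qed.

(* With T(l,m,n) any of the three sums of the identity,
   T(l,m+1,n) = T(l+1,m,n) + T(l,m,n+1), and replacing a by L_{-1} a turns
   T(l,m,n) into - l T(l-1,m,n) - m T(l,m-1,n).  So the identity follows from its
   cases l = 0 (the commutator formula) and l = -1, m = 0 (the normally ordered
   product).  The third sum is (-1)^l times [product b a l n m]. *)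
Definition iterate a b l m n w : X :=
  fsum (fun i : nat => binz K m i *: Y (vop a (l + i%:Z) b) (m + n - i%:Z) w).
Definition product a b l m n w : X :=
  fsum (fun i : nat => ((-1) ^+ i * binz K l i) *: Y a (l + m - i%:Z) (Y b (n + i%:Z) w)).
Definition defect a b l m n w : X :=
  iterate a b l m n w - (product a b l m n w - (-1) ^ l *: product b a l n m w).

Let iterate_ev0 a b l (g : nat -> int) w : ev0 (fun i : nat => Y (vop a (l + i%:Z) b) (g i) w).
Proof.
have [N HN] := vop_truncation a b; exists (N + `|l|)%N => i Ni.
have -> : l + i%:Z = (absz (l + i%:Z))%:Z by lia.
by rewrite HN ?Y0l //; lia.
Qed.

Let product_ev0 a b n (g : nat -> int) w : ev0 (fun i : nat => Y a (g i) (Y b (n + i%:Z) w)).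
Proof.
have [N HN] := Ytrunc b w; exists (N + `|n|)%N => i Ni.
have -> : n + i%:Z = (absz (n + i%:Z))%:Z by lia.
by rewrite HN ?Y0r //; lia.
Qed.

Lemma iterate_rec a b l m n w :
  iterate a b l (m + 1) n w = iterate a b (l + 1) m n w + iterate a b l m (n + 1) w.
Proof.
apply: etrans (fsum_pascal m (iterate_ev0 a b l (fun i : nat => m + 1 + n - i%:Z) w)) _.
rewrite addrC; congr (_ + _); apply: eq_fsum => i; congr (_ *: _).
  by congr (Y (vop _ _ _) _ _); lia.
by congr (Y _ _ _); lia.
Qed.

Lemma product_rec a b l m n w :
  product a b l (m + 1) n w = product a b (l + 1) m n w + product a b l m (n + 1) w.
Proof.
rewrite /product.
pose f (i : nat) := (-1) ^+ i *: Y a (l + m + 1 - i%:Z) (Y b (n + i%:Z) w).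
have f0 : ev0 f.
  exact: (ev0Z (fun i => (-1) ^+ i) (product_ev0 a b n (fun i : nat => l + m + 1 - i%:Z) w)).
have E1 : fsum (fun i : nat =>
      ((-1) ^+ i * binz K (l + 1) i) *: Y a (l + 1 + m - i%:Z) (Y b (n + i%:Z) w))
    = fsum (fun i => binz K (l + 1) i *: f i).
  apply: eq_fsum => i; rewrite /f scalerA mulrC.
  by congr (_ *: Y _ _ _); lia.
rewrite E1 (fsum_pascal l f0) -addrA -[LHS]addr0; congr (_ + _).
  apply: eq_fsum => i; rewrite /f scalerA mulrC.
  by congr (_ *: Y _ _ _); lia.
rewrite -fsumD; last 2 first.
- exact: (ev0Z (binz K l) (ev0S f0)).
- exact: (ev0Z (fun i => (-1) ^+ i * binz K l i)
    (product_ev0 a b (n + 1) (fun i : nat => l + m - i%:Z) w)).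
rewrite -[LHS](fsum0 X); apply: eq_fsum => i; rewrite /f scalerA exprS mulN1r mulrN scaleNr.
rewrite (_ : l + m + 1 - i.+1%:Z = l + m - i%:Z); last by lia.
rewrite (_ : n + i.+1%:Z = n + 1 + i%:Z); last by lia.
by rewrite [binz K l i * _]mulrC addNr.
Qed.

Lemma defect_rec a b l m n w :
  defect a b l (m + 1) n w = defect a b (l + 1) m n w + defect a b l m (n + 1) w.
Proof.
rewrite /defect iterate_rec product_rec (product_rec b a l n m).
rewrite expfzDr ?oppr_eq0 ?oner_eq0 // expr1z mulrN1 !scaleNr scalerDr !opprK.
rewrite addrACA -opprD; congr (_ - _); rewrite [RHS]addrACA; congr (_ + _).
by rewrite opprD addrA subrr add0r.
Qed.

Lemma iterate_derivative a b l m n w : iterate (Lop (-1) a) b l m n w =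
  - l%:~R *: iterate a b (l - 1) m n w - m%:~R *: iterate a b l (m - 1) n w.
Proof.
pose f (i : nat) := Y (vop a (l - 1 + i%:Z) b) (m + n - i%:Z) w.
have f0 : ev0 f := iterate_ev0 a b (l - 1) (fun i : nat => m + n - i%:Z) w.
have E : fsum (fun i : nat => (i%:R * binz K m i) *: f i) = m%:~R *: iterate a b l (m - 1) n w.
  rewrite (fsum_absorb m f0); congr (_ *: _); apply: eq_fsum => i; congr (_ *: _).
  by congr (Y (vop _ _ _) _ _); lia.
rewrite -E addrC -scaleN1r -fsumZ; last exact: (ev0Z (fun i => i%:R * binz K m i)).
rewrite -fsumZ; last exact: (ev0Z (binz K m)).
rewrite -fsumD; last 2 first.
- exact: (ev0Z (fun=> -1) (ev0Z (fun i => i%:R * binz K m i) f0)).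
- exact: (ev0Z (fun=> - l%:~R) (ev0Z (binz K m) f0)).
apply: eq_fsum => i; rewrite vop_derivative YZl.
rewrite (_ : l + i%:Z - 1 = l - 1 + i%:Z); last by lia.
rewrite -/(f i) !scalerA -scalerDl; congr (_ *: _).
by rewrite intrD -[i%:Z%:~R]/(i%:R); ring.
Qed.

Lemma product_derivativel a b l m n w : product (Lop (-1) a) b l m n w =
  - l%:~R *: product a b (l - 1) m n w - m%:~R *: product a b l (m - 1) n w.
Proof.
pose f (i : nat) := Y a (l + m - i%:Z - 1) (Y b (n + i%:Z) w).
have f0 : ev0 f := product_ev0 a b n (fun i : nat => l + m - i%:Z - 1) w.
have E1 : product a b (l - 1) m n w = fsum (fun i : nat => ((-1) ^+ i * binz K (l - 1) i) *: f i).
  by apply: eq_fsum => i; congr (_ *: Y _ _ _); lia.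
have E2 : product a b l (m - 1) n w = fsum (fun i : nat => ((-1) ^+ i * binz K l i) *: f i).
  by apply: eq_fsum => i; congr (_ *: Y _ _ _); lia.
rewrite E1 E2 -scaleNr -!fsumZ; try by apply: ev0Z.
rewrite -fsumD; try by apply: ev0Z; apply: ev0Z.
apply: eq_fsum => i; rewrite Yder -/(f i) !scalerA -scalerDl; congr (_ *: _).
have := binzB K l i; rewrite intrB -[i%:Z%:~R]/(i%:R) => H.
rewrite !intrB intrD -[i%:Z%:~R]/(i%:R) mulNr [X in - X + _]mulrCA -H.
by ring.
Qed.

Lemma product_derivativer a b l m n w : product b (Lop (-1) a) l n m w =
  l%:~R *: product b a (l - 1) n m w - m%:~R *: product b a l n (m - 1) w.
Proof.
pose f (i : nat) := Y b (l + n - i%:Z) (Y a (m - 1 + i%:Z) w).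
have f0 : ev0 f := product_ev0 b a (m - 1) (fun i : nat => l + n - i%:Z) w.
pose g (i : nat) := (-1) ^+ i *: f i.
have g0 : ev0 g by apply: ev0Z.
have E1 : fsum (fun i : nat => (i%:R * binz K l i) *: g i) = - (l%:~R *: product b a (l - 1) n m w).
  rewrite (fsum_absorb l g0) -scalerN; congr (_ *: _).
  rewrite -scaleN1r -fsumZ; last first.
    exact: (ev0Z (fun i => (-1) ^+ i * binz K (l - 1) i) (product_ev0 b a m _ w)).
  apply: eq_fsum => i; rewrite /g /f !scalerA exprS.
  congr (_ *: Y _ _ (Y _ _ _)); [by ring|by lia|by lia].
have E2 : product b a l n (m - 1) w = fsum (fun i : nat => binz K l i *: g i).
  by apply: eq_fsum => i; rewrite /g scalerA mulrC.
rewrite E2 -[l%:~R *: _]opprK -E1 -scaleNr -scaleN1r -!fsumZ; try by apply: ev0Z.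
rewrite -fsumD; try by apply: ev0Z; apply: ev0Z.
apply: eq_fsum => i; rewrite Yder YZr /g.
rewrite (_ : m + i%:Z - 1 = m - 1 + i%:Z); last by lia.
rewrite -/(f i) !scalerA -scalerDl; congr (_ *: _).
by rewrite intrD -[i%:Z%:~R]/(i%:R); ring.
Qed.

Lemma defect_derivative a b l m n w : defect (Lop (-1) a) b l m n w =
  - l%:~R *: defect a b (l - 1) m n w - m%:~R *: defect a b l (m - 1) n w.
Proof.
rewrite /defect iterate_derivative product_derivativel product_derivativer.
rewrite (_ : (-1) ^ l = - (-1) ^ (l - 1) :> K); last first.
  by rewrite expfzDr ?oppr_eq0 ?oner_eq0 // exprN1 invrN1 mulrN1 opprK.
have subACA (A B C D : X) : A - B - (C - D) = A - C - (B - D).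
  by rewrite !opprB [LHS]addrACA [RHS]addrACA [X in _ = _ + X]addrC.
rewrite !scalerBr !scalerA [RHS]subACA [X in _ = _ - X]subACA.
by congr (_ - (_ - (_ *: _ - _ *: _))); ring.
Qed.

Lemma defect_addl a a' b l m n w : defect (a + a') b l m n w =
  defect a b l m n w + defect a' b l m n w.
Proof.
have HI : iterate (a + a') b l m n w = iterate a b l m n w + iterate a' b l m n w.
  rewrite -fsumD; try by apply: ev0Z; apply: iterate_ev0.
  apply: eq_fsum => i; rewrite -scalerDr -YDl; congr (_ *: Y _ _ _).
  by have := vop_linearl (l + i%:Z) b 1 a a'; rewrite !scale1r.
have HP : product (a + a') b l m n w = product a b l m n w + product a' b l m n w.
  rewrite -fsumD; try by apply: ev0Z; apply: product_ev0.
  by apply: eq_fsum => i; rewrite -scalerDr -YDl.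
have HQ : product b (a + a') l n m w = product b a l n m w + product b a' l n m w.
  rewrite -fsumD; try by apply: ev0Z; apply: product_ev0.
  by apply: eq_fsum => i; rewrite -scalerDr YDl YDr.
rewrite /defect HI HP HQ scalerDr [RHS]addrACA -[X in _ = _ + X]opprD.
by rewrite [X in _ = _ - X]addrACA -[X in _ = _ - (_ + X)]opprD.
Qed.

Lemma defect_addr a b b' l m n w : defect a (b + b') l m n w =
  defect a b l m n w + defect a b' l m n w.
Proof.
have HI : iterate a (b + b') l m n w = iterate a b l m n w + iterate a b' l m n w.
  rewrite -fsumD; try by apply: ev0Z; apply: iterate_ev0.
  apply: eq_fsum => i; rewrite -scalerDr -YDl; congr (_ *: Y _ _ _).
  by have := vop_linearr (l + i%:Z) a 1 b b'; rewrite !scale1r.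
have HP : product a (b + b') l m n w = product a b l m n w + product a b' l m n w.
  rewrite -fsumD; try by apply: ev0Z; apply: product_ev0.
  by apply: eq_fsum => i; rewrite -scalerDr YDl YDr.
have HQ : product (b + b') a l n m w = product b a l n m w + product b' a l n m w.
  rewrite -fsumD; try by apply: ev0Z; apply: product_ev0.
  by apply: eq_fsum => i; rewrite -scalerDr YDl.
rewrite /defect HI HP HQ scalerDr [RHS]addrACA -[X in _ = _ + X]opprD.
by rewrite [X in _ = _ - X]addrACA -[X in _ = _ - (_ + X)]opprD.
Qed.

Lemma defect_0 a b m n w : defect a b 0 m n w = 0.
Proof.
have [N HN] := vop_truncation a b.
have HI : iterate a b 0 m n w =
    \sum_(j < N) binz K m j *: Y (vop a j%:Z b) (m + n - j%:Z) w.
  rewrite /iterate (@fsumE _ _ _ N) => [|i Ni]; last by rewrite add0r HN // Y0l scaler0.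
  by apply: eq_bigr => i _; rewrite add0r.
have HP c d p q : product c d 0 p q w = Y c p (Y d q w).
  rewrite /product fsum_single => [|i]; last by rewrite binz0S mulr0 scale0r.
  by rewrite binz_0r mulr1 scale1r add0r subr0 addr0.
by rewrite /defect HI !HP expr0z scale1r (Ycomm _ _ _ HN) subrr.
Qed.

(** As binom(-1, i) = (-1)^i, all signs cancel and the sums are those of the normally ordered
    product. That relation is given for homogeneous a and b, whence the reduction by additivity. *)
Lemma defect_N1 a b n w : defect a b (-1) 0 n w = 0.
Proof.
elim/(@vgr_ind K V): a => [|p a pa|a a' Ha Ha']; last by rewrite defect_addl Ha Ha' addr0.
  have := defect_addl 0 0 b (-1) 0 n w; rewrite addr0 => /eqP.
  by rewrite -subr_eq0 opprD addrA subrr sub0r oppr_eq0 => /eqP.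
elim/(@vgr_ind K V): b => [|q b qb|b b' Hb Hb']; last by rewrite defect_addr Hb Hb' addr0.
  have := defect_addr a 0 0 (-1) 0 n w; rewrite addr0 => /eqP.
  by rewrite -subr_eq0 opprD addrA subrr sub0r oppr_eq0 => /eqP.
have sgn i : (-1) ^+ i * binz K (-1) i = 1 :> K by rewrite binzN1 -exprMn mulrNN mulr1 expr1n.
have [N0 HN0] := Ynop n w pa qb.
pose f (i : nat) := Y a (-1 - i%:Z) (Y b (n + i%:Z) w).
pose g (i : nat) := Y b (n - i%:Z - 1) (Y a i%:Z w).
have f0 : ev0 f := product_ev0 a b n (fun i : nat => -1 - i%:Z) w.
have g0 : ev0 g.
  have [N HN] := Ytrunc a w; exists N => i Ni.
  by rewrite /g HN // Y0r.
have Hf : product a b (-1) 0 n w = fsum f.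
  by apply: eq_fsum => i; rewrite sgn scale1r addr0.
have Hg : product b a (-1) n 0 w = fsum g.
  apply: eq_fsum => i; rewrite sgn scale1r add0r /g.
  by congr (Y _ _ _); lia.
have HI : iterate a b (-1) 0 n w = Y (vop a (-1) b) n w.
  rewrite /iterate fsum_single => [|i]; last by rewrite binz0S scale0r.
  by rewrite binz_0r scale1r add0r subr0 addr0.
rewrite /defect Hf Hg HI exprN1 invrN1 scaleN1r opprK -fsumD //.
have [N HN] := f0; have [N' HN'] := g0.
rewrite (@fsumE _ _ _ (maxn N0 (maxn N N'))) => [|i].
  by rewrite (HN0 (maxn N0 (maxn N N'))) ?leq_maxl // subrr.
by rewrite !geq_max => /and3P[_ Ni N'i]; rewrite HN // HN' // addr0.
Qed.

(** For l >= 0 the recursion climbs from l = 0. At l = -1 its term at l + 1 = 0 vanishes, so that m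
    can be moved to 0 at the expense of n. Below, the derivative formula at l leaves - l times the
    defect at l - 1, and l is nonzero. *)
Lemma defect_eq0 a b l m n w : defect a b l m n w = 0.
Proof.
have pos (k : nat) a' b' m' n' : defect a' b' k%:Z m' n' w = 0.
  elim: k m' n' => [|k IHk] m' n'; first exact: defect_0.
  have := defect_rec a' b' k m' n' w; rewrite !IHk addr0 => /esym E.
  by rewrite -addn1 PoszD.
have step a' b' m' n' : defect a' b' (-1) (m' + 1) n' w = defect a' b' (-1) m' (n' + 1) w.
  by rewrite defect_rec addNr defect_0 add0r.
have N1 a' b' m' n' : defect a' b' (-1) m' n' w = 0.
  elim: m' n' => [|k IHk|k IHk] n'.
  - exact: defect_N1.
  - by rewrite -addn1 PoszD step.
  - have := step a' b' (- k.+1%:Z) (n' - 1).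
    by rewrite subrK (_ : - k.+1%:Z + 1 = - k%:Z) ?IHk //; lia.
case: l => [k|k]; first exact: pos.
elim: k a b m n => [|k IHk] a b m n; first exact: N1.
have := defect_derivative a b (Negz k) m n w; rewrite !IHk scaler0 subr0 => /esym/eqP.
rewrite scaler_eq0 oppr_eq0 intr_eq0 /= => /eqP.
by rewrite (_ : Negz k - 1 = Negz k.+1) //; lia.
Qed.

Lemma borcherds_identity : borcherds (@vop K V) Y.
Proof.
move=> a b w l m n.
have [N1 H1] := iterate_ev0 a b l (fun i : nat => m + n - i%:Z) w.
have [N2 H2] := product_ev0 a b n (fun i : nat => l + m - i%:Z) w.
have [N3 H3] := product_ev0 b a m (fun i : nat => l + n - i%:Z) w.
exists (maxn N1 (maxn N2 N3)) => N; rewrite !geq_max => /and3P[N1N N2N N3N].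
have := defect_eq0 a b l m n w.
rewrite /defect /iterate /product !(@fsumE _ _ _ N); first last.
- by move=> i Ni; rewrite H1 ?scaler0 // (leq_trans N1N).
- by move=> i Ni; rewrite H2 ?scaler0 // (leq_trans N2N).
- by move=> i Ni; rewrite H3 ?scaler0 // (leq_trans N3N).
move/eqP; rewrite subr_eq0 => /eqP->.
rewrite scaler_sumr -sumrB; apply: eq_bigr => i _.
by rewrite scalerBr !scalerA [(-1) ^ l * _]mulrC.
Qed.

End Borcherds.

Lemma sum_tail (Z : zmodType) (P : Z -> Prop) (d : nat -> Z) J :
  P 0 -> (forall x y, P x -> P y -> P (x + y)) -> (forall x, P x -> P (- x)) ->
  (forall j, (J <= j)%N -> P (d j)) -> forall m n, (J <= m)%N -> (J <= n)%N ->
  P (\sum_(j < m) d j - \sum_(j < n) d j).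
Proof.
move=> P0 PD PN Pd.
have tail m : (J <= m)%N -> P (\sum_(j < m) d j - \sum_(j < J) d j).
  elim: m => [|m IHm]; first by rewrite leqn0 => /eqP->; rewrite subrr.
  rewrite leq_eqVlt => /orP[/eqP->|Jm]; first by rewrite subrr.
  by rewrite big_ord_recr /= addrAC; apply: (PD) (IHm Jm) (Pd m Jm).
move=> m n Jm Jn.
have := PD _ _ (tail m Jm) (PN _ (tail n Jn)).
by rewrite opprB addrA subrK.
Qed.

Lemma scale_mulD (A : pzRingType) (W : lmodType A) (x y z t : A) (w : W) :
  (x * y + z * t) *: w = x *: (y *: w) + z *: (t *: w).
Proof. by rewrite scalerDl -!scalerA. Qed.

(** * Induced modules are admissible *)

Section PhiModule.
Variables (K : numClosedFieldType) (V : voa K) (M : lmodType (zhu V)).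
Local Notation U := (envU V).
Local Notation L := (lieU V).
Local Notation Y := (@wmode K V (Phi M)).

Lemma lie_envB (x y : L) : lie_env (x - y) = lie_env x - lie_env y.
Proof.
apply: etrans (clsB _ _ _); apply: (congr1 (cls _)).
exact/val_inj.
Qed.

Lemma lie_env_sum n (f : nat -> L) :
  lie_env (\sum_(j < n) f j) = \sum_(j < n) lie_env (f j).
Proof.
elim: n => [|n IHn].
  rewrite !big_ord0 -(scal0 L) lie_env_scal; exact: scal0.
rewrite !big_ord_recr /= -IHn; exact: lie_envD.
Qed.

Lemma lie_env_comm (x y : L) :
  lie_env (x * y - y * x) = lie_env x * lie_env y - lie_env y * lie_env x.
Proof.
exact (etrans (lie_envB (x * y) (y * x))
  (congr2 (fun s t : U => s - t) (lie_envM x y) (lie_envM y x))).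
Qed.

Lemma lie_env_mulD (x y z t : L) :
  lie_env (x * y + z * t) = lie_env x * lie_env y + lie_env z * lie_env t.
Proof.
exact (etrans (lie_envD (x * y) (z * t))
  (congr2 (fun s t : U => s + t) (lie_envM x y) (lie_envM z t))).
Qed.

Lemma umode_comm (a b : V) m n N : (forall j : nat, (N <= j)%N -> vop a j%:Z b = 0) ->
  umode a m * umode b n - umode b n * umode a m =
  \sum_(j < N) scal (binz K m j) * umode (vop a j%:Z b) (m + n - j%:Z) :> U.
Proof.
move=> HN; rewrite -(lie_env_mode a m) -(lie_env_mode b n).
apply: etrans (esym (lie_env_comm (lmode a m) (lmode b n))) _.
apply: etrans (congr1 (@lie_env K V) (lmode_bracket m n HN)) _.
apply: etrans (lie_env_sum N (fun j : nat =>
  scal (binz K m j) * lmode (vop a j%:Z b) (m + n - j%:Z))) _.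
apply: eq_bigr => j _; apply: etrans (lie_envZ _ _) _.
exact (congr1 (fun u : U => scal (binz K m j) * u) (lie_env_mode _ _)).
Qed.

Lemma wmode_linl k (a b : V) n w : Y (k *: a + b) n w = k *: Y a n w + Y b n w.
Proof.
by rewrite /wmode umode_lin scalerDl -scalerA.
Qed.

Lemma wmode_linr (a : V) n k w x : Y a n (k *: w + x) = k *: Y a n w + Y a n x.
Proof.
rewrite /wmode -[RHS]/((scal k : U) *: (umode a n *: (w : Phi M)) + umode a n *: (x : Phi M)).
rewrite -[k *: w]/((scal k : U) *: (w : Phi M)) scalerDr !scalerA.
by rewrite scalC.
Qed.

Lemma wmode_derivative (a : V) n w : Y (Lop (-1) a) n w = - n%:~R *: Y a (n - 1) w.
Proof. by rewrite /wmode umode_derivative -scalerA. Qed.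

Lemma scale_suml (W : lmodType U) n (f : nat -> U) (w : W) :
  (\sum_(j < n) f j) *: w = \sum_(j < n) (f j *: w).
Proof. exact: scaler_suml. Qed.

Lemma wmode_comm (a b : V) m n w N : (forall j : nat, (N <= j)%N -> vop a j%:Z b = 0) ->
  Y a m (Y b n w) - Y b n (Y a m w) =
  \sum_(j < N) binz K m j *: Y (vop a j%:Z b) (m + n - j%:Z) w.
Proof.
move=> HN; rewrite /wmode !scalerA.
have := congr1 (fun u => u *: (w : Phi M)) (umode_comm m n HN).
rewrite scalerBl (scale_suml N (fun j : nat =>
  scal (binz K m j) * umode (vop a j%:Z b) (m + n - j%:Z))) => E.
apply: etrans E _; apply: eq_bigr => j _.
exact/esym/scalerA.
Qed.

Section NormalOrder.
Variables (p q : nat) (a b : V) (n : int).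
Hypotheses (pa : vgr p a) (qb : vgr q b).

Let term (j : nat) : L := lmode a (- 1 - j%:Z) * lmode b (n + j%:Z) +
  lmode b (n - j%:Z - 1) * lmode a j%:Z.

Let partial (N : nat) : L := \sum_(j < N) term j.

Let lgr_term j : lgr (p%:Z + q%:Z - n - 1) (term j).
Proof.
apply: lgr_add.
  rewrite (_ : _ - 1 = (p%:Z - (- 1 - j%:Z) - 1) + (q%:Z - (n + j%:Z) - 1)); last by lia.
  by apply: lgr_mul; apply: lgr_mode.
rewrite (_ : _ - 1 = (q%:Z - (n - j%:Z - 1) - 1) + (p%:Z - j%:Z - 1)); last by lia.
by apply: lgr_mul; apply: lgr_mode.
Qed.

Let cauchy_partial : cauchy (p%:Z + q%:Z - n - 1) partial.
Proof.
split=> [N|N].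
  by rewrite /partial; elim/big_ind: _ => // [|x y]; [apply: lgr_0|apply: lgr_add].
(* Past this index the right factors b_[n+j] and a_[j], of degrees q - n - j - 1 and p - j - 1, both
   have degree at most - N. *)
exists (p + q + `|n| + N)%N; apply: sum_tail; first exact: lneg_0.
- exact: lneg_add.
- exact: lneg_opp.
move=> j Hj; apply: lneg_add.
  by apply: lneg_gen (lgr_mode _ qb); lia.
by apply: lneg_gen (lgr_mode _ pa); lia.
Qed.

(** The defining relation equates a mode with a limit of partial sums; on w it is attained by
    [Phi_approx]. *)
Lemma wmode_normal_order w : exists N0, forall N, (N0 <= N)%N ->
  Y (vop a (-1) b) n w = \sum_(j < N) (Y a (- 1 - j%:Z) (Y b (n + j%:Z) w) +
                                      Y b (n - j%:Z - 1) (Y a j%:Z w)).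
Proof.
have sP : partial \in @csum_pred K V by apply/asboolP/csum_cauchy/cauchy_partial.
pose s : cseq V := CSeq sP; pose x : cseq V := CSeq (lmode_csum (vop a (-1) b) n).
have xs : cls (@voa_ideal K V) x = cls (@voa_ideal K V) s.
  apply/clsP; apply: ideal_sub => N; exists (x - s); split.
    apply: ideal_sub; right; exists p, q, a, b, n; split=> //.
    apply/funext => k; apply: (congr1 (fun t => lmode (vop a (-1) b) n - t)).
    exact: big_split.
  by rewrite subrr; exists 0%N => *; apply: lneg_0.
have [N0 H] := Phi_approx (x := s) w cauchy_partial.
exists N0 => N NN; apply: etrans (congr1 (fun u => u *: (w : Phi M)) xs) _.
rewrite (H N NN) [cval s N]/(partial N) /partial lie_env_sum.
rewrite (scale_suml N (fun j => lie_env (term j))).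
apply: eq_bigr => j _; have E : lie_env (term j) =
    umode a (- 1 - j%:Z) * umode b (n + j%:Z) + umode b (n - j%:Z - 1) * umode a j%:Z.
  apply: etrans (lie_env_mulD _ _ _ _) _.
  exact (congr2 (fun s t : U => s + t)
    (congr2 (fun s t : U => s * t) (lie_env_mode a _) (lie_env_mode b _))
    (congr2 (fun s t : U => s * t) (lie_env_mode b _) (lie_env_mode a _))).
rewrite E; exact: scale_mulD.
Qed.

End NormalOrder.

Lemma Phi_weak_module : weak_module (Phi M).
Proof.
split; [exact: Phi_truncation|exact: Phi_vac|].
apply: borcherds_identity.
- exact: wmode_linl.
- exact: wmode_linr.
- exact: Phi_truncation.
- exact: wmode_derivative.
- exact: wmode_comm.
- by move=> p q a b n w pa qb; exact (wmode_normal_order n pa qb w).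
Qed.

Lemma Phi_admissible : admissible_module (Phi M).
Proof. split; [exact: Phi_weak_module|exact: Phi_direct_sum]. Qed.

End PhiModule.

(** * The contravariant pairing *)

Section ThetaZhu.
Variables (K : numClosedFieldType) (V : voa K) (th : theta_antiaut V).
Local Notation U := (envU V).

Lemma theta_zhu_involutive : involutive (theta_zhu th).
Proof.
elim/cls_ind=> x; apply: etrans (congr1 (theta_zhu th) (theta_zhuE th x)) _.
apply: etrans (theta_zhuE th _) _; apply: (congr1 (cls _)).
by apply/val_inj; exact (theta_involutive th (u0val x)).
Qed.

Lemma theta_uproj0 u : th (uproj 0 u) = uproj 0 (th u).
Proof.
elim/ugr_ind: u => [k u ku|u v IHu IHv]; last by rewrite thetaD !uprojD thetaD IHu IHv.
rewrite (uproj_homog 0 ku) (uproj_homog 0 (theta_ugr th ku)) (eq_sym _ (- k)) oppr_eq0 eq_sym.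
case: eqP => // _; exact: theta0.
Qed.

Lemma theta_zhu_deg0 u : theta_zhu th (zcls (deg0 u)) = zcls (deg0 (th u)).
Proof.
rewrite theta_zhuE; apply: (congr1 (cls _)); apply/val_inj.
exact: theta_uproj0.
Qed.

(* Uses theta(u) v = theta(theta(v) u). *)
Lemma lowest_theta_negid (N : lmodType (zhu V)) k u (y : Phi N) :
  negid k u -> Phi_lowest (th u *: y) = 0.
Proof.
move=> ku; elim/Phi_ind: y => [|d v n dv|y z IHy IHz].
- by rewrite scaler0; apply: Phi_lowest0.
- rewrite tens_scale Phi_lowest_tens.
  rewrite -[v](theta_involutive th) -thetaM -theta_zhu_deg0.
  rewrite (zcls_deg0_negid (negid_mull (theta_ugr th dv) ku)).
  rewrite (_ : theta_zhu th 0 = 0) ?scale0r //.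
  by apply: (addrI (theta_zhu th 0)); rewrite -theta_zhuD !addr0.
- by rewrite scalerDr Phi_lowestD IHy IHz addr0.
Qed.

End ThetaZhu.

Section Contragredient.
Variables (K : numClosedFieldType) (V : voa K) (th : theta_antiaut V) (W : gmod V).
Implicit Types f g : contragredient W th.

Lemma contra_lin f k (x y : restr W) : f (k *: x + y) = k * f x + f y.
Proof. by have /asboolP[] := contra_funP f. Qed.

Lemma contraD f x y : f (x + y) = f x + f y.
Proof. by have := contra_lin f 1 x y; rewrite scale1r mul1r. Qed.

Lemma contra0 f : f 0 = 0.
Proof. by apply: (addrI (f 0)); rewrite -contraD !addr0. Qed.

Lemma contra_eventually f : exists D, forall d w, (D <= d)%N -> gpc d w -> f w = 0.
Proof. by have /asboolP[] := contra_funP f. Qed.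

Lemma contra_scaleE u f w : (u *: f) w = f (th u *: w).
Proof. by []. Qed.

Lemma contra_addE f g w : (f + g) w = f w + g w.
Proof. by []. Qed.

Lemma contra_ext f g : (forall w, f w = g w) -> f = g.
Proof. by move=> fg; apply/val_inj/funext. Qed.

Lemma contra_sumE (I : Type) (s : seq I) (F : I -> contragredient W th) w :
  (\sum_(i <- s) F i) w = \sum_(i <- s) F i w.
Proof. by elim/big_rec2: _ => [//|i y x _ <-]. Qed.

Lemma contra_scalE k f w : ((scal k : envU V) *: f) w = k * f w.
Proof.
rewrite contra_scaleE theta_scal.
exact (scalar_scale (contra_lin f) k w).
Qed.

End Contragredient.

Section PhiProjection.
Variables (K : numClosedFieldType) (V : voa K) (M : lmodType (zhu V)).

Definition Phi_proj (d : nat) (x : Phi M) : Phi M :=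
  dproj (gpc (g := Phi M) : nat -> set (restr (Phi M))) d x.

Lemma Phi_proj_in d x : gpc d (Phi_proj d x).
Proof. exact (dproj_in (Phi_direct_sum M) d x). Qed.

Lemma Phi_proj_linear d k (x y : restr (Phi M)) :
  Phi_proj d (k *: x + y) = k *: (Phi_proj d x : restr (Phi M)) + Phi_proj d y.
Proof. exact (dproj_lin (Phi_direct_sum M) d k x y). Qed.

Lemma Phi_projD d x y : Phi_proj d (x + y) = Phi_proj d x + Phi_proj d y.
Proof. exact (dprojD (Phi_direct_sum M) d x y). Qed.

Lemma Phi_proj0 d : Phi_proj d 0 = 0.
Proof. exact (dproj0 (Phi_direct_sum M) d). Qed.

Lemma Phi_proj_homog d e x : gpc e x -> Phi_proj d x = if d == e then x else 0.
Proof.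
move=> ex.
exact (dproj_homog (Phi_direct_sum M) (ex : (gpc (g := Phi M) e : set (restr (Phi M))) x) d).
Qed.

Lemma Phi_proj_id d x : gpc d x -> Phi_proj d x = x.
Proof. by move=> /(Phi_proj_homog d)->; rewrite eqxx. Qed.

Lemma Phi_proj_sum x : exists2 s, uniq s & x = \sum_(d <- s) Phi_proj d x.
Proof.
have [s us [_ E]] := dproj_sum (Phi_direct_sum M) x.
by exists s.
Qed.

End PhiProjection.

(** * The canonical map attached to a contravariant pairing *)

Section Pairing.
Variables (K : numClosedFieldType) (V : voa K) (th : theta_antiaut V).
Variables (M N : lmodType (zhu V)) (b : M -> N -> K).
Local Notation U := (envU V).
Hypotheses
  (bl : forall k (m m' : restr M) n, b (k *: m + m') n = k * b m n + b m' n)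
  (br : forall m k (n n' : restr N), b m (k *: n + n') = k * b m n + b m n')
  (badj : forall a m n, b (a *: m) n = b m (theta_zhu th a *: n)).

Let blD m m' n : b (m + m') n = b m n + b m' n.
Proof. by have := bl 1 m m' n; rewrite scale1r mul1r. Qed.
Let brD m n n' : b m (n + n') = b m n + b m n'.
Proof. by have := br m 1 n n'; rewrite scale1r mul1r. Qed.
Let b0r m : b m 0 = 0.
Proof. by apply: (addrI (b m 0)); rewrite -brD !addr0. Qed.

Lemma Phi_lowest_linear k (x y : restr (Phi N)) :
  Phi_lowest (k *: x + y) = k *: (Phi_lowest x : restr N) + Phi_lowest y.
Proof.
apply: etrans (Phi_lowestD _ _) _; congr (_ + _).
exact: (@Phi_lowest_scale _ _ _ (scal k : U0 V) x).
Qed.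

Lemma lowest_functional_subproof m :
  (fun y : Phi N => b m (Phi_lowest y)) \in @contra_pred K V (Phi N).
Proof.
apply/asboolP; split=> [k x y|]; first by rewrite Phi_lowest_linear br.
by exists 1%N => d w d1 dw; rewrite (Phi_lowest_neq dw) ?b0r // -lt0n.
Qed.

Definition lowest_functional m : contragredient (Phi N) th :=
  MkContragredient th (lowest_functional_subproof m).

Definition psi_map : Phi M -> contragredient (Phi N) th :=
  Phi_rec (fun u m => u *: lowest_functional m).

Let psiDl u v m : (u + v) *: lowest_functional m =
  u *: lowest_functional m + v *: lowest_functional m.
Proof. exact: scalerDl. Qed.

Let psiDr u m m' : u *: lowest_functional (m + m') =
  u *: lowest_functional m + u *: lowest_functional m'.
Proof.
rewrite -scalerDr; congr (_ *: _); apply: contra_ext => y.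
by rewrite contra_addE /= blD.
Qed.

Let psibal u (x : U0 V) m : (u * u0val x) *: lowest_functional m =
  u *: lowest_functional (zcls x *: m).
Proof.
rewrite -scalerA; congr (_ *: _); apply: contra_ext => y.
rewrite contra_scaleE /= badj theta_zhuE; congr b.
exact: (Phi_lowest_scale (theta_0 th x)).
Qed.

Let psineg k u m : negid k u -> u *: lowest_functional m = 0.
Proof.
move=> ku; apply: contra_ext => y.
by rewrite contra_scaleE /= (lowest_theta_negid th y ku) b0r.
Qed.

Lemma psi_map_tens u m : psi_map (tens u m) = u *: lowest_functional m.
Proof. exact (Phi_rec_tens psiDl psiDr psibal psineg u m). Qed.

Lemma psi_map_linear : linear psi_map.
Proof.
move=> u x y; rewrite /psi_map (Phi_recD psiDl psiDr psibal psineg); congr (_ + _).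
elim/Phi_ind: x => [|d v m _|x z IHx IHz].
- by rewrite scaler0 (Phi_rec0 psiDl psiDr psibal psineg) scaler0.
- by rewrite tens_scale -/psi_map !psi_map_tens scalerA.
- by rewrite scalerDr !(Phi_recD psiDl psiDr psibal psineg) IHx IHz scalerDr.
Qed.

(** The pairing is left arbitrary so that both canonical maps are instances, with the roles of M and
    its dual exchanged. *)
Lemma canonical_map_ex :
  exists psi : {linear Phi M -> contragredient (Phi N) th}, canonical_map b psi.
Proof.
pose pL := GRing.isLinear.Build _ _ _ _ psi_map psi_map_linear.
pose psi : {linear Phi M -> contragredient (Phi N) th} := HB.pack psi_map pL.
exists psi => m; rewrite [psi _]psi_map_tens scale1r; split=> [e w e0 ew|n] /=.
  by rewrite (Phi_lowest_neq ew e0) b0r.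
by rewrite Phi_lowest_tens1.
Qed.

Section Canonical.
Variables (psi : {linear Phi M -> contragredient (Phi N) th}).
Hypothesis can_psi : canonical_map b psi.

Lemma canonical_tens1 m y : psi (tens 1 m) y = b m (Phi_lowest y).
Proof.
have [pc0 val0] := can_psi m; rewrite -val0.
elim/Phi_ind: y => [|d u n du|y z IHy IHz].
- rewrite contra0 Phi_lowest0 (_ : tens 1 0 = 0) ?contra0 //.
  by apply: (addrI (tens 1 0)); rewrite -tensDr !addr0.
- have [d0|d0] := eqVneq d 0%N.
    by rewrite tens1_lowest //; apply: Phi_pc_tens; rewrite d0 in du.
  have pcd := Phi_pc_tens n du; rewrite (Phi_lowest_neq pcd d0) (pc0 d) //.
  rewrite (_ : tens 1 0 = 0) ?contra0 //.
  by apply: (addrI (tens 1 0)); rewrite -tensDr !addr0.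
- by rewrite Phi_lowestD tensDr !contraD IHy IHz.
Qed.

Lemma canonical_tens u m y : psi (tens u m) y = b m (Phi_lowest (th u *: y)).
Proof.
by rewrite -canonical_tens1 -contra_scaleE -linearZ /= tens_scale mulr1.
Qed.

Lemma canonical_pc d e x y : gpc d x -> gpc e y -> d != e -> psi x y = 0.
Proof.
move=> dx ey de; elim/Phi_pc_ind: x / dx => [|u m du|x x' IHx IHx'].
- by rewrite linear0.
- rewrite canonical_tens; have := gpc_act (theta_ugr th du) ey.
  case E: (_ + _) => [e'|e'] => [H|->]; last by rewrite Phi_lowest0 b0r.
  by rewrite (Phi_lowest_neq H) ?b0r //; apply: contra de => /eqP e0; apply/eqP; lia.
- by rewrite linearD contra_addE IHx IHx' addr0.
Qed.

(** Distinct degrees are orthogonal, which makes the projections self-adjoint. It follows that the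
    kernel of psi is graded. *)
Lemma canonical_proj d x y : psi (Phi_proj d x) y = psi x (Phi_proj d y).
Proof.
elim/Phi_ind: x => [|i u m iu|x x' IHx IHx']; last first.
- by rewrite Phi_projD !linearD !contra_addE IHx IHx'.
- have pi := Phi_pc_tens m iu; rewrite (Phi_proj_homog d pi).
  elim/Phi_ind: y => [|j v n jv|y y' IHy IHy']; last first.
  + by rewrite Phi_projD !contraD IHy IHy'.
  + have pj := Phi_pc_tens n jv; rewrite (Phi_proj_homog d pj).
    have [ij|ij] := eqVneq i j.
      by rewrite ij; case: eqP => _ //; rewrite linear0 contra0.
    have H := canonical_pc pi pj ij.
    by case: eqP => _; case: eqP => _; rewrite ?H ?contra0 ?linear0.
  + by rewrite Phi_proj0 !contra0.
- by rewrite Phi_proj0 linear0.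
Qed.

End Canonical.
End Pairing.

Section CanonicalPair.
Variables (K : numClosedFieldType) (V : voa K) (th : theta_antiaut V).
Variables (M N : lmodType (zhu V)) (b : M -> N -> K).
Local Notation U := (envU V).
Hypotheses
  (bl : forall k (m m' : restr M) n, b (k *: m + m') n = k * b m n + b m' n)
  (br : forall m k (n n' : restr N), b m (k *: n + n') = k * b m n + b m n')
  (badj : forall a m n, b (a *: m) n = b m (theta_zhu th a *: n)).
Variables (psi : {linear Phi M -> contragredient (Phi N) th})
  (psi' : {linear Phi N -> contragredient (Phi M) th}).
Hypotheses (can_psi : canonical_map b psi) (can_psi' : canonical_map (fun n m => b m n) psi').

Let br' n k (m m' : restr M) : b (k *: m + m') n = k * b m n + b m' n.
Proof. exact: bl. Qed.

(** Contravariance of b turns <(theta(v) u)_0 m, n> into <m, theta(theta(v) u)_0 n>, and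
    theta(theta(v) u) = theta(u) v. *)
Lemma canonical_sym x y : psi' y x = psi x y.
Proof.
elim/Phi_ind: x => [|d u m du|x x' IHx IHx']; last first.
- by rewrite contraD linearD contra_addE IHx IHx'.
- elim/Phi_ind: y => [|e v n ev|y y' IHy IHy']; last first.
  + by rewrite contraD linearD contra_addE IHy IHy'.
  + rewrite (canonical_tens can_psi) (canonical_tens can_psi').
    rewrite !tens_scale !Phi_lowest_tens badj theta_zhu_deg0 thetaM theta_involutive.
    by [].
  + by rewrite linear0 contra0.
- by rewrite linear0 contra0.
Qed.

Lemma simple_of_injective : simple_zhu_module M -> injective psi -> simple_module (Phi M).
Proof.
move=> [[m0 m0_neq0] Msimple] inj; split; first exact: Phi_admissible.
  exists (tens 1 m0); apply: contra_neq m0_neq0 => E.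
  by rewrite -(Phi_lowest_tens1 m0) E Phi_lowest0.
move=> S gS; have [SS _ Sgr] := gS.
have [H|/existsNP[s /not_implyP[Ss /eqP s0]]] := pselect (forall w, S w -> w = 0); first by left.
right.
have [u [m [Sm m_neq0]]] : exists (u : U) m, S (tens 1 m) /\ m != 0.
  apply: contrapT => none; move/eqP: s0; apply.
  suff : psi s = 0 by rewrite -(linear0 psi) => /inj.
  apply: contra_ext => y; rewrite -[RHS]/(0 : K).
  elim/Phi_ind: y => [|e v n ev|y y' IHy IHy']; last first.
  - by rewrite contraD IHy IHy' addr0.
  (* The factor v moves to the other side: psi s (v (x) n) = psi (theta(v) s) (1 (x) n). Only the
     degree 0 component of theta(v) s, which lies in S again, pairs with 1 (x) n. *)
  - rewrite -[v]mulr1 -tens_scale -[v](theta_involutive th) -contra_scaleE -linearZ /=.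
    have [l [f [Hf ->]]] := Sgr _ (graded_submodule_scale (th v) gS Ss).
    rewrite linear_sum contra_sumE big1 // => d _; have [pd Sd] := Hf d.
    have [d0|d0] := eqVneq d 0%N; last first.
      exact (canonical_pc br can_psi pd (Phi_pc0_tens1 n) d0).
    rewrite d0 in pd Sd *; have [fd0|fd0] := eqVneq (Phi_lowest (f 0%N)) 0.
      rewrite -(tens1_lowest pd) fd0 (canonical_tens1 can_psi).
      by have := bl (-1) 0 0 (Phi_lowest (tens 1 n)); rewrite scaler0 addr0 mulN1r addNr.
    by case: none; exists 1, (Phi_lowest (f 0%N)); rewrite tens1_lowest.
  - exact: contra0.
(* The degree 0 part of S is a nonzero submodule of M, so it is all of M, which generates
   [Phi M]. *)
pose S0 : set M := [set m | S (tens 1 m)].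
have [||S00|S0all] := Msimple S0.
- rewrite /S0 /= (_ : tens 1 0 = 0); first by case: SS.
  by apply: (addrI (tens 1 0)); rewrite -tensDr !addr0.
- elim/cls_ind=> a n n' Sn Sn'; rewrite /S0 /= tensDr -[cls _ _]/(zcls a) -tens1_scale.
  exact: (subspaceD SS (graded_submodule_scale _ gS Sn) Sn').
- by rewrite (S00 m Sm) eqxx in m_neq0.
elim/Phi_ind=> [|d v n _|x y Sx Sy]; first by case: SS.
  by rewrite -[v]mulr1 -tens_scale; apply: graded_submodule_scale gS (S0all n).
exact: (subspaceD SS Sx Sy).
Qed.

(** The kernel of psi is a graded submodule, and a nonzero value of b keeps it from being
    everything. *)
Lemma injective_of_simple m n : b m n != 0 -> simple_module (Phi M) -> injective psi.
Proof.
move=> bmn [_ _ simp]; pose S : set (Phi M) := [set x | psi x = 0].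
have gS : graded_submodule S.
  split.
  - split=> [|k x y Sx Sy]; first exact: linear0.
    have : psi ((scal k : U) *: (x : Phi M) + y) = 0.
      by rewrite linearP (Sx : psi x = 0) (Sy : psi y = 0) scaler0 addr0.
    exact.
  - move=> a i w Sw.
    have : psi (umode a i *: (w : Phi M)) = 0 by rewrite linearZ /= (Sw : psi w = 0) scaler0.
    exact.
  - move=> w Sw; have [s us wE] := Phi_proj_sum w.
    exists s, (fun d => Phi_proj d w); split=> // d; split; first exact: Phi_proj_in.
    apply: contra_ext => y; rewrite (canonical_proj br can_psi) (Sw : psi w = 0).
    by [].
have [S0|Sall] := simp S gS.
  move=> x y xy; apply/eqP; rewrite -subr_eq0; apply/eqP/S0.
  by rewrite /S /= linearB xy subrr.
move/eqP: bmn; case; have [_ <-] := can_psi m.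
by rewrite (Sall _ : psi _ = 0).
Qed.

(** Injectivity of psi' means that the functionals psi x separate the points of [Phi N]. On a
    finite-dimensional piece finitely many of them do, so f is a combination of these there. As f
    vanishes in large degrees, finitely many local solutions, each cut down to its degree, add up to
    a preimage. *)
Lemma surjective_of_injective : injective psi' ->
  (forall d, findim (gpc (g := Phi N) d : set (restr (Phi N)))) ->
  forall f, exists x, psi x = f.
Proof.
move=> inj fin f.
have local d : exists x, forall y, gpc d y -> psi x y = f y.
  pose F (g : restr (Phi N) -> K) := exists x, forall y, g y = psi x y.
  have Flin g : F g -> scalar g.
    by move=> [x gx] k y z; rewrite !gx; apply: contra_lin.
  have Fsep (y : restr (Phi N)) : gpc (g := Phi N) d y -> y != 0 -> exists2 g, F g & g y != 0.
    move=> _ y0; apply: contrapT => none; move/eqP: y0; apply.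
    suff : psi' y = 0 by rewrite -(linear0 psi') => /inj.
    apply: contra_ext => x; rewrite canonical_sym -[RHS]/(0 : K).
    apply/eqP; apply: contrapT => /negP xy; apply: none.
    by exists (psi x) => //; exists x.
  have subd := gpc_subspace (Phi N) d.
  have [r [fs [Ffs sep]]] := separating_seq subd (fin d) Flin Fsep.
  have [|c cE] := functional_combination subd (fun i => Flin _ (Ffs i)) (contra_lin f) (fs := fs).
    by move=> y dy H; rewrite (sep y dy H); apply: contra0.
  have [xs Hxs] := choice Ffs.
  exists (\sum_i (scal (c i) : U) *: xs i) => y dy.
  rewrite linear_sum contra_sumE [RHS](cE y dy); apply: eq_bigr => i _.
  by rewrite (linearZZ psi) contra_scalE Hxs.
have [xs Hxs] := choice local; have [D HD] := contra_eventually f.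
exists (\sum_(d < D) Phi_proj d (xs d)); apply: contra_ext => y.
elim/Phi_ind: y => [|e v n ev|y y' IHy IHy']; last first.
- by rewrite !contraD IHy IHy'.
- have pe := Phi_pc_tens n ev; rewrite linear_sum contra_sumE.
  under eq_bigr do rewrite (canonical_proj br can_psi) (Phi_proj_homog _ pe).
  have [eD|De] := ltnP e D.
    rewrite (bigD1 (Ordinal eD)) //= eqxx (Hxs e _ pe) big1 ?addr0 // => i.
    by rewrite -val_eqE /= => /negPf->; rewrite contra0.
  rewrite (HD e _ De pe) big1 // => i _; rewrite ifN_eq ?contra0 //.
  by rewrite neq_ltn (leq_trans (ltn_ord i) De).
- by rewrite !contra0.
Qed.

(* For independent e_i in Phi(M)_d choose y_i in Phi(N)_d dual to the e_i, such
   that each x pairs to zero with almost all y_i (F sends e_i to 'X^i).  The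
   functional with value 1 on every y_i is then not represented by any x. *)
Lemma findim_of_surjective d : (forall f, exists x, psi x = f) ->
  (forall f, exists y, psi' y = f) -> findim (gpc (g := Phi M) d : set (restr (Phi M))).
Proof.
move=> surj surj'; apply: contrapT => inf.
have [e ed e_indep] := lin_indep_ex (gpc_subspace (Phi M) d) inf.
have [F FE] := lin_indep_extension (fun i => 'X^i : {poly K}) e_indep.
pose f0 i (x : Phi M) : K := (F (Phi_proj d x))`_i.
have f0P i : f0 i \in @contra_pred K V (Phi M).
  apply/asboolP; split=> [k x y|].
    by rewrite /f0 Phi_proj_linear linearP coefD coefZ.
  exists d.+1 => j w dj jw; rewrite /f0 (Phi_proj_homog d jw) ifN_eq ?linear0 ?coef0 //.
  by rewrite neq_ltn dj.
have [z zE] := choice (fun i => surj' (MkContragredient th (f0P i))).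
pose y i := Phi_proj d (z i).
have yE i x : psi' (y i) x = f0 i x.
  rewrite (canonical_proj (b := fun n m => b m n) br' can_psi') zE /= /f0.
  by rewrite (Phi_proj_id (Phi_proj_in d x)).
have y_indep : lin_indep (y : nat -> restr (Phi N)).
  move=> n c cy i ni.
  have : psi' (\sum_(j < n) (scal (c j) : U) *: y j) (e i) = 0.
    by rewrite (cy : \sum_(j < n) (scal (c j) : U) *: y j = 0) linear0.
  rewrite linear_sum contra_sumE => <-.
  rewrite (bigD1 (Ordinal ni)) //= big1 ?addr0 => [|j ji].
    by rewrite (linearZZ psi') contra_scalE yE /f0 (Phi_proj_id (ed i)) FE coefXn eqxx mulr1.
  rewrite (linearZZ psi') contra_scalE yE /f0 (Phi_proj_id (ed i)) FE coefXn.
  by rewrite -val_eqE /= in ji; rewrite (negPf ji) mulr0.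
have [G GE] := lin_indep_extension (fun=> 1 : K^o) y_indep.
pose g0 (w : Phi N) : K := G (Phi_proj d w).
have g0P : g0 \in @contra_pred K V (Phi N).
  apply/asboolP; split=> [k x w|]; first by rewrite /g0 Phi_proj_linear linearP.
  exists d.+1 => j w dj jw; rewrite /g0 (Phi_proj_homog d jw) ifN_eq ?linear0 //.
  by rewrite neq_ltn dj.
have [x xE] := surj (MkContragredient th g0P).
have one i : f0 i x = 1.
  rewrite -yE canonical_sym xE /= /g0 (Phi_proj_id (Phi_proj_in d (z i))).
  exact: GE.
move: (one (size (F (Phi_proj d x)))); rewrite /f0 nth_default // => /esym/eqP.
by rewrite oner_eq0.
Qed.

End CanonicalPair.

(** * Simple ordinary modules *)

Lemma restr_scaleE (K : pzRingType) (B : pzAlgType K) (W : lmodType B) k (w : restr W) :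
  k *: w = (scal k : B) *: (w : W).
Proof. by []. Qed.

(** Schur's lemma: z has an eigenvector, and an eigenspace of a central element is a submodule. *)
Lemma central_scalar (K : closedFieldType) (A : pzAlgType K) (M : lmodType A) (z : A) (m0 : M) :
  (forall a, z * a = a * z) -> findim ([set: M] : set (restr M)) -> m0 != 0 ->
  (forall S : set M, S 0 -> (forall (a : A) m n, S m -> S n -> S (a *: m + n)) ->
    (forall m, S m -> m = 0) \/ (forall m, S m)) ->
  exists l : K, forall m : M, z *: m = (scal l : A) *: m.
Proof.
move=> zC fin m0_neq0 Msimple.
pose T (m : restr M) : restr M := z *: (m : M).
have Tlin : linear T.
  by move=> k m n; rewrite /T !restr_scaleE scalerDr !scalerA -scalC.
pose TL := GRing.isLinear.Build _ _ _ _ T Tlin.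
pose TT : {linear restr M -> restr M} := HB.pack T TL.
have [l [y [y0 Ty]]] := eigenvector_ex TT fin m0_neq0.
exists l; pose S : set M := [set m | z *: m = (scal l : A) *: m].
have [||S0|//] := Msimple S.
- by rewrite /S /= !scaler0.
- move=> a m n Sm Sn; rewrite /S /= !scalerDr (Sn : z *: n = _).
  by rewrite !scalerA zC scalC -!scalerA (Sm : z *: m = _).
- by move/eqP: y0; case; apply: S0; apply: Ty.
Qed.

Section Ordinary.
Variables (K : numClosedFieldType) (V : voa K) (M : lmodType (zhu V)).
Local Notation U := (envU V).

Lemma conf_U0 : umode (conf V) 1 \in @U0_pred K V.
Proof. exact/asboolP/ugr_conf. Qed.

Definition zhu_conf : zhu V := zcls (MkU0 conf_U0).

Lemma zhu_conf_central a : zhu_conf * a = a * zhu_conf.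
Proof.
elim/cls_ind: a => x; rewrite /zhu_conf /zcls.
apply: etrans (esym (clsM _ _ _)) _; apply: etrans _ (clsM _ _ _).
apply: (congr1 (cls _)); apply/val_inj => /=.
have := ugr_ad (asboolP _ (u0valP x)); rewrite scal0 mul0r.
by move/eqP; rewrite subr_eq0 => /eqP.
Qed.

Lemma zhu_schur : simple_zhu_module M -> findim ([set: M] : set (restr M)) ->
  exists l : K, forall m : M, zhu_conf *: m = (scal l : zhu V) *: m.
Proof.
move=> [[m0 m0_neq0] Msimple] fin.
exact (central_scalar zhu_conf_central fin m0_neq0 Msimple).
Qed.

Section Eigenvalues.
Variable l : K.
Hypothesis conf_l : forall m : M, zhu_conf *: m = (scal l : zhu V) *: m.

(** In L_0 u = [L_0, u] + u L_0 the first term contributes d and the second, moved across the tensor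
    sign, contributes l. *)
Lemma L0_Phi_pc d (w : restr (Phi M)) : gpc (g := Phi M) d w ->
  wmode (W := Phi M) (conf V) 1 w = (l + d%:R) *: w.
Proof.
rewrite /wmode -[RHS]/((scal (l + d%:R) : U) *: (w : Phi M)).
elim/Phi_pc_ind: w / => [|u m du|x y IHx IHy].
- by rewrite !scaler0.
- rewrite tens_scale; have := ugr_ad du => /eqP; rewrite subr_eq => /eqP->.
  rewrite tensDl (tens_balanced u (MkU0 conf_U0) m) -/zhu_conf conf_l.
  rewrite -(tens_balanced u (scal l : U0 V) m) scalD scalerDl addrC !tens_scale.
  by rewrite (scalC l u).
- by rewrite !scalerDr IHx IHy.
Qed.

Let T (w : restr (Phi M)) : restr (Phi M) := wmode (W := Phi M) (conf V) 1 w.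

Let T_linear : linear T.
Proof. by move=> k x y; apply: wmode_linr. Qed.

HB.instance Definition _ := GRing.isLinear.Build K (restr (Phi M)) (restr (Phi M)) _ T T_linear.

Let ev (d : nat) : K := l + d%:R.

Let ev_inj : injective ev.
Proof. by move=> i j /addrI/eqP; rewrite eqr_nat => /eqP. Qed.

Lemma L0_eigenspace_Phi d : L0_eigenspace (W := Phi M) (l + d%:R) = gpc (g := Phi M) d.
Proof.
apply/seteqP; split=> w; last exact: L0_Phi_pc.
exact: (eigen_homog (T := T) (Phi_direct_sum M) L0_Phi_pc ev_inj).
Qed.

Lemma L0_eigenspace_eq0 k (w : restr (Phi M)) : (forall d : nat, k != l + d%:R) ->
  L0_eigenspace (W := Phi M) k w -> w = 0.
Proof. exact: (eigen_eq0 (T := T) (Phi_direct_sum M) L0_Phi_pc). Qed.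

Lemma L0_direct_sum : direct_sum (@L0_eigenspace K V (Phi M)).
Proof.
have sub k : subspace (@L0_eigenspace K V (Phi M) k).
  have E w : @L0_eigenspace K V (Phi M) k w <-> T w = k *: w by [].
  split=> [|c x y /E Tx /E Ty]; apply/E; first by rewrite linear0 scaler0.
  by rewrite T_linear Tx Ty scalerDr !scalerA mulrC.
have span (w : restr (Phi M)) : exists (s : seq K) (f : K -> restr (Phi M)),
    (forall i, @L0_eigenspace K V (Phi M) i (f i)) /\ w = \sum_(i <- s) f i.
  apply: (direct_sum_span sub) => S SS eS.
  have [s _ ->] := Phi_proj_sum (w : Phi M).
  apply: (subspace_sum SS) => d _; apply: (eS (l + d%:R)).
  by rewrite L0_eigenspace_Phi; apply: Phi_proj_in.
exact (direct_sum_eigen (T := T) (ev := id) (@inj_id K) sub span (fun _ _ => id)).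
Qed.

Lemma ordinary_of_findim :
  (forall d, findim (gpc (g := Phi M) d : set (restr (Phi M)))) -> ordinary_module (Phi M).
Proof.
move=> fin; split.
- exact: Phi_weak_module.
- exact: L0_direct_sum.
- move=> k; have [[d ->]|kN] := pselect (exists d : nat, k = l + d%:R).
    by rewrite L0_eigenspace_Phi.
  exists 0%N, (fun=> 0) => w kw; exists (fun=> 0); rewrite big_ord0.
  by apply: L0_eigenspace_eq0 kw => d; apply/eqP=> kE; apply: kN; exists d.
(* The eigenvalues lie among l, l + 1, l + 2, and so on. If l = k + z, there are none of the form k
   + n with n < z; if l - k is no integer, no k + n is an eigenvalue and any bound will do. *)
- move=> k; have [[z zE]|kN] := pselect (exists z : int, k + z%:~R = l).
    exists z => n nz w; apply: L0_eigenspace_eq0 => d; rewrite -zE -addrA.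
    rewrite (inj_eq (addrI k)) -[d%:R]/(d%:Z%:~R) -intrD eqr_int.
    by apply/eqP; lia.
  exists 0 => n _ w; apply: L0_eigenspace_eq0 => d; apply/eqP => E; apply: kN.
  exists (n - d%:Z); rewrite intrB addrA E -[d%:Z%:~R]/(d%:R).
  by rewrite addrK.
Qed.

Lemma findim_of_ordinary : ordinary_module (Phi M) ->
  forall d, findim (gpc (g := Phi M) d : set (restr (Phi M))).
Proof. by move=> [_ _ fin _] d; rewrite -L0_eigenspace_Phi; apply: fin. Qed.

End Eigenvalues.

Lemma findim_lowest : findim (gpc (g := Phi M) 0 : set (restr (Phi M))) ->
  findim ([set: M] : set (restr M)).
Proof.
move=> [n [b Hb]]; exists n, (fun i => Phi_lowest (b i)) => m _.
have [c E] := Hb _ (Phi_pc0_tens1 m); exists c.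
rewrite -[LHS]Phi_lowest_tens1 E.
elim/big_rec2: _ => [|i x y _ <-]; first exact: Phi_lowest0.
exact: Phi_lowest_linear.
Qed.

End Ordinary.

(** * Duals of modules over the Zhu algebra *)

Section Dual.
Variables (K : numClosedFieldType) (V : voa K) (th : theta_antiaut V).
Variable M : lmodType (zhu V).
Local Notation D := (dualmod M th).

Lemma dual_lin (f : D) k (x y : restr M) : f (k *: x + y) = k * f x + f y.
Proof. by have /asboolP := dual_funP f; apply. Qed.

Lemma dual_scaleE a (f : D) m : (a *: f) m = f (theta_zhu th a *: m).
Proof. by []. Qed.

Lemma dual_scalE k (f : restr D) (m : M) : (k *: f : restr D) m = k * f m.
Proof.
rewrite -[LHS]/(f (theta_zhu th (scal k) *: m)) theta_zhu_scal.
exact (scalar_scale (dual_lin f) k m).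
Qed.

Lemma dual_linear_left k (f g : restr D) (m : M) : (k *: f + g : restr D) m = k * f m + g m.
Proof. by rewrite -[LHS]/((k *: f : restr D) m + g m) dual_scalE. Qed.

Lemma dual_adjoint (a : zhu V) m (f : D) : f (a *: m) = (theta_zhu th a *: f) m.
Proof. by rewrite dual_scaleE theta_zhu_involutive. Qed.

Lemma dual_separates (m : M) : m != 0 -> exists f : D, f m != 0.
Proof.
move=> m0; have [F Flin Fm] := functional_separates (m0 : (m : restr M) != 0).
have FP : (F : M -> K) \in @functional_pred K V M by apply/asboolP.
by exists (DualMod th FP).
Qed.

Lemma dual_sum r (F : 'I_r -> restr D) (m : M) : (\sum_i F i : restr D) m = \sum_i F i m.
Proof. by elim/big_rec2: _ => [//|i x y _ <-]. Qed.

(** In finite dimension, finitely many members of a separating subspace F already separate points,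
    and every functional is a combination of them. *)
Lemma dual_span (F : set D) : findim ([set: M] : set (restr M)) ->
  subspace (F : set (restr D)) -> (forall m : M, (forall f, F f -> f m = 0) -> m = 0) ->
  forall g, F g.
Proof.
move=> fin SF sep g.
pose G (h : restr M -> K) := exists2 f : D, F f & h = f.
have Glin h : G h -> scalar h by move=> [f _ ->] k x y; apply: dual_lin.
have sT : subspace ([set: M] : set (restr M)) by [].
have Gsep (m : restr M) : setT m -> m != 0 -> exists2 h, G h & h m != 0.
  move=> _ m0; apply: contrapT => none; move/eqP: m0; apply; apply: sep => f Ff.
  apply/eqP; apply: contrapT => /negP fm; apply: none.
  by exists (f : M -> K) => //; exists f.
have [r [fs [Gfs H]]] := separating_seq sT fin Glin Gsep.
have [|c cE] := functional_combination sT (fun i => Glin _ (Gfs i)) (dual_lin g) (fs := fs).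
  by move=> m _ Hm; rewrite (H m I Hm); exact (scalar_zero (dual_lin g)).
have /choice[hs Hhs] : forall i, exists f : D, F f /\ fs i = f.
  by move=> i; have [f Ff E] := Gfs i; exists f.
rewrite (_ : g = \sum_i c i *: (hs i : restr D)).
  by apply: (subspace_sum SF) => i _; apply: subspaceZ SF (Hhs i).1.
apply/val_inj/funext => m; apply: etrans (cE m I) _.
apply: etrans _ (esym (dual_sum (fun i => c i *: (hs i : restr D)) m)).
apply: eq_bigr => i _.
by rewrite dual_scalE (Hhs i).2.
Qed.

Lemma dual_findim : findim ([set: M] : set (restr M)) -> findim ([set: D] : set (restr D)).
Proof.
move=> fin; have sT : subspace ([set: M] : set (restr M)) by [].
pose G (h : restr M -> K) := scalar h.
have Gsep (m : restr M) : setT m -> m != 0 -> exists2 h, G h & h m != 0.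
  by move=> _; apply: functional_separates.
have [r [fs [Gfs H]]] := separating_seq sT fin (fun h (Gh : G h) => Gh) Gsep.
have fsP i : (fs i : M -> K) \in @functional_pred K V M by apply/asboolP/Gfs.
exists r, (fun i => DualMod th (fsP i)) => g _.
have [|c cE] := functional_combination sT Gfs (dual_lin g) (fs := fs).
  by move=> m _ Hm; rewrite (H m I Hm); exact (scalar_zero (dual_lin g)).
exists c; apply/val_inj/funext => m; apply: etrans (cE m I) _.
apply: etrans _ (esym (dual_sum (fun i => c i *: (DualMod th (fsP i) : restr D)) m)).
by apply: eq_bigr => i _; rewrite dual_scalE.
Qed.

(** The annihilator in M of a submodule S of the dual is a submodule. If it is zero, S separates
    points and is everything by finite dimension; if it is M, then S is zero. *)
Lemma dual_simple : simple_zhu_module M -> findim ([set: M] : set (restr M)) ->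
  simple_zhu_module D.
Proof.
move=> [[m0 m0_neq0] Msimple] fin; split.
  have [f fm] := dual_separates m0_neq0; exists f; apply: contraNneq fm => ->.
  by [].
move=> S S0 SS.
have sS : subspace (S : set (restr D)) by split=> // k f g Sf Sg; apply: SS.
have [[f [Sf f0]]|none] := pselect (exists f, S f /\ f <> 0); last first.
  by left=> f Sf; apply: contrapT => f0; apply: none; exists f.
right; apply: (dual_span fin sS).
have [||ann0|annT] := Msimple [set m : M | forall g, S g -> g m = 0].
- by move=> g _; exact (scalar_zero (dual_lin g)).
- move=> a m n Sm Sn g Sg; have := dual_lin g 1 (a *: m) n.
  rewrite scale1r mul1r => ->; rewrite dual_adjoint (Sn g Sg) addr0.
  apply: Sm; rewrite -[_ *: _]addr0; exact: SS.
- by move=> m Hm; apply: ann0.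
- by case: f0; apply/val_inj/funext => m; apply: annT.
Qed.

End Dual.

Lemma injective_surjective_bijective (S T : Type) (f : S -> T) :
  injective f -> (forall y, exists x, f x = y) -> bijective f.
Proof.
move=> inj /choice[g fg]; exists g => // x.
by apply: inj; rewrite fg.
Qed.

(** * The two implications *)

Section Equivalence.
Variables (K : numClosedFieldType) (V : voa K) (th : theta_antiaut V).
Variables (M : lmodType (zhu V)) (simpleM : simple_zhu_module M).
Local Notation D := (dualmod M th).
Local Notation b := (fun (m : M) (f : D) => f m).
Local Notation b' := (fun (f : D) (m : M) => f m).

Let bl k (m m' : restr M) (f : D) : b (k *: m + m') f = k * b m f + b m' f.
Proof. exact: dual_lin. Qed.

Let br m k (f g : restr D) : b m (k *: f + g) = k * b m f + b m g.
Proof. exact: dual_linear_left. Qed.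

Let badj a m f : b (a *: m) f = b m (theta_zhu th a *: f).
Proof. exact: dual_adjoint. Qed.

Let badj' a f m : b' (a *: f) m = b' f (theta_zhu th a *: m).
Proof. by []. Qed.

Let b'l k (f g : restr D) m : b' (k *: f + g) m = k * b' f m + b' g m.
Proof. exact: br. Qed.

Let b'r f k (m m' : restr M) : b' f (k *: m + m') = k * b' f m + b' f m'.
Proof. exact: bl. Qed.

Lemma ordinary_of_findim_pieces (N : lmodType (zhu V)) : simple_zhu_module N ->
  (forall d, findim (gpc (g := Phi N) d : set (restr (Phi N)))) -> ordinary_module (Phi N).
Proof.
move=> sN fin; have [l Hl] := zhu_schur sN (findim_lowest (fin 0%N)).
exact: ordinary_of_findim Hl fin.
Qed.

Lemma simple_ordinary_of_isomorphisms
    (psi : {linear Phi M -> contragredient (Phi D) th})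
    (psi' : {linear Phi D -> contragredient (Phi M) th}) :
  is_psi psi -> is_psi_dual psi' -> bijective psi -> bijective psi' ->
  [/\ simple_module (Phi M) /\ ordinary_module (Phi M),
      simple_module (Phi D) /\ ordinary_module (Phi D)
    & findim ([set: M] : set (restr M))].
Proof.
move=> can can' bij bij'.
have surj f : exists x, psi x = f by case: bij => g _ fg; exists (g f).
have surj' f : exists x, psi' x = f by case: bij' => g _ fg; exists (g f).
(* Finite dimension comes first: it is what allows [dual_simple] to provide simplicity of the dual,
   on which the rest depends. *)
have fin := fun d => findim_of_surjective bl badj can can' d surj surj'.
have fin' := fun d => findim_of_surjective b'l badj' can' can d surj' surj.
have finM := findim_lowest (fin 0%N).
have simpleD : simple_zhu_module D := dual_simple th simpleM finM.
split=> //; split.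
- exact (simple_of_injective bl br can simpleM (bij_inj bij)).
- exact: ordinary_of_findim_pieces.
- exact (simple_of_injective b'l b'r can' simpleD (bij_inj bij')).
- exact: ordinary_of_findim_pieces.
Qed.

Lemma isomorphisms_of_simple_ordinary :
  simple_module (Phi M) -> ordinary_module (Phi M) ->
  simple_module (Phi D) -> ordinary_module (Phi D) ->
  findim ([set: M] : set (restr M)) ->
  (exists psi : {linear Phi M -> contragredient (Phi D) th}, is_psi psi /\ bijective psi) /\
  (exists psi : {linear Phi D -> contragredient (Phi M) th}, is_psi_dual psi /\ bijective psi).
Proof.
move=> sM oM sD oD finM.
have simpleD : simple_zhu_module D := dual_simple th simpleM finM.
have [l Hl] := zhu_schur simpleM finM.
have [l' Hl'] := zhu_schur simpleD (dual_findim th finM).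
have fin := findim_of_ordinary Hl oM; have fin' := findim_of_ordinary Hl' oD.
have [psi can] : exists psi : {linear Phi M -> contragredient (Phi D) th}, is_psi psi.
  exact (canonical_map_ex bl br badj).
have [psi' can'] : exists psi : {linear Phi D -> contragredient (Phi M) th}, is_psi_dual psi.
  exact (canonical_map_ex b'l b'r badj').
(* A functional f with f m nonzero shows that neither canonical map is zero, so simplicity makes
   both injective. *)
have [[m m0] _] := simpleM; have [f fm] := dual_separates th m0.
have inj : injective psi := injective_of_simple br can fm sM.
have inj' : injective psi' := injective_of_simple b'r can' (fm : b' f m != 0) sD.
split; [exists psi|exists psi']; split=> //; apply: injective_surjective_bijective => //.
  exact (surjective_of_injective br badj can can' inj' fin').
exact (surjective_of_injective b'r badj' can' can inj fin).
Qed.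

End Equivalence.

Theorem proposition4p0p8 (R : realType) (V : voa R[i]) (theta : theta_antiaut V)
    (M : lmodType (zhu V)) (simpleM : simple_zhu_module M) :
  ((exists psi :
        {linear Phi M -> contragredient (Phi (dualmod M theta)) theta},
      is_psi psi /\ bijective psi) /\
   (exists psi :
        {linear Phi (dualmod M theta) -> contragredient (Phi M) theta},
      is_psi_dual psi /\ bijective psi))
  <->
  [/\ simple_module (Phi M) /\ ordinary_module (Phi M),
      simple_module (Phi (dualmod M theta)) /\
      ordinary_module (Phi (dualmod M theta))
    & findim ([set: M] : set (restr M))].
Proof.
split=> [[[psi [can bij]] [psi' [can' bij']]]|[[sM oM] [sD oD] finM]].
  exact (simple_ordinary_of_isomorphisms simpleM can can' bij bij').
exact (isomorphisms_of_simple_ordinary simpleM sM oM sD oD finM).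
Qed.
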